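(* Let $\beta=1$ and $\rho>0$, let $k_c(\rho)=\rho^{-1}+2/\sqrt\rho$ and $$r_c(\rho)=\frac{1+2\sqrt\rho}{\rho}\log\left(1+\frac{\rho}{1+2\sqrt\rho}\right)+2\log(1+\sqrt\rho)-1 .$$ For every $r$ with $0<r\le r_c(\rho)$ there exist $k\in(-\infty,k_c(\rho)]$ and $b>0$ such that $$k=\frac{\frac b2-2}{1-\frac{1}{\sqrt{1+\rho b}}},$$ $$r=2(k+1)\log\frac{1+\sqrt{1+\rho b}}{2}-\frac{1}{4\rho}\left(\sqrt{1+\rho b}-1\right)^2-\frac k2\log(1+\rho b).$$ With these $k,b$, the function $$p(x)=\frac{\sqrt{b-x}}{2\pi(1+\rho x)\sqrt x}\left(\rho x+1-\frac{k\rho}{\sqrt{1+\rho b}}\right)\quad(0<x\le b),\qquad p(x)=0\ \text{ for }x>b,$$ is the unique minimizer of $\mathcal{E}$ over $\mathcal{X}_r$, and $$\mathcal{E}_1(r)-\mathcal{E}_0=\frac k2\left(r-\frac b4\right)-\log\frac b4-k\log\frac{1+\sqrt{1+\rho b}}{2}+\frac1{32}(b-4)\left(4\rho^{-1}+3b+12\right).$$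
   Context: An integrable function $p:\mathbb{R}_+\to\mathbb{R}$ is called tame if $\int_0^\infty x|p(x)|\,dx<\infty$ and there is some $\varepsilon>0$ with $\int_0^\infty|p(x)|^{1+\varepsilon}dx<\infty$. Let $\Omega$ be the set of tame functions (identified when equal almost everywhere). For $\beta\ge 1$ and $p\in\Omega$ the energy functional is $$\mathcal{E}[p]=\int_0^\infty x\,p(x)\,dx-(\beta-1)\int_0^\infty p(x)\log x\,dx-\int_0^\infty\!\!\int_0^\infty p(x)p(y)\log|x-y|\,dx\,dy ;$$ here $\beta=1$, so the middle term is absent. $\mathcal{X}=\{p\in\Omega: p\ge0,\ \int_0^\infty p(x)\,dx=1\}$ and, for given $\rho>0$ and $r>0$, $\mathcal{X}_r=\{p\in\mathcal{X}:\int_0^\infty p(x)\log(1+\rho x)\,dx=r\}$. Set $\mathcal{E}_0=\inf_{q\in\mathcal{X}}\mathcal{E}[q]$ and $\mathcal{E}_1(r)=\inf_{q\in\mathcal{X}_r}\mathcal{E}[q]$. Here $\log$ is the natural logarithm. *)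

(* Defs.v *)
From mathcomp Require Import all_boot all_order all_algebra.
From mathcomp Require Import all_classical all_reals all_analysis.
Set Implicit Arguments.
Unset Strict Implicit.
Unset Printing Implicit Defensive.
Import Order.TTheory GRing.Theory Num.Theory.
Import numFieldNormedType.Exports.

Local Open Scope classical_set_scope.
Local Open Scope ring_scope.

(* Functions on R_+ are total functions R -> R of which only the restriction
   to [Rplus] matters: every integral is over [Rplus] and every pointwise
   condition is required almost everywhere on [Rplus]. Elements of Omega are
   represented by functions, so equality in Omega is
   [p = q %[ae lebesgue_measure in Rplus]]. *)
Definition Rplus (R : realType) : set R := `[0, +oo[.

Definition tame (R : realType) (p : R -> R) : Prop :=
  [/\ (@lebesgue_measure R).-integrable (@Rplus R) (EFin \o p),
      (\int[@lebesgue_measure R]_(x in @Rplus R) (x * `|p x|)%:E < +oo)%E &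
      exists2 eps : R, 0 < eps &
        (\int[@lebesgue_measure R]_(x in @Rplus R)
           (`|p x| `^ (1 + eps))%:E < +oo)%E].

(* [ln] is 0 outside the positive reals, so the integrands below vanish at
   x = 0 and on the diagonal x = y, which are null sets. *)
Definition energy (R : realType) (beta : R) (p : R -> R) : \bar R :=
  (\int[@lebesgue_measure R]_(x in @Rplus R) (x * p x)%:E
   - (beta - 1)%:E *
     \int[@lebesgue_measure R]_(x in @Rplus R) (p x * ln x)%:E
   - \int[@lebesgue_measure R]_(x in @Rplus R)
       \int[@lebesgue_measure R]_(y in @Rplus R)
         (p x * p y * ln `|x - y|)%:E)%E.

Definition densities (R : realType) : set (R -> R) :=
  [set p | [/\ tame p,
    {ae @lebesgue_measure R, forall x, @Rplus R x -> 0 <= p x} &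
    (\int[@lebesgue_measure R]_(x in @Rplus R) (p x)%:E = 1)%E]].

Definition densities_at (R : realType) (rho r : R) : set (R -> R) :=
  [set p | @densities R p /\
    (\int[@lebesgue_measure R]_(x in @Rplus R)
       (p x * ln (1 + rho * x))%:E = r%:E)%E].

Definition minimizer (R : realType) (F : (R -> R) -> \bar R)
    (A : set (R -> R)) (p : R -> R) : Prop :=
  A p /\ forall q, A q -> (F p <= F q)%E.

Definition unique_minimizer (R : realType) (F : (R -> R) -> \bar R)
    (A : set (R -> R)) (p : R -> R) : Prop :=
  minimizer F A p /\
  forall q, minimizer F A q -> q = p %[ae @lebesgue_measure R in @Rplus R].

Definition E0 (R : realType) (beta : R) : \bar R :=
  ereal_inf [set energy beta q | q in @densities R].

Definition E1 (R : realType) (beta rho r : R) : \bar R :=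
  ereal_inf [set energy beta q | q in densities_at rho r].

Definition k_c (R : realType) (rho : R) : R := rho^-1 + 2 / Num.sqrt rho.

Definition r_c (R : realType) (rho : R) : R :=
  (1 + 2 * Num.sqrt rho) / rho * ln (1 + rho / (1 + 2 * Num.sqrt rho))
  + 2 * ln (1 + Num.sqrt rho) - 1.

Definition kb_system (R : realType) (rho r k b : R) : Prop :=
  k = (b / 2 - 2) / (1 - 1 / Num.sqrt (1 + rho * b)) /\
  r = 2 * (k + 1) * ln ((1 + Num.sqrt (1 + rho * b)) / 2)
      - 1 / (4 * rho) * (Num.sqrt (1 + rho * b) - 1) ^+ 2
      - k / 2 * ln (1 + rho * b).

Definition opt_density (R : realType) (rho k b : R) (x : R) : R :=
  if (0 < x) && (x <= b) then
    Num.sqrt (b - x) / (2 * pi * (1 + rho * x) * Num.sqrt x)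
    * (rho * x + 1 - k * rho / Num.sqrt (1 + rho * b))
  else 0.

(* Main.v *)
Require Import Defs.
From HB Require Import structures.
From mathcomp Require Import all_boot all_order all_algebra.
From mathcomp Require Import all_classical all_reals all_analysis.
From mathcomp Require Import measurable_realfun ring lra.
Set Implicit Arguments.
Unset Strict Implicit.
Unset Printing Implicit Defensive.
Import Order.TTheory GRing.Theory Num.Theory.
Import numFieldNormedType.Exports.
Local Open Scope classical_set_scope.
Local Open Scope ring_scope.

(* Minimality rests on the Euler-Lagrange inequality: with N(x, y) = x + y -
   ln |x - y| >= 0, the potential of p satisfies U(x) >= x / 2 +
   (k / 2) ln (1 + rho x) + const on the half-line, with equality on [0, b].
   Bounding the cross energy of q and p by it gives E[q] - E[p] >= D, where D is
   the logarithmic energy of the neutral signed measure q - p.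
   D is nonnegative because ln T - ln u + u / T - 1 (0 < u <= T) is the Gram
   kernel of the features 1[0 < t <= T, z < x <= z + t] / t, and it tends to
   -ln u, up to a constant, as T grows; if D = 0 all increments of the two
   distribution functions over short intervals agree, whence q = p.
   The potential of p is computed by writing p as a mixture of arcsine laws of
   the intervals [0, a], 0 < a < b.  For the arcsine law of [0, 1] the error
   between the potential and its expected value is bounded and doubles under
   x |-> (2 x - 1)^2, hence vanishes. *)

(** * Integration and calculus tools *)

Section lebesgue_tools.
Context {R : realType}.
Local Notation mu := (@lebesgue_measure R).
Implicit Types (a b c d x y : R).

(** By partial fractions [p] is a mixture whose weight, up to the factor [1 / 4], is
    [1 - k * rho * (1 + rho * a) ^ (-3/2)]. The weight is dictated by the target: integrating the
    Green function of [[0, a]] at [x] over [0 < a < x] gives [2 * x] with constant weight and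
    [2 / rho * ln (1 + rho * x)] with [mix_weight], that is, the linear term of the energy and the
    constraint function. Stopping at [b < x] leaves the potential above its Euler-Lagrange value
    because the omitted weights are nonnegative; here, as for [0 <= p], the hypothesis
    [k <= k_c rho] enters, in the form [k * rho <= sqrt (1 + rho * b)]. The first equation for
    [k, b] says that [p] has mass 1, the second that its logarithmic moment is [r]. The lower bound
    is [E[q] >= E[p] + k (L - r)] for every density [q] with logarithmic moment [L], so it serves
    the constrained problem and, with [k = 0], the free one. The logarithm has no sign and
    finiteness of the energies has to be proved; hence most identities are first integrated between
    nonnegative functions in the extended reals, and subtraction waits until the terms are
    finite. *)

Lemma ge0_integral_affine (f : R -> \bar R) c d : c != 0 ->
  measurable_fun [set: R] f -> (forall x, 0 <= f x)%E ->
  (\int[mu]_x f x = `|c|%:E * \int[mu]_x f (c * x + d)%R)%E.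
Proof.
move=> c0 mf f0.
have nc0 : 0 < `|c| by rewrite normr_gt0.
pose phi : measurableTypeR R -> measurableTypeR R := fun x => c * x + d.
have mphi : measurable_fun setT phi.
  by apply: measurable_funD => //; exact: measurable_funM.
pose pf : {measure set (measurableTypeR R) -> \bar R} :=
  measure_function_pushforward__canonical__measure_function_Measure mu mphi.
pose nu : {measure set (measurableTypeR R) -> \bar R} :=
  [the {measure set _ -> \bar R} of mscale (NngNum (ltW nc0)) pf].
(* Lebesgue measure is determined by its values on the intervals []u, v]]; for [c < 0] the preimage
   is closed on the left instead, with the same length. *)
have munu : forall A, measurable A -> mu A = nu A.
  apply: (@lebesgue_measure_unique R nu) => _ [[u v]] _ <-.
  rewrite /nu/= /mscale/= /pushforward.
  have [cp|cn] := ltP 0 c.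
    have -> : phi @^-1` `]u, v] = `](u - d) / c, (v - d) / c]%classic.
      apply/seteqP; split => x /=; rewrite /phi !in_itv/= ltr_pdivrMr// ler_pdivlMr//.
        by rewrite ltrBlDr lerBrDr mulrC.
      by rewrite ltrBlDr lerBrDr mulrC.
    rewrite !lebesgue_measure_itv/= !lte_fin ltr_pM2r ?invr_gt0// ltrD2r.
    case: ifPn => uv; last by rewrite mule0.
    rewrite -EFinD -EFinM gtr0_norm//; congr EFin; field; exact: lt0r_neq0.
  have {}cn : c < 0 by rewrite lt_neqAle c0.
  have -> : phi @^-1` `]u, v] = `[(v - d) / c, (u - d) / c[%classic.
    by apply/seteqP; split => x /=; rewrite /phi !in_itv/= ltr_ndivlMr// ler_ndivrMr//
      ltrBlDr lerBrDr mulrC andbC.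
  rewrite !lebesgue_measure_itv/= !lte_fin ltr_nM2r ?invr_lt0// ltrD2r.
  case: ifPn => uv; last by rewrite mule0.
  rewrite -EFinD -EFinM ltr0_norm//; congr EFin; field; exact: c0.
rewrite (eq_measure_integral nu); last by move=> A mA _; exact: munu.
rewrite ge0_integral_mscale//=; congr (_ * _)%E.
by rewrite ge0_integral_pushforward//= preimage_setT.
Qed.

Lemma ge0_tonelli (D1 D2 : set R) (f : R * R -> \bar R) :
  measurable D1 -> measurable D2 ->
  measurable_fun setT f -> (forall z, 0 <= f z)%E ->
  (\int[mu]_(x in D1) \int[mu]_(y in D2) f (x, y) =
   \int[mu]_(y in D2) \int[mu]_(x in D1) f (x, y))%E.
Proof.
move=> mD1 mD2 mf f0.
pose g := f \_ (D1 `*` D2).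
have mg : measurable_fun setT g.
  apply/(measurable_restrictT f) => //; first exact: measurableX.
  exact: measurable_funTS.
have g0 z : (0 <= g z)%E by apply: erestrict_ge0 => t _; exact: f0.
have gE x y : g (x, y) = if (x \in D1) && (y \in D2) then f (x, y) else 0%E.
  by rewrite /g patchE/= in_setX.
have := @fubini_tonelli _ _ _ _ R mu mu g mg g0.
rewrite [X in X = _ -> _](_ : _ = \int[mu]_(x in D1) \int[mu]_(y in D2) f (x, y))%E; last first.
  rewrite [RHS]integral_mkcond; apply: eq_integral => x _; rewrite patchE.
  case: ifPn => xD1.
    rewrite [RHS]integral_mkcond; apply: eq_integral => y _.
    by rewrite patchE gE xD1.
  by apply: integral0_eq => y _; rewrite gE (negbTE xD1).
rewrite [X in _ = X -> _](_ : _ = \int[mu]_(y in D2) \int[mu]_(x in D1) f (x, y))%E//.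
rewrite [RHS]integral_mkcond; apply: eq_integral => y _; rewrite patchE.
case: ifPn => yD2.
  rewrite [RHS]integral_mkcond; apply: eq_integral => x _.
  by rewrite patchE gE yD2 andbT.
by apply: integral0_eq => x _; rewrite gE (negbTE yD2) andbF.
Qed.

(* An alias of [is_derive], which is a type class: it keeps [apply] from
   launching a costly instance search on the premises of the rules below. *)
Definition has_derivative (f : R -> R) x (df : R) : Prop := is_derive x 1 f df.

(** Many integrands below blow up at an endpoint, so only one-sided limits of [F] are required
    there. Nonnegativity gives monotone convergence along compact subintervals, and finiteness of
    the integral is part of the conclusion. *)
Lemma ge0_integral_FTC_oo (f F : R -> R) (a b Fa Fb : R) : a < b ->
  (forall x, a < x < b -> has_derivative F x (f x)) ->
  (forall x, a < x < b -> {for x, continuous f}) ->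
  (forall x, a < x < b -> 0 <= f x) ->
  F x @[x --> a^'+] --> Fa -> F x @[x --> b^'-] --> Fb ->
  (\int[mu]_(x in `]a, b[) (f x)%:E = (Fb - Fa)%:E)%E.
Proof.
move=> ab dF cf f0 FFa FFb.
(* A third of the length keeps [[a + e n, b - e n]] nondegenerate already for [n = 0]. *)
pose e n := (b - a) / 3 / n.+1%:R.
have e3 : 0 < (b - a) / 3 by rewrite divr_gt0// subr_gt0.
have e0 n : 0 < e n by rewrite /e divr_gt0.
have e1 n : e n <= (b - a) / 3.
  by rewrite /e ler_pdivrMr// ler_peMr ?(ltW e3)// ler1n.
have ecvg : e n @[n --> \oo] --> 0.
  rewrite -[X in _ --> X](mulr0 ((b - a) / 3)).
  by apply: cvgMr => //; exact: cvg_harmonic.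
pose I n := `[a + e n, b - e n]%classic : set R.
have ean n : a + e n < b - e n.
  have := e1 n; rewrite ler_pdivlMr//; lra.
have sub n x : x \in `[a + e n, b - e n] -> a < x < b.
  by rewrite in_itv/= => /andP[h1 h2]; apply/andP; split; have := e0 n; lra.
have UI : \bigcup_n I n = `]a, b[%classic.
  apply/seteqP; split => x /=.
    by move=> [n _ /sub]; rewrite in_itv.
  rewrite in_itv/= => /andP[ax xb].
  have : \forall n \near \oo, e n < Num.min (x - a) (b - x).
    apply: (cvgr_lt 0) => //; rewrite lt_min !subr_gt0 ax xb//.
  move=> [n _ /(_ n (leqnn _))/=]; rewrite lt_min => /andP[h1 h2].
  by exists n => //; rewrite /I/= in_itv/=; apply/andP; split; lra.
have ndI : nondecreasing_seq I.
  move=> m n mn; rewrite subsetEset => x; rewrite /I/= !in_itv/=.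
  have : e n <= e m by rewrite /e ler_pM2l// lef_pV2 ?posrE// ler_nat.
  by move=> h /andP[h1 h2]; apply/andP; split; lra.
have mf : measurable_fun `]a, b[ (EFin \o f).
  apply/measurable_EFinP; apply: open_continuous_measurable_fun => //.
  by move=> x; rewrite inE/= in_itv/= => /cf.
have cvg1 : (\int[mu]_(x in I n) (f x)%:E)%E @[n --> \oo] -->
    (\int[mu]_(x in `]a, b[) (f x)%:E)%E.
  rewrite -UI; apply: ge0_nondecreasing_set_cvg_integral => //.
  - by move=> n; exact: measurable_itv.
  - move=> n; apply: measurable_funS mf => // x /sub; by rewrite /= in_itv.
  - by move=> n x /sub/f0; rewrite /= lee_fin.
have IE n : (\int[mu]_(x in I n) (f x)%:E = (F (b - e n) - F (a + e n))%:E)%E.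
  rewrite (@continuous_FTC2 _ f F)//.
  - apply: continuous_in_subspaceT => x; rewrite inE/= => /sub; exact: cf.
  - split.
    + move=> x; rewrite in_itv/= => /andP[h1 h2].
      have /dF-[]// : a < x < b by apply: (sub n); rewrite in_itv/= !ltW.
    + apply: cvg_at_right_filter.
      apply/differentiable_continuous/derivable1_diffP.
      have /dF-[]// : a < a + e n < b by apply/andP; split; have := e0 n; have := ean n; lra.
    + apply: cvg_at_left_filter.
      apply/differentiable_continuous/derivable1_diffP.
      have /dF-[]// : a < b - e n < b by apply/andP; split; have := e0 n; have := ean n; lra.
  - move=> x; rewrite in_itv/= => /andP[h1 h2]; rewrite derive1E.
    have /dF-[]// : a < x < b by apply: (sub n); rewrite in_itv/= !ltW.
apply: (cvg_unique _ cvg1) => //=.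
under eq_fun do rewrite IE.
apply/cvg_EFin; first by near=> n.
rewrite (_ : _ \o _ = (fun n => F (b - e n) - F (a + e n)))//.
apply: cvgB.
- move/cvg_at_leftP : FFb; apply; split.
    by move=> n; have := e0 n; rewrite gtrBl.
  by rewrite -[X in _ --> X]subr0; apply: cvgB => //; exact: cvg_cst.
- move/cvg_at_rightP : FFa; apply; split.
    by move=> n; rewrite ltrDl.
  by rewrite -[X in _ --> X]addr0; apply: cvgD => //; exact: cvg_cst.
Unshelve. all: by end_near. Qed.

End lebesgue_tools.

(** * Rules for derivatives and limits *)

Section calculus_rules.
Context {R : realType}.
Implicit Types (f g : R -> R) (x : R).

Lemma has_derivativeD f g x df dg : has_derivative f x df -> has_derivative g x dg ->
  has_derivative (fun y => f y + g y) x (df + dg).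
Proof. by move=> ? ?; exact: is_deriveD. Qed.

Lemma has_derivativeN f x df : has_derivative f x df ->
  has_derivative (fun y => - f y) x (- df).
Proof. by move=> ?; exact: is_deriveN. Qed.

Lemma has_derivativeM f g x df dg : has_derivative f x df -> has_derivative g x dg ->
  has_derivative (fun y => f y * g y) x (f x * dg + g x * df).
Proof.
by move=> hf hg; have := @is_deriveM _ _ f g x 1 df dg hf hg.
Qed.

Lemma has_derivativeV f x df : f x != 0 -> has_derivative f x df ->
  has_derivative (fun y => (f y)^-1) x (- (f x) ^- 2 * df).
Proof. exact: is_deriveV. Qed.

Lemma has_derivative_sqrt f x df : 0 < f x -> has_derivative f x df ->
  has_derivative (fun y => Num.sqrt (f y)) x ((2 * Num.sqrt (f x))^-1 * df).
Proof. by move=> fx0 hf; exact: (is_derive1_comp (is_derive1_sqrt fx0) hf). Qed.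

Lemma has_derivative_ln f x df : 0 < f x -> has_derivative f x df ->
  has_derivative (fun y => ln (f y)) x ((f x)^-1 * df).
Proof. by move=> fx0 hf; exact: (is_derive1_comp (is_derive1_ln fx0) hf). Qed.

Lemma has_derivative_id x : has_derivative (fun y : R => y) x 1.
Proof. exact: is_derive_id. Qed.

Lemma has_derivative_cst (c x : R) : has_derivative (fun=> c) x (0 : R).
Proof. exact: is_derive_cst. Qed.

Lemma has_derivative_tan x : cos x != 0 -> has_derivative tan x ((cos x ^+ 2)^-1).
Proof. exact: is_derive_tan. Qed.

Lemma has_derivative_eq f x df df' :
  has_derivative f x df -> df = df' -> has_derivative f x df'.
Proof. by move=> h <-. Qed.

Context {T : Type} {F : set_system T} {FF : Filter F}.
Implicit Types (h k : T -> R) (l m : R).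

Lemma cvgD_fun h k l m : h t @[t --> F] --> l -> k t @[t --> F] --> m ->
  h t + k t @[t --> F] --> l + m.
Proof. by move=> ? ?; exact: cvgD. Qed.

Lemma cvgN_fun h l : h t @[t --> F] --> l -> - h t @[t --> F] --> - l.
Proof. by move=> ?; exact: cvgN. Qed.

Lemma cvgM_fun h k l m : h t @[t --> F] --> l -> k t @[t --> F] --> m ->
  h t * k t @[t --> F] --> l * m.
Proof. by move=> ? ?; exact: cvgM. Qed.

Lemma cvgV_fun h l : l != 0 -> h t @[t --> F] --> l ->
  (h t)^-1 @[t --> F] --> l^-1.
Proof. by move=> ? ?; exact: cvgV. Qed.

Lemma cvg_sqrt_fun h l : h t @[t --> F] --> l ->
  Num.sqrt (h t) @[t --> F] --> Num.sqrt l.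
Proof. by move=> hl; apply: continuous_cvg hl; exact: sqrt_continuous. Qed.

Lemma cvg_ln_fun h l : 0 < l -> h t @[t --> F] --> l ->
  ln (h t) @[t --> F] --> ln l.
Proof. by move=> l0 hl; apply: continuous_cvg hl; exact: continuous_ln. Qed.

Lemma cvg_cos_fun h l : h t @[t --> F] --> l -> cos (h t) @[t --> F] --> cos l.
Proof. by move=> hl; apply: continuous_cvg hl; exact: continuous_cos. Qed.

Lemma cvg_lim_eq h l m : h t @[t --> F] --> l -> l = m -> h t @[t --> F] --> m.
Proof. by move=> hl <-. Qed.

Lemma cvgX_fun h n l : h t @[t --> F] --> l -> h t ^+ n @[t --> F] --> l ^+ n.
Proof.
move=> hl; apply: (@continuous_cvg _ _ _ F FF h (fun x => x ^+ n) l) => //.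
exact: exprn_continuous.
Qed.

End calculus_rules.

(* The rules are selected on the syntax of the function: leaving the choice to
   unification is prohibitively slow in the presence of numerals. *)
Ltac derive_rule := lazymatch goal with |- has_derivative ?f _ _ =>
  lazymatch f with
  | (fun _ => ?c) => apply: has_derivative_cst
  | (fun x => x) => apply: has_derivative_id
  | (fun x => @GRing.add _ (@?g x) (@?h x)) => apply: has_derivativeD
  | (fun x => @GRing.opp _ (@?g x)) => apply: has_derivativeN
  | (fun x => @GRing.mul _ (@?g x) (@?h x)) => apply: has_derivativeM
  | (fun x => @GRing.inv _ (@?g x)) => apply: has_derivativeV
  | (fun x => Num.sqrt (@?g x)) => apply: has_derivative_sqrt
  | (fun x => ln (@?g x)) => apply: has_derivative_ln
  | @GRing.add _ ?c => apply: (@has_derivativeD _ (fun=> c) (fun x => x))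
  | @GRing.opp _ => apply: (@has_derivativeN _ (fun x => x))
  | @GRing.mul _ ?c => apply: (@has_derivativeM _ (fun=> c) (fun x => x))
  | @GRing.inv _ => apply: (@has_derivativeV _ (fun x => x))
  | @Num.sqrt _ => apply: (@has_derivative_sqrt _ (fun x => x))
  | @ln _ => apply: (@has_derivative_ln _ (fun x => x))
  | @tan _ => apply: has_derivative_tan
  | (fun x => tan x) => apply: has_derivative_tan
  end end.

Ltac derive_rules := repeat derive_rule.

Ltac cvg_rule := rewrite ?/(prop_for _ _) ?/(continuous_at _ _);
  lazymatch goal with |- context [fmap ?f _] =>
  lazymatch f with
  | (fun _ => ?c) => exact: cvg_cst
  | (fun x => x) => exact: cvg_id
  | (fun x => @GRing.add _ (@?g x) (@?h x)) => apply: cvgD_fun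
  | (fun x => @GRing.opp _ (@?g x)) => apply: cvgN_fun
  | (fun x => @GRing.mul _ (@?g x) (@?h x)) => apply: cvgM_fun
  | (fun x => @GRing.exp _ (@?g x) ?n) => apply: cvgX_fun
  | (fun x => @GRing.inv _ (@?g x)) => apply: cvgV_fun
  | (fun x => Num.sqrt (@?g x)) => apply: cvg_sqrt_fun
  | (fun x => ln (@?g x)) => apply: cvg_ln_fun
  | (fun x => cos (@?g x)) => apply: cvg_cos_fun
  | @GRing.add _ ?c => apply: (@cvgD_fun _ _ _ _ (fun=> c) (fun x => x))
  | @GRing.opp _ => apply: (@cvgN_fun _ _ _ _ (fun x => x))
  | @GRing.mul _ ?c => apply: (@cvgM_fun _ _ _ _ (fun=> c) (fun x => x))
  | @GRing.inv _ => apply: (@cvgV_fun _ _ _ _ (fun x => x))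
  | @Num.sqrt _ => apply: (@cvg_sqrt_fun _ _ _ _ (fun x => x))
  | @ln _ => apply: (@cvg_ln_fun _ _ _ _ (fun x => x))
  end end.

Ltac cvg_rules := repeat cvg_rule.

(** * Rules for measurability *)

Section measurability_rules.
Context {R : realType} d (T : measurableType d).
Implicit Types (D : set T) (f g : T -> R).

Lemma measurable_funV D f : measurable_fun D f ->
  measurable_fun D (fun t => (f t)^-1).
Proof.
move=> mf; apply: (measurableT_comp _ mf) => {D f mf}.
have -> : [set: R] = [set~ 0] `|` [set 0] by rewrite setUC setUv.
apply/measurable_funU; [exact: measurableC|by []|split].
- apply: open_continuous_measurable_fun.
    by rewrite openC; exact: closed_eq.
  by move=> x; rewrite inE/= => /eqP x0; exact: inv_continuous.
- exact: measurable_fun_set1.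
Qed.

Lemma measurable_fun_sqrt D f : measurable_fun D f ->
  measurable_fun D (fun t => Num.sqrt (f t)).
Proof.
move=> mf; apply: (measurableT_comp _ mf).
by apply: continuous_measurable_fun; exact: sqrt_continuous.
Qed.

Lemma measurable_fun_ln D f : measurable_fun D f ->
  measurable_fun D (fun t => ln (f t)).
Proof. by move=> mf; apply: (measurableT_comp _ mf); exact: measurable_ln. Qed.

Lemma measurable_fun_norm D f : measurable_fun D f ->
  measurable_fun D (fun t => `|f t|).
Proof. by move=> mf; exact: (measurableT_comp _ mf). Qed.

Lemma measurable_fun_cos D f : measurable_fun D f ->
  measurable_fun D (fun t => cos (f t)).
Proof.
move=> mf; apply: (measurableT_comp _ mf).
by apply: continuous_measurable_fun; exact: continuous_cos.
Qed.

Lemma measurable_fun_andb D (p q : T -> bool) : measurable_fun D p ->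
  measurable_fun D q -> measurable_fun D (fun t => p t && q t).
Proof. exact: measurable_and. Qed.

End measurability_rules.

Ltac measurable_rules := repeat first
  [ exact: measurable_cst | exact: measurable_id | exact: measurable_fst
  | exact: measurable_snd | assumption
  | apply: measurable_fun_ifT | apply: measurable_fun_andb
  | apply: measurable_fun_ltr | apply: measurable_fun_ler | apply: measurable_fun_eqr
  | apply: measurable_funB | apply: measurable_funD | apply: measurable_funM
  | apply: measurable_funX | apply: measurable_funN
  | apply: measurable_funV | apply: measurable_fun_sqrt | apply: measurable_fun_ln
  | apply: measurable_fun_norm | apply: measurable_fun_cos ].

(** * Affine substitution for signed integrands *)

Section affine_substitution.
Context {R : realType}.
Local Notation mu := (@lebesgue_measure R).

Lemma integral_affine_set (D : set R) (f : R -> R) (c d : R) : c != 0 ->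
  measurable D -> measurable_fun [set: R] f ->
  (\int[mu]_(x in D) (f x)%:E =
   `|c|%:E * \int[mu]_(x in [set x | D (c * x + d)%R]) (f (c * x + d)%R)%:E)%E.
Proof.
move=> c0 mD mf.
have pos (g : R -> \bar R) : measurable_fun [set: R] g -> (forall x, 0 <= g x)%E ->
    (\int[mu]_(x in D) g x =
     `|c|%:E * \int[mu]_(x in [set x | D (c * x + d)%R]) g (c * x + d)%R)%E.
  move=> mg g0; rewrite integral_mkcond (ge0_integral_affine d c0).
  - by rewrite [in RHS]integral_mkcond; congr (_ * _)%E; apply: eq_integral => x _;
      rewrite !patchE; congr (if _ then _ else _); apply/idP/idP; rewrite !inE.
  - by apply/(measurable_restrictT g) => //; exact: measurable_funTS.
  - by move=> x; apply: erestrict_ge0 => y _; exact: g0.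
have mEf : measurable_fun [set: R] (EFin \o f) by exact/measurable_EFinP.
have c1 : 0 < `|c| by rewrite normr_gt0.
rewrite integralE [in RHS]integralE.
rewrite (pos (EFin \o f)^\+)%E//; last exact: measurable_funepos.
rewrite (pos (EFin \o f)^\-)%E//; last exact: measurable_funeneg.
rewrite [X in (_ * X - _)%E](_ : _ =
  \int[mu]_(x in [set x | D (c * x + d)%R]) ((fun x => (f (c * x + d)%R)%:E)^\+ x))%E; last first.
  by apply: eq_integral => x _; rewrite !funeposE.
rewrite [X in (_ - _ * X)%E](_ : _ =
  \int[mu]_(x in [set x | D (c * x + d)%R]) ((fun x => (f (c * x + d)%R)%:E)^\- x))%E; last first.
  by apply: eq_integral => x _; rewrite !funenegE.
set A := (\int[mu]_(_ in _) _)%E; set B := (\int[mu]_(_ in _) _)%E.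
have : (0 <= A)%E by apply: integral_ge0.
have : (0 <= B)%E by apply: integral_ge0.
(* The positive and negative parts may be infinite, so the factor is distributed over their
   difference case by case. *)
case: A => [a||]//; case: B => [b||]// _ _; first by rewrite muleBr.
all: by rewrite ?gt0_muley ?lte_fin//= ?gt0_muleNy ?lte_fin.
Qed.

End affine_substitution.

(** * Logarithmic potential of the arcsine law *)

Section arcsine_law.
Context {R : realType}.
Local Notation mu := (@lebesgue_measure R).
Local Notation Q1 := (`]0, pi / 2[%classic : set R).
Implicit Types (h : R -> R) (x y : R).

Lemma cos_sqr_measurable h : measurable_fun [set: R] h ->
  measurable_fun [set: R] (fun al : R => h (cos al ^+ 2)).
Proof.
by move=> mh; apply: (measurableT_comp mh); measurable_rules.
Qed.

(** The image of Lebesgue measure on []0, pi / 2[] under the squared cosine is, up to its mass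
    [pi / 2], the arcsine law of [[0, 1]]; averages against this law are written with the angle,
    which removes the endpoint singularities of its density. Reflecting the angle gives the symmetry
    of the law about [1 / 2]. *)
Lemma integral_cos_sqr_onem h : measurable_fun [set: R] h ->
  (\int[mu]_(al in Q1) (h (1 - cos al ^+ 2))%:E =
   \int[mu]_(al in Q1) (h (cos al ^+ 2))%:E)%E.
Proof.
move=> mh; rewrite [RHS](@integral_affine_set _ _ _ (-1) (pi / 2))//; last exact: cos_sqr_measurable.
rewrite normrN1 mul1e.
rewrite (_ : [set x | _] = Q1).
  by apply: eq_integral => x _; rewrite mulN1r [- x + _]addrC cosB cos_pihalf sin_pihalf
    mul0r add0r mul1r sin2cos2.
apply/seteqP; split => x /=; rewrite !in_itv/= mulN1r => /andP[? ?]; apply/andP; split; lra.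
Qed.

(** The argument of [h] on the left is the squared cosine of the doubled angle. Doubling covers []0,
    pi[], which folds back onto [Q1] under [al |-> pi - al]. *)
Lemma integral_cos_sqr_double h : measurable_fun [set: R] h ->
  (\int[mu]_(al in Q1) (h ((2 * cos al ^+ 2 - 1) ^+ 2))%:E =
   \int[mu]_(al in Q1) (h (cos al ^+ 2))%:E)%E.
Proof.
move=> mh; pose g (al : R) := h (cos al ^+ 2).
have mg : measurable_fun [set: R] g by exact: cos_sqr_measurable.
have mEg : measurable_fun [set: R] (EFin \o g) by exact/measurable_EFinP.
have double : (\int[mu]_(al in `]0%R, pi[) (g al)%:E =
    2%:E * \int[mu]_(al in Q1) (h ((2 * cos al ^+ 2 - 1) ^+ 2))%:E)%E.
  rewrite (@integral_affine_set _ _ _ 2 0)// ger0_norm//; congr (_ * _)%E.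
  rewrite (_ : [set x | _] = Q1).
    by apply: eq_integral => x _; rewrite addr0 /g mulr_natl cos_mulr2n mulr_natl.
  by apply/seteqP; split => x /=; rewrite !in_itv/= addr0 => /andP[? ?]; apply/andP; split; lra.
have half : (\int[mu]_(al in `]0%R, pi[) (g al)%:E =
    2%:E * \int[mu]_(al in Q1) (g al)%:E)%E.
  have -> : `]0, pi[%classic = Q1 `|` `[pi / 2, pi[ :> set R.
    by rewrite -itv_bndbnd_setU// bnd_simp; have := @pi_gt0 R; lra.
  rewrite integral_setU//; last 2 first.
  - exact: measurable_funTS.
  - apply/disj_set2P; rewrite -subset0 => x [] /=; rewrite !in_itv/=.
    by move=> /andP[_ h1] /andP[h2 _]; move: h1; rewrite ltNge h2.
  have -> : (\int[mu]_(al in `[(pi / 2)%R, pi[) (g al)%:E =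
             \int[mu]_(al in `](pi / 2)%R, pi[) (g al)%:E)%E.
    by rewrite -integral_itv_obnd_cbnd//; exact: measurable_funTS.
  have -> : (\int[mu]_(al in `](pi / 2)%R, pi[) (g al)%:E =
             \int[mu]_(al in Q1) (g al)%:E)%E.
    rewrite (@integral_affine_set _ _ _ (-1) pi)//.
    rewrite normrN1 mul1e (_ : [set x | _] = Q1).
      by apply: eq_integral => x _; rewrite /g mulN1r [- x + _]addrC cosB cospi sinpi
        mul0r addr0 mulN1r sqrrN.
    by apply/seteqP; split => x /=; rewrite !in_itv/= mulN1r => /andP[? ?];
      apply/andP; split; lra.
  by rewrite -[X in (X + X)%E]mul1e -ge0_muleDl// -EFinD.
move: double; rewrite half.
set A := (\int[mu]_(_ in _) _)%E; set B := (\int[mu]_(_ in _) _)%E.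
case: A => [a||]; case: B => [b||]//=; rewrite ?gt0_muley ?gt0_muleNy ?lte_fin//.
by move=> [] /mulfI => <-//.
Qed.

End arcsine_law.

(** * Power bounds for the logarithmic singularity *)

Section log_singularity.
Context {R : realType}.
Local Notation mu := (@lebesgue_measure R).
Implicit Types (x y w : R).

(** This is [ln v < v] at [v = w ^ (-1/2)]. It trades the logarithmic singularity for an integrable
    power. *)
Lemma oppr_ln_le_inv_sqrt w : 0 < w -> - ln w <= 2 / Num.sqrt w.
Proof.
move=> w0; have s0 : 0 < Num.sqrt w by rewrite sqrtr_gt0.
have si0 : 0 < (Num.sqrt w)^-1 by rewrite invr_gt0.
have := ltW (ln_sublinear si0); rewrite lnV ?posrE// => h.
rewrite -[w in ln w](sqr_sqrtr (ltW w0)) lnXn// -mulr_natl; lra.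
Qed.

Lemma integral_inv_sqrt (d : R) : 0 < d ->
  (\int[mu]_(t in `]0%R, d[) ((Num.sqrt t)^-1)%:E = (2 * Num.sqrt d)%:E)%E.
Proof.
move=> d0; rewrite -[X in _ = X%:E]subr0.
apply: (@ge0_integral_FTC_oo _ _ (fun t => 2 * Num.sqrt t)) => //.
- move=> x /andP[x0 _]; apply: has_derivative_eq; first by derive_rules.
  by field; rewrite gt_eqF// sqrtr_gt0.
- by move=> x /andP[x0 _]; cvg_rules; rewrite gt_eqF// sqrtr_gt0.
- by apply: cvg_at_right_filter; rewrite -[X in _ --> X](mulr0 2) -{2}(sqrtr0 R); cvg_rules.
- by apply: cvg_at_left_filter; cvg_rules.
Qed.

Lemma measurable_inv_sqrt_norm : measurable_fun [set: R] (fun t : R => (Num.sqrt `|t|)^-1).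
Proof. by measurable_rules. Qed.

Lemma integral_inv_sqrt_norm (d : R) : 0 < d ->
  (\int[mu]_(t in `](- d)%R, d[) ((Num.sqrt `|t|)^-1)%:E = (4 * Num.sqrt d)%:E)%E.
Proof.
move=> d0; pose f (t : R) := (Num.sqrt `|t|)^-1.
have mf : measurable_fun [set: R] f by exact: measurable_inv_sqrt_norm.
have mEf : measurable_fun [set: R] (EFin \o f) by exact/measurable_EFinP.
have pos : (\int[mu]_(t in `]0%R, d[) (f t)%:E = (2 * Num.sqrt d)%:E)%E.
  rewrite -integral_inv_sqrt//; apply: eq_integral => t.
  by rewrite inE/= in_itv/= /f => /andP[t0 _]; rewrite gtr0_norm.
have -> : `](- d), d[%classic = `](- d), 0[ `|` `[0, d[ :> set R.
  by rewrite -itv_bndbnd_setU// bnd_simp; lra.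
rewrite integral_setU//; last 2 first.
- exact: measurable_funTS.
- apply/disj_set2P; rewrite -subset0 => x [] /=; rewrite !in_itv/=.
  by move=> /andP[_ h1] /andP[h2 _]; move: h1; rewrite ltNge h2.
rewrite -integral_itv_obnd_cbnd//; last exact: measurable_funTS.
rewrite pos (@integral_affine_set _ _ _ (-1) 0)// normrN1 mul1e.
rewrite (_ : [set x | _] = `]0, d[%classic); last first.
  by apply/seteqP; split => x /=; rewrite !in_itv/= mulN1r => /andP[? ?];
      apply/andP; split; lra.
rewrite (_ : (\int[mu]_(x in _) _ = \int[mu]_(t in `]0%R, d[) (f t)%:E)%E); last first.
  by apply: eq_integral => x _; rewrite mulN1r addr0 /f normrN.
by rewrite pos -EFinD; congr EFin; ring.
Qed.

(** In [sin x = 2 sin (x / 2) cos (x / 2)] the mean value theorem bounds [sin (x / 2)] below by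
    [x / 2 * cos (x / 2)], and [cos x >= 0] forces [cos (x / 2) ^ 2 >= 1 / 2]. *)
Lemma sin_ge_half x : 0 <= x <= pi / 2 -> x / 2 <= sin x.
Proof.
move=> /andP[]; rewrite le_eqVlt => /predU1P[<-|x0 xpi].
  by rewrite sin0 mul0r.
have pp := @pi_gt0 R.
have [u u0x su] : exists2 u : R, u \in `]0, x / 2[ & sin (x / 2) - sin 0 = cos u * (x / 2 - 0).
  apply: (@MVT _ (@sin R) (@cos R)); first by rewrite divr_gt0.
  by apply: continuous_subspaceT; exact: continuous_sin.
rewrite sin0 !subr0 in su.
move: u0x; rewrite in_itv/= => /andP[u0 ux].
have cu : cos (x / 2) <= cos u.
  apply/ltW; rewrite ltr_cos//; rewrite in_itv/=; apply/andP; split; lra.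
have c0 : 0 <= cos (x / 2) by apply: cos_ge0_pihalf; apply/andP; split; lra.
have -> : x = (x / 2) *+ 2 by rewrite -mulr_natl; field.
rewrite sin_mulr2n -mulr_natl -[in X in X <= _]mulr_natl su.
have : 0 <= cos x by apply: cos_ge0_pihalf; apply/andP; split; lra.
have -> : x = (x / 2) *+ 2 by rewrite -mulr_natl; field.
rewrite cos_mulr2n -mulr_natl => h.
have -> : x / 2 *+ 2 / 2 = x / 2 by rewrite -mulr_natl; field.
move: cu c0 h; set c := cos (x / 2); set c' := cos u => cu c0 h.
have : c * c <= c * c' by rewrite ler_wpM2l.
nra.
Qed.

(** The difference of squares is [sin (al - phi) * sin (al + phi)], and for [phi <= al] both factors
    are at least [(al - phi) / 2]. The bound is quadratic because the squared cosine is stationary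
    at [0] and [pi / 2]. *)
Lemma cos_sqr_dist (phi al : R) : 0 <= phi <= pi / 2 -> 0 <= al <= pi / 2 ->
  (`|phi - al| / 2) ^+ 2 <= `|cos phi ^+ 2 - cos al ^+ 2|.
Proof.
wlog le_pa : phi al / phi <= al => [hw hp ha|/andP[p0 p1] /andP[a0 a1]].
  have [/hw h|/ltW/hw h] := leP phi al; first exact: h.
  by rewrite distrC [leRHS]distrC; exact: h.
have pp := @pi_gt0 R.
have -> : cos phi ^+ 2 - cos al ^+ 2 = sin (al - phi) * sin (al + phi).
  rewrite sinB sinD; have := cos2Dsin2 phi; have := cos2Dsin2 al.
  move: (cos phi) (cos al) (sin phi) (sin al) => a b c d h1 h2.
  have -> : (d * a - b * c) * (d * a + b * c) = d ^+ 2 * a ^+ 2 - b ^+ 2 * c ^+ 2.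
    by ring.
  have -> : c ^+ 2 = 1 - a ^+ 2 by lra.
  have -> : d ^+ 2 = 1 - b ^+ 2 by lra.
  by ring.
rewrite distrC ger0_norm ?subr_ge0//.
have s1 : (al - phi) / 2 <= sin (al - phi) by apply: sin_ge_half; apply/andP; split; lra.
have s2 : sin (al - phi) <= sin (al + phi).
  rewrite sinB sinD lerD2l.
  have : 0 <= cos al * sin phi.
    by rewrite mulr_ge0// ?cos_ge0_pihalf ?sin_ge0_pi//; apply/andP; split; lra.
  lra.
have s0 : 0 <= (al - phi) / 2 by lra.
by rewrite ger0_norm; nra.
Qed.

End log_singularity.

(** * Green function and the doubling argument *)

Section arcsine_potential.
Context {R : realType}.
Local Notation mu := (@lebesgue_measure R).
Local Notation Q1 := (`]0, pi / 2[%classic : set R).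
Implicit Types (x y : R).

Let sqrt2_le2 : Num.sqrt 2 <= 2 :> R.
Proof.
have {2}-> : 2 = Num.sqrt (2 ^+ 2) :> R by rewrite sqrtr_sqr ger0_norm.
by apply: ler_wsqrtr; rewrite expr2; lra.
Qed.

(* The Green function of the complement of [0, 1] with pole at infinity; it
   vanishes on [0, 1] because [Num.sqrt] is 0 on negative numbers. *)
Definition green x : R := 2 * ln (Num.sqrt (Num.max x 1) + Num.sqrt (x - 1)).

Lemma green_le1 x : x <= 1 -> green x = 0.
Proof.
move=> x1; rewrite /green (max_r x1) (@ler0_sqrtr _ (x - 1)) ?subr_le0//.
by rewrite sqrtr1 addr0 ln1 mulr0.
Qed.

(** The potential of the arcsine law has the same growth [ln (max x 1)], so these bounds make the
    error of the doubling argument bounded. The constant is [2 * ln 2], from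
    [sqrt (x - 1) <= sqrt (max x 1)]. *)
Lemma green_bounds x : ln (Num.max x 1) <= green x <= ln 4 + ln (Num.max x 1).
Proof.
have M0 : 0 < Num.max x 1 by rewrite lt_max ltr01 orbT.
have s0 : 0 < Num.sqrt (Num.max x 1) by rewrite sqrtr_gt0.
have s1 : 0 <= Num.sqrt (x - 1) by exact: sqrtr_ge0.
have s2 : Num.sqrt (x - 1) <= Num.sqrt (Num.max x 1).
  by apply: ler_wsqrtr; rewrite le_max; apply/orP; left; lra.
have -> : ln (Num.max x 1) = 2 * ln (Num.sqrt (Num.max x 1)).
  by rewrite -[in LHS](sqr_sqrtr (ltW M0)) lnXn// mulr_natl.
have -> : ln 4 = 2 * ln 2 :> R by rewrite mulr_natl -lnXn//; congr ln; ring.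
rewrite /green -mulrDr !ler_pM2l// -lnM ?posrE//.
rewrite !ler_ln ?posrE ?mulr_gt0//; [apply/andP; split|..]; lra.
Qed.

Lemma green_ge0 x : 0 <= green x.
Proof.
by have /andP[h _] := green_bounds x; apply: le_trans h; rewrite ln_ge0// le_max lexx orbT.
Qed.

(** For [x = cosh (tau) ^ 2] with [tau >= 0] one has [green x = 2 * tau], and the map doubles [tau];
    [[0, 1]] is mapped into itself. *)
Lemma green_double x : 0 <= x -> green ((2 * x - 1) ^+ 2) = 2 * green x.
Proof.
move=> x0; have [x1|x1] := leP x 1.
  rewrite (green_le1 x1) mulr0 green_le1//; nra.
have T1 : 1 <= (2 * x - 1) ^+ 2 by nra.
rewrite /green (max_l T1) (max_l (ltW x1)) sqrtr_sqr ger0_norm; last lra.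
rewrite (_ : (2 * x - 1) ^+ 2 - 1 = (2 * (Num.sqrt x * Num.sqrt (x - 1))) ^+ 2); last first.
  by rewrite !exprMn !sqr_sqrtr ?subr_ge0 ?(ltW x1)//; ring.
rewrite sqrtr_sqr ger0_norm; last by rewrite !mulr_ge0 ?sqrtr_ge0.
have s0 : 0 < Num.sqrt x + Num.sqrt (x - 1).
  by rewrite ltr_wpDr ?sqrtr_ge0// sqrtr_gt0; lra.
rewrite (_ : 2 * x - 1 + _ = (Num.sqrt x + Num.sqrt (x - 1)) ^+ 2).
  by rewrite lnXn// -(mulr_natl (ln _) 2).
by rewrite sqrrD !sqr_sqrtr ?subr_ge0 ?(ltW x1)//; ring.
Qed.

Let logc x (al : R) := ln `|x - cos al ^+ 2|.

Let logc_measurable x : measurable_fun [set: R] (logc x).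
Proof. by rewrite /logc; measurable_rules. Qed.

Let cos01 (al : R) : 0 <= cos al ^+ 2 <= 1.
Proof. by rewrite sqr_ge0/= -(cos2Dsin2 al) lerDl sqr_ge0. Qed.

Let logc_upper x al : 0 <= x -> logc x al <= ln 2 + ln (Num.max x 1).
Proof.
move=> x0; have M1 : 1 <= Num.max x 1 by rewrite le_max lexx orbT.
have xM : x <= Num.max x 1 by rewrite le_max lexx.
rewrite -lnM ?posrE//; last lra.
rewrite /logc; have /andP[c0 c1] := cos01 al.
have [->|ne] := eqVneq `|x - cos al ^+ 2| 0.
  by rewrite ln0// ln_ge0//; lra.
rewrite ler_ln ?posrE; [|by rewrite lt0r ne normr_ge0|lra].
by rewrite ler_norml; apply/andP; split; lra.
Qed.

(** At [phi] the squared cosine is closest to [x]: it equals [x] if [x <= 1], and [phi = 0] if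
    [x > 1]. In the latter case [x - c >= x * (1 - c)], with [c] the squared cosine, retains the
    term [ln x]. *)
Let logc_lower x : 0 <= x -> exists phi : R, 0 <= phi <= pi / 2 /\
  forall al, Q1 al ->
    ln (Num.max x 1) - 8 / Num.sqrt `|al - phi| <= logc x al.
Proof.
move=> x0; have pp := @pi_gt0 R.
(* The constant 8: the square doubles the logarithm, and [- ln (w / 2) <= 2 / sqrt (w / 2) <= 4 /
   sqrt w]. *)
have bnd (M w u : R) : 0 < M -> 0 < w -> M * (w / 2) ^+ 2 <= u -> ln M - 8 / Num.sqrt w <= ln u.
  move=> M0 w0 h.
  have w2 : 0 < w / 2 by rewrite divr_gt0.
  have h1 : 2 * ln (w / 2) + ln M <= ln u.
    rewrite mulr_natl -lnXn// -lnM ?posrE ?exprn_gt0// ler_ln ?posrE.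
    - by rewrite mulrC.
    - by rewrite mulr_gt0// exprn_gt0.
    - by apply: lt_le_trans h; rewrite mulr_gt0// exprn_gt0.
  have := oppr_ln_le_inv_sqrt w2.
  have : 2 / Num.sqrt (w / 2) <= 4 / Num.sqrt w.
    rewrite ler_pdivrMr ?sqrtr_gt0// mulrAC ler_pdivlMr ?sqrtr_gt0//.
    have s0 : 0 < Num.sqrt (w / 2) by rewrite sqrtr_gt0.
    have -> : Num.sqrt w = Num.sqrt 2 * Num.sqrt (w / 2).
      by rewrite -sqrtrM// mulrC divfK.
    have := sqrt2_le2.
    by rewrite mulrA ler_pM2r//; lra.
  lra.
have [x1|x1] := leP x 1.
  have sx : Num.sqrt x \in `[-1, 1].
    rewrite in_itv/=; apply/andP; split; first by apply: le_trans (sqrtr_ge0 x); rewrite lerN10.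
    by rewrite -sqrtr1; exact: ler_wsqrtr.
  exists (acos (Num.sqrt x)).
  have h0 : 0 <= acos (Num.sqrt x) <= pi / 2.
    rewrite acos_ge0//=.
    rewrite leNgt; apply/negP => h.
    have := sqrtr_ge0 x; rewrite leNgt => /negP; apply.
    rewrite -(acosK sx) -cos_pihalf ltr_cos// in_itv/=.
      by apply/andP; split; lra.
    by rewrite acos_ge0//= acos_lepi.
  split=> // al /=; rewrite in_itv/= => /andP[a0 a1].
  rewrite ln1 sub0r /logc.
  (* At the singular angle both sides are 0, by the conventions [ln 0 = 0] and [0^-1 = 0]. *)
  have [->|ne] := eqVneq al (acos (Num.sqrt x)).
    by rewrite acosK// sqr_sqrtr// !subrr normr0 sqrtr0 invr0 mulr0 oppr0 ln0.
  have := @bnd 1 `|al - acos (Num.sqrt x)| `|x - cos al ^+ 2|.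
  rewrite ln1 sub0r; apply => //; first by rewrite normr_gt0 subr_eq0.
  rewrite mul1r -{2}(sqr_sqrtr x0) -{2}(acosK sx) distrC cos_sqr_dist//.
  by apply/andP; split; lra.
exists 0; split; first by apply/andP; split; lra.
move=> al /=; rewrite in_itv/= => /andP[a0 a1]; apply: bnd.
- lra.
- by rewrite subr0 normr_gt0 gt_eqF.
- have h : (`|0 - al| / 2) ^+ 2 <= `|cos 0 ^+ 2 - cos al ^+ 2|.
    by apply: cos_sqr_dist; apply/andP; split; lra.
  have /andP[c0 c1] := cos01 al.
  rewrite cos0 expr1n distrC (@ger0_norm _ (1 - cos al ^+ 2)) in h; last lra.
  rewrite (@ger0_norm _ (x - cos al ^+ 2)); last lra.
  have : x * (`|al - 0| / 2) ^+ 2 <= x * (1 - cos al ^+ 2) by rewrite ler_wpM2l.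
  nra.
Qed.

(** Since [pi / 2 < 2], the domain lies within distance 2 of [phi]; over that neighbourhood the
    integral is [32 * sqrt 2], and [sqrt 2 <= 2]. *)
Let inv_dist_lt (phi : R) : 0 <= phi <= pi / 2 ->
  (\int[mu]_(al in Q1) (8 / Num.sqrt `|al - phi|)%:E <= 64%:E)%E.
Proof.
move=> /andP[p0 p1].
have mf : measurable_fun [set: R] (fun al => 8 / Num.sqrt `|al - phi|).
  by measurable_rules.
have pp := @pihalf_lt2 R.
apply: (@le_trans _ _ (\int[mu]_(al in `](phi - 2)%R, (phi + 2)%R[) (8 / Num.sqrt `|al - phi|)%:E)%E).
  apply: ge0_subset_integral => //.
  - by apply/measurable_EFinP; exact: measurable_funTS.
  - by move=> al /=; rewrite !in_itv/= => /andP[h1 h2]; apply/andP; split; lra.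
have mG : measurable_fun [set: R] (fun t => 8 / Num.sqrt `|t|) by measurable_rules.
have m22 : measurable (`]-2, 2[%classic : set R) by [].
have := @integral_affine_set R _ _ 1 (- phi) (oner_neq0 _) m22 mG.
rewrite normr1 mul1e (_ : [set x | `]-2, 2[%classic (1 * x - phi)] = `]phi - 2, phi + 2[%classic); last first.
  by apply/seteqP; split => x /=; rewrite !in_itv/= mul1r => /andP[? ?]; apply/andP; split; lra.
have E : (\int[mu]_(al in `](phi - 2)%R, (phi + 2)%R[) (8 / Num.sqrt `|al - phi|)%:E =
    \int[mu]_(al in `](phi - 2)%R, (phi + 2)%R[) (8 / Num.sqrt `|1 * al - phi|)%:E)%E.
  by apply: eq_integral => al _; rewrite mul1r.
move=> hS; rewrite E -hS.
under eq_integral do rewrite EFinM.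
rewrite ge0_integralZl//; last first.
  by apply/measurable_EFinP; apply: measurable_funTS; exact: measurable_inv_sqrt_norm.
rewrite integral_inv_sqrt_norm// -EFinM lee_fin.
have := sqrt2_le2; lra.
Qed.

Let mQ1 : mu Q1 = (pi / 2)%:E.
Proof. by rewrite lebesgue_measure_itv/= lte_fin divr_gt0 ?pi_gt0// oppr0 adde0. Qed.

Lemma integrable_cst_itv (D : set R) (c : R) : measurable D -> (mu D < +oo)%E ->
  mu.-integrable D (EFin \o cst c).
Proof.
move=> mD fD; apply: measurable_bounded_integrable => //.
by exists `|c|; split=> // y cy x _; apply: ltW.
Qed.

Let iG (phi : R) : 0 <= phi <= pi / 2 ->
  mu.-integrable Q1 (EFin \o (fun al => 8 / Num.sqrt `|al - phi|)).
Proof.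
move=> hp; apply/integrableP; split.
  by apply/measurable_EFinP; apply: measurable_funTS; measurable_rules.
under eq_integral do rewrite gee0_abs ?lee_fin ?divr_ge0 ?sqrtr_ge0//.
by apply: le_lt_trans (inv_dist_lt hp) _; rewrite ltry.
Qed.

Let ic (c : R) : mu.-integrable Q1 (EFin \o cst c).
Proof. by apply: integrable_cst_itv => //; rewrite mQ1 ltry. Qed.

Lemma integrable_arcsine_log x : 0 <= x ->
  mu.-integrable Q1 (fun al : R => (ln `|x - cos al ^+ 2|)%:E).
Proof.
move=> x0; have [phi [hp hl]] := logc_lower x0.
have M0 : 0 <= ln (Num.max x 1) by rewrite ln_ge0// le_max lexx orbT.
have l2 : 0 <= ln 2 :> R by rewrite ln_ge0//; lra.
apply: (le_integrable _ _ _ (integrableD _ (ic (ln 2 + ln (Num.max x 1))) (iG hp))) => //.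
  by apply/measurable_EFinP; apply: measurable_funTS; exact: logc_measurable.
move=> al Qal /=; rewrite lee_fin.
have G0 : 0 <= 8 / Num.sqrt `|al - phi| by rewrite divr_ge0 ?sqrtr_ge0.
rewrite [leRHS]ger0_norm; last lra.
have := logc_upper al x0; have := hl _ Qal; rewrite /logc => h1 h2.
by rewrite ler_norml; apply/andP; split; lra.
Qed.

Let L x := \int[mu]_(al in Q1) logc x al.

Let L_E x : 0 <= x -> (\int[mu]_(al in Q1) (logc x al)%:E = (L x)%:E)%E.
Proof. by move=> x0; rewrite fineK// integrable_fin_num//; exact: integrable_arcsine_log. Qed.

Let L_bounds x : 0 <= x ->
  pi / 2 * ln (Num.max x 1) - 64 <= L x <= pi / 2 * (ln 2 + ln (Num.max x 1)).
Proof.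
move=> x0; have il := integrable_arcsine_log x0; apply/andP; split.
  have [phi [hp hl]] := logc_lower x0.
  have <- : \int[mu]_(al in Q1) (cst (ln (Num.max x 1)) al) = pi / 2 * ln (Num.max x 1).
    by rewrite Rintegral_cst// (_ : fine (mu Q1) = pi / 2) ?mQ1// mulrC.
  have : \int[mu]_(al in Q1) (8 / Num.sqrt `|al - phi|) <= 64.
    by rewrite -lee_fin fineK ?inv_dist_lt// integrable_fin_num//; exact: iG.
  have : \int[mu]_(al in Q1) (cst (ln (Num.max x 1)) al - 8 / Num.sqrt `|al - phi|) <= L x.
    by apply: le_Rintegral => //; exact: (integrableB _ (ic _) (iG hp)).
  rewrite RintegralB//; first [exact: ic|exact: iG|lra].
have <- : \int[mu]_(al in Q1) (cst (ln 2 + ln (Num.max x 1)) al) = pi / 2 * (ln 2 + ln (Num.max x 1)).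
  by rewrite Rintegral_cst// (_ : fine (mu Q1) = pi / 2) ?mQ1// mulrC.
apply: le_Rintegral => //.
by move=> al _; exact: logc_upper.
Qed.

(** The law is invariant under [y |-> (2 y - 1) ^ 2], and [(2 x - 1) ^ 2 - (2 y - 1) ^ 2 = 4 (x - y)
    (x - (1 - y))]; by the symmetry about [1 / 2] the last two factors have the same mean
    logarithm. *)
Let L_double x : 0 <= x -> L ((2 * x - 1) ^+ 2) = pi / 2 * ln 4 + 2 * L x.
Proof.
move=> x0; have il := integrable_arcsine_log x0.
apply: EFin_inj; rewrite -L_E ?sqr_ge0//.
pose h y := ln `|(2 * x - 1) ^+ 2 - y|.
have mh : measurable_fun [set: R] h by rewrite /h; measurable_rules.
rewrite -(integral_cos_sqr_double mh).
pose k y := ln `|x - y|.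
have mk : measurable_fun [set: R] k by rewrite /k; measurable_rules.
have ik : mu.-integrable Q1 (fun al => (k (1 - cos al ^+ 2))%:E).
  apply/integrableP; split.
    apply/measurable_EFinP/measurable_funTS.
    by apply: (@cos_sqr_measurable _ (fun y => k (1 - y))); rewrite /k; measurable_rules.
  rewrite (_ : (\int[mu]_(_ in _) _ = \int[mu]_(al in Q1) (`|k (cos al ^+ 2)|)%:E)%E).
    by have /integrableP[] := il.
  by rewrite -(@integral_cos_sqr_onem _ (fun y => `|k y|))//; exact: measurable_fun_norm.
transitivity (\int[mu]_(al in Q1) (ln 4 + k (cos al ^+ 2) + k (1 - cos al ^+ 2))%:E)%E; last first.
  under eq_integral do rewrite 2!EFinD.
  rewrite integralD//; last exact: (integrableD _ (ic _) il).
  rewrite integralD//; last exact: ic.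
  rewrite (integral_cos_sqr_onem mk) [X in (_ + X + _)%E]L_E// [X in (_ + _ + X)%E]L_E//.
  rewrite (_ : (\int[mu]_(_ in _) _ = (pi / 2 * ln 4)%:E)%E).
    by rewrite -!EFinD; congr EFin; ring.
  rewrite integral_cst//; transitivity ((ln 4 : R)%:E * (pi / 2 : R)%:E)%E.
    by congr (_ * _)%E; exact: mQ1.
  by rewrite -EFinM mulrC.
apply: ae_eq_integral => //.
- apply/measurable_EFinP/measurable_funTS.
  by apply: (@cos_sqr_measurable _ (fun y => h ((2 * y - 1) ^+ 2))); rewrite /h; measurable_rules.
- apply/measurable_EFinP/measurable_funTS.
  by apply: (@cos_sqr_measurable _ (fun y => ln 4 + k y + k (1 - y))); rewrite /k; measurable_rules.
(* The logarithm of the product splits except where a factor vanishes, since [ln 0 = 0]; on [Q1]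
   each factor has at most one zero. *)
have acE (y al : R) : Q1 al -> cos al ^+ 2 = y -> al = acos (Num.sqrt y).
  rewrite /= in_itv/= => /andP[a0 a1] <-; have pp := @pi_gt0 R.
  rewrite sqrtr_sqr ger0_norm; last by apply: cos_ge0_pihalf; apply/andP; split; lra.
  by rewrite cosK// in_itv/=; apply/andP; split; lra.
exists [set acos (Num.sqrt x); acos (Num.sqrt (1 - x))]; split => //.
- by apply: measurableU; exact: measurable_set1.
- by apply: countable_lebesgue_measure0; exact: finite_set_countable.
- move=> al /= hal; apply: contrapT => /not_orP[n1 n2]; apply: hal => Qal; congr EFin.
  rewrite /h /k.
  have d1 : x - cos al ^+ 2 != 0.
    by rewrite subr_eq0; apply/eqP => h1; apply: n1; apply: acE.
  have d2 : x - (1 - cos al ^+ 2) != 0.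
    rewrite subr_eq0; apply/eqP => h1; apply: n2; apply: acE => //; lra.
  rewrite -lnM ?posrE ?normr_gt0// -lnM ?posrE ?normr_gt0 ?mulr_gt0 ?normr_gt0//.
  rewrite -[4 in RHS](@ger0_norm R 4)// -!normrM; congr (ln `|_|); ring.
Qed.

Lemma arcsine_log_potential x : 0 <= x ->
  (\int[mu]_(al in Q1) (ln `|x - cos al ^+ 2|)%:E = (pi / 2 * (green x - ln 4))%:E)%E.
Proof.
move=> x0; have pp := @pi_gt0 R.
rewrite L_E//; congr EFin.
pose E y := L y + pi / 2 * (ln 4 - green y).
pose C : R := 64 + pi / 2 * (ln 4 + ln 2).
have l2 : 0 <= ln 2 :> R by rewrite ln_ge0//; lra.
have l4 : 0 <= ln 4 :> R by rewrite ln_ge0//; lra.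
have EC y : 0 <= y -> `|E y| <= C.
  move=> y0; have /andP[h1 h2] := L_bounds y0; have /andP[g1 g2] := green_bounds y.
  have p2 : 0 <= pi / 2 :> R by lra.
  have k1 := ler_wpM2l p2 g1; have k2 := ler_wpM2l p2 g2.
  have k3 := mulr_ge0 p2 l4; have k4 := mulr_ge0 p2 l2.
  by rewrite ler_norml /E /C; apply/andP; split; lra.
have ET y : 0 <= y -> E ((2 * y - 1) ^+ 2) = 2 * E y.
  by move=> y0; rewrite /E L_double// green_double//; ring.
have En n y : 0 <= y -> 2 ^+ n * `|E y| <= C.
  elim: n y => [|n IH] y y0; first by rewrite expr0 mul1r; exact: EC.
  have := IH _ (sqr_ge0 (2 * y - 1)); rewrite ET// normrM ger0_norm//.
  by rewrite exprSr -mulrA.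
suff : E x = 0 by rewrite /E; lra.
apply/eqP; rewrite -normr_le0 leNgt; apply/negP => e0.
have [n nC] : exists n : nat, C / `|E x| < n%:R.
  by exists (Num.truncn (C / `|E x|)).+1; exact: Num.Theory.truncnS_gt.
have := En n _ x0; rewrite leNgt => /negP; apply.
rewrite -ltr_pdivrMr//; apply: (lt_trans nC).
by rewrite -natrX ltr_nat ltn_expl.
Qed.

End arcsine_potential.

(** * Mixtures of arcsine laws *)

Section arcsine_mixture.
Context {R : realType}.
Local Notation mu := (@lebesgue_measure R).
Local Notation Q1 := (`]0, pi / 2[%classic : set R).
Implicit Types (rho a b x : R).

(* Mixing the images of the arcsine law under [a * _], [0 < a < b], with these
   weights gives [mix_density rho b] up to the factor [pi / 2]. *)
Definition mix_weight rho a : R := ((1 + rho * a) * Num.sqrt (1 + rho * a))^-1.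

Definition mix_density rho b x : R :=
  Num.sqrt (b - x) / (Num.sqrt x * ((1 + rho * x) * Num.sqrt (1 + rho * b))).

Lemma mix_weight_ge0 rho a : 0 <= mix_weight rho a.
Proof.
rewrite /mix_weight invr_ge0; have [h|h] := leP 0 (1 + rho * a).
  by rewrite mulr_ge0 ?sqrtr_ge0.
by rewrite ler0_sqrtr ?mulr0// ltW.
Qed.

Lemma measurable_mix_weight rho : measurable_fun [set: R] (mix_weight rho).
Proof. by rewrite /mix_weight; measurable_rules. Qed.

Lemma mix_density_ge0 rho b x : 0 <= rho -> 0 <= x -> 0 <= mix_density rho b x.
Proof.
move=> r0 x0; rewrite /mix_density divr_ge0 ?sqrtr_ge0//.
by rewrite !mulr_ge0 ?sqrtr_ge0// addr_ge0// mulr_ge0.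
Qed.

Lemma measurable_mix_density rho b : measurable_fun [set: R] (mix_density rho b).
Proof. by rewrite /mix_density; measurable_rules. Qed.

(** For fixed [x] the scale is [a = x / cos al ^ 2], and [a < b] amounts to
    [al < acos (sqrt (x / b))]. In [t = tan al] the integrand is [u ^ (-3/2)] with
    [u = 1 + rho x + rho x t ^ 2], whose antiderivative is [t / ((1 + rho x) sqrt u)]. *)
Lemma integral_mix_weight_secant rho b x : 0 <= rho -> 0 < x < b ->
  (\int[mu]_(al in `]0%R, acos (Num.sqrt (x / b))[)
     (mix_weight rho ((cos al ^+ 2)^-1 * x) * (cos al ^+ 2)^-1)%:E =
   (mix_density rho b x)%:E)%E.
Proof.
move=> r0 /andP[x0 xb]; have b0 : 0 < b by lra.
have xb0 : 0 < x / b by rewrite divr_gt0.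
have xb1 : x / b < 1 by rewrite ltr_pdivrMr// mul1r.
have s0 : 0 < Num.sqrt (x / b) by rewrite sqrtr_gt0.
have s1 : Num.sqrt (x / b) < 1 by rewrite -sqrtr1 ltr_sqrt.
set A := acos _; have pp := @pi_gt0 R.
have A0 : 0 < A by rewrite acos_gt0//; apply/andP; split; lra.
have cA : cos A = Num.sqrt (x / b) by rewrite acosK// in_itv/=; apply/andP; split; lra.
have Api : A <= pi by rewrite acos_lepi//; apply/andP; split; lra.
have A2 : A < pi / 2.
  rewrite -ltr_cos ?in_itv/= ?cos_pihalf ?cA//; first by apply/andP; split; lra.
  by apply/andP; split; lra.
have cgt0 al : 0 <= al <= A -> 0 < cos al.
  by move=> /andP[h1 h2]; apply: cos_gt0_pihalf; apply/andP; split; lra.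
have rx : 0 <= rho * x by rewrite mulr_ge0// ltW.
have rb : 0 <= rho * b by rewrite mulr_ge0// ltW.
pose u al : R := 1 + rho * x + rho * x * (tan al * tan al).
have u0 al : 0 < u al.
  by rewrite /u; have := mulr_ge0 rx (sqr_ge0 (tan al)); rewrite expr2; lra.
have cosE al : cos al != 0 -> (cos al ^+ 2)^-1 = 1 + tan al ^+ 2 by move=> /cos2_tan2.
have uE al : cos al != 0 -> 1 + rho * ((cos al ^+ 2)^-1 * x) = u al.
  by move=> c0; rewrite cosE// /u; ring.
pose F al := tan al / ((1 + rho * x) * Num.sqrt (u al)).
have dF al : 0 <= al <= A -> has_derivative F al
    (mix_weight rho ((cos al ^+ 2)^-1 * x) * (cos al ^+ 2)^-1).
  move=> /cgt0 c0; have cn0 : cos al != 0 by rewrite gt_eqF.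
  apply: has_derivative_eq.
    rewrite /F /u; derive_rules => //; last exact: u0.
    by rewrite mulf_neq0 ?gt_eqF ?sqrtr_gt0 ?u0// ltr_pwDl.
  rewrite /= /mix_weight uE// cosE// -/(u al).
  have v0 : 0 < Num.sqrt (u al) by rewrite sqrtr_gt0.
  have v2 : Num.sqrt (u al) ^+ 2 = u al by rewrite sqr_sqrtr// ltW.
  rewrite -[X in _ = (X * _)^-1 * _]v2; move: v0 v2; rewrite {3}/u.
  move: (Num.sqrt _) (tan al) (rho * x) rx => v t k k0 v0 v2.
  have vn0 : v != 0 by rewrite gt_eqF.
  have kn0 : 1 + k != 0 by rewrite gt_eqF// ltr_pwDl.
  transitivity ((1 + t ^+ 2) / ((1 + k) * v) * (1 - k * (t * t) / v ^+ 2)).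
    by field; rewrite ?vn0 ?kn0.
  have -> : k * (t * t) = v ^+ 2 - 1 - k by lra.
  by field; rewrite ?vn0 ?kn0.
have cF al : 0 <= al <= A -> {for al, continuous F}.
  by move=> /dF-[dFal _]; exact/differentiable_continuous/derivable1_diffP.
have FA : F A - F 0 = mix_density rho b x.
  have cA0 : cos A != 0 by rewrite cA gt_eqF.
  have uA : u A = 1 + rho * b.
    by rewrite -uE// cA sqr_sqrtr ?ltW//; field; rewrite !gt_eqF.
  have sb0 : 0 < Num.sqrt b by rewrite sqrtr_gt0.
  rewrite /F tan0 mul0r subr0 uA /mix_density /tan cA sin_acos; last first.
    by apply/andP; split; lra.
  rewrite sqr_sqrtr ?ltW//.
  have -> : Num.sqrt (b - x) = Num.sqrt b * Num.sqrt (1 - x / b).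
    by rewrite -sqrtrM ?ltW//; congr Num.sqrt; field; rewrite gt_eqF.
  have -> : Num.sqrt x = Num.sqrt b * Num.sqrt (x / b).
    by rewrite -sqrtrM ?ltW//; congr Num.sqrt; field; rewrite gt_eqF.
  have sr0 : 0 < Num.sqrt (1 + rho * b) by rewrite sqrtr_gt0 ltr_pwDl.
  have k0 : 1 + rho * x != 0 by rewrite gt_eqF// ltr_pwDl.
  by field; rewrite k0 !gt_eqF.
rewrite -FA; apply: (@ge0_integral_FTC_oo _ _ F) => //.
- by move=> al /andP[h1 h2]; apply: dF; rewrite !ltW.
- move=> al /andP[h1 h2].
  have c0 : 0 < cos al by apply: cgt0; rewrite !ltW.
  have c2 : 0 < cos al ^+ 2 by rewrite exprn_gt0.
  have w0 : 0 < 1 + rho * ((cos al ^+ 2)^-1 * x) by rewrite uE// gt_eqF.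
  rewrite /mix_weight; cvg_rules; rewrite ?gt_eqF//.
  by rewrite mulr_gt0// sqrtr_gt0.
- by move=> al _; rewrite mulr_ge0 ?mix_weight_ge0// invr_ge0 sqr_ge0.
- by apply: cvg_at_right_filter; apply: cF; rewrite lexx ltW.
- by apply: cvg_at_left_filter; apply: cF; rewrite lexx ltW.
Qed.

(** Exchange the integrals over [a] and [al], substitute [x = a * cos al ^ 2] at fixed [al],
    exchange again, and evaluate the remaining integral over [al]. *)
Lemma integral_mix_density rho b (h : R -> R) : 0 <= rho -> 0 < b ->
  measurable_fun [set: R] h -> (forall x, 0 <= h x) ->
  (\int[mu]_(x in `]0%R, b[) (mix_density rho b x * h x)%:E =
   \int[mu]_(a in `]0%R, b[) ((mix_weight rho a)%:E *
     \int[mu]_(al in Q1) (h (a * cos al ^+ 2)%R)%:E))%E.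
Proof.
move=> r0 b0 mh h0; have pp := @pi_gt0 R.
have mw := measurable_mix_weight rho.
have w0 := mix_weight_ge0 rho.
have mh2 : measurable_fun [set: R * R] (fun z : R * R => h (z.1 * cos z.2 ^+ 2)).
  by apply: (measurableT_comp mh); measurable_rules.
pose f (z : R * R) := (mix_weight rho z.1 * h (z.1 * cos z.2 ^+ 2))%:E.
have mf : measurable_fun setT f.
  apply/measurable_EFinP; apply: measurable_funM => //.
  by apply: (measurableT_comp mw); exact: measurable_fst.
have f0 z : (0 <= f z)%E by rewrite lee_fin mulr_ge0.
transitivity (\int[mu]_(a in `]0%R, b[) \int[mu]_(al in Q1) f (a, al))%E; last first.
  apply: eq_integral => a _; rewrite -ge0_integralZl//.
  - apply/measurable_EFinP/measurable_funTS.
    by apply: (measurableT_comp mh); measurable_rules.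
  - by move=> al _; rewrite lee_fin.
  - by rewrite lee_fin.
rewrite ge0_tonelli//.
(* The range of [x] depends on [al]; it is moved into the integrand so that Tonelli applies on a
   rectangle. *)
pose g (z : R * R) := (if z.2 < b * cos z.1 ^+ 2 then
  mix_weight rho ((cos z.1 ^+ 2)^-1 * z.2) * (cos z.1 ^+ 2)^-1 * h z.2 else 0)%:E.
have mg : measurable_fun setT g.
  apply/measurable_EFinP; apply: measurable_fun_ifT => //; first by measurable_rules.
  apply: measurable_funM; last exact: (measurableT_comp mh).
  apply: measurable_funM; last by measurable_rules.
  by apply: (measurableT_comp mw); measurable_rules.
have g0 z : (0 <= g z)%E.
  by rewrite lee_fin; case: ifPn => // _; rewrite !mulr_ge0// invr_ge0 sqr_ge0.
transitivity (\int[mu]_(al in Q1) \int[mu]_(x in `]0%R, b[) g (al, x))%E; last first.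
  apply: eq_integral => al; rewrite inE/= in_itv/= => /andP[al0 al1].
  have c0 : 0 < cos al by apply: cos_gt0_pihalf; apply/andP; split; lra.
  have c2 : 0 < cos al ^+ 2 by rewrite exprn_gt0.
  have c1 : cos al ^+ 2 <= 1 by rewrite -(cos2Dsin2 al) lerDl sqr_ge0.
  have ci0 : (cos al ^+ 2)^-1 != 0 by rewrite invr_eq0 gt_eqF.
  rewrite [RHS](@integral_affine_set _ _ (fun a => mix_weight rho a * h (a * cos al ^+ 2)) (cos al ^+ 2)^-1 0)//; last first.
    apply: measurable_funM => //.
    by apply: (measurableT_comp mh); measurable_rules.
  rewrite gtr0_norm ?invr_gt0// (_ : [set a | `]0, b[%classic ((cos al ^+ 2)^-1 * a + 0)] = `]0, b * cos al ^+ 2[%classic); last first.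
    by apply/seteqP; split => x /=;
      rewrite !in_itv/= addr0 (mulrC _^-1) pmulr_lgt0 ?invr_gt0// ltr_pdivrMr.
  rewrite -ge0_integralZl//; first last.
  - by rewrite lee_fin invr_ge0 ltW.
  - by move=> x _; rewrite lee_fin mulr_ge0.
  - apply/measurable_EFinP/measurable_funTS; apply: measurable_funM.
      by apply: (measurableT_comp mw); measurable_rules.
    by apply: (measurableT_comp mh); measurable_rules.
  rewrite [LHS]integral_mkcond [RHS]integral_mkcond; apply: eq_integral => x _.
  rewrite !patchE !mem_setE !in_itv/= /g/= addr0.
  have [x0|]//= := ltP 0 x.
  have [xc|] := ltP x (b * cos al ^+ 2); last by case: ifPn.
  have -> : x < b by apply: lt_le_trans xc _; rewrite ler_piMr// ltW.
  rewrite -EFinM; congr EFin.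
  have -> : (cos al ^+ 2)^-1 * x * cos al ^+ 2 = x by field; rewrite gt_eqF.
  by ring.
rewrite (@ge0_tonelli _ Q1 `]0, b[ g)//.
apply: eq_integral => x; rewrite inE/= in_itv/= => /andP[x0 xb].
have xb0 : 0 < x / b by rewrite divr_gt0.
have xb1 : x / b < 1 by rewrite ltr_pdivrMr// mul1r.
have s0 : 0 < Num.sqrt (x / b) by rewrite sqrtr_gt0.
have s1 : Num.sqrt (x / b) < 1 by rewrite -sqrtr1 ltr_sqrt.
have sin : Num.sqrt (x / b) \in `[-1, 1] by rewrite in_itv/=; apply/andP; split; lra.
have A0 : 0 < acos (Num.sqrt (x / b)) by rewrite acos_gt0//; apply/andP; split; lra.
have A1 : acos (Num.sqrt (x / b)) <= pi by rewrite acos_lepi//; apply/andP; split; lra.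
have A2 : acos (Num.sqrt (x / b)) < pi / 2.
  rewrite -ltr_cos ?in_itv/= ?cos_pihalf ?acosK//; first by apply/andP; split; lra.
  by apply/andP; split; lra.
have xb' : 0 < x < b by rewrite x0.
rewrite EFinM -(integral_mix_weight_secant r0 xb') -ge0_integralZr//; first last.
- by rewrite lee_fin.
- by move=> al _; rewrite lee_fin mulr_ge0// invr_ge0 sqr_ge0.
- apply/measurable_EFinP/measurable_funTS; apply: measurable_funM.
    by apply: (measurableT_comp mw); measurable_rules.
  by measurable_rules.
rewrite [LHS]integral_mkcond [RHS]integral_mkcond; apply: eq_integral => al _.
rewrite !patchE !mem_setE !in_itv/= /g/=.
have [al0|]//= := ltP 0 al.
have [al1|al1] := ltP al (pi / 2); last first.
  by rewrite ifF//; apply/negbTE; rewrite -leNgt; lra.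
have c0 : 0 < cos al by apply: cos_gt0_pihalf; apply/andP; split; lra.
have -> : (x < b * cos al ^+ 2) = (al < acos (Num.sqrt (x / b))).
  have alpi : al <= pi by lra.
  rewrite -[RHS]ltr_cos ?in_itv/= ?(ltW A0) ?A1 ?(ltW al0)//.
  rewrite acosK// -ltr_pdivrMl// mulrC -[in RHS](ger0_norm (ltW c0)) -sqrtr_sqr.
  by rewrite ltr_sqrt// exprn_gt0.
by case: ifPn.
Qed.

End arcsine_mixture.

(** * Closed forms of integrals against the mixing weight *)

Section weight_integrals.
Context {R : realType}.
Local Notation mu := (@lebesgue_measure R).
Implicit Types (rho a b x : R).

Lemma cvg_mul_ln : a * ln a @[a --> (0 : R)^'+] --> (0 : R).
Proof.
apply/cvgr0Pnorm_le => /= e e0.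
near=> a.
have a0 : 0 < a by near: a; exact: nbhs_right_gt.
have a1 : a < 1 by near: a; exact: nbhs_right_lt.
have ae : a < (e / 2) ^+ 2 by near: a; apply: nbhs_right_lt; rewrite exprn_gt0// divr_gt0.
have sa : 0 < Num.sqrt a by rewrite sqrtr_gt0.
have h := oppr_ln_le_inv_sqrt a0.
have l0 : ln a <= 0 by rewrite ln_le0// ltW.
rewrite normrM (gtr0_norm a0) (ler0_norm l0).
apply: (@le_trans _ _ (a * (2 / Num.sqrt a))); first by rewrite ler_wpM2l// ltW.
rewrite -{1}(sqr_sqrtr (ltW a0)).
have -> : Num.sqrt a ^+ 2 * (2 / Num.sqrt a) = 2 * Num.sqrt a by field; rewrite gt_eqF.
have : Num.sqrt a <= e / 2.
  have -> : e / 2 = Num.sqrt ((e / 2) ^+ 2) by rewrite sqrtr_sqr gtr0_norm// divr_gt0.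
  by apply: ler_wsqrtr; exact: ltW.
lra.
Unshelve. all: by end_near. Qed.

(** The mean [a / 2] of the arcsine law of [[0, a]] minus the logarithm of the capacity [a / 4] of
    that interval: the part independent of [x] in the [log_kernel] potential of the law. *)
Definition log_defect a : R := a / 2 - ln (a / 4).

Lemma log_defect_ge0 a : 0 < a -> 0 <= log_defect a.
Proof.
move=> a0; have a4 : 0 < a / 4 by rewrite divr_gt0.
by have := ltW (ln_sublinear a4); rewrite /log_defect; lra.
Qed.

Lemma cvg_mul_ln4 : a * ln (a / 4) @[a --> (0 : R)^'+] --> (0 : R).
Proof.
have h : a * ln a - a * ln 4 @[a --> (0 : R)^'+] --> (0 : R) - 0 * ln 4.
  apply: cvgD_fun; first exact: cvg_mul_ln.
  by apply: cvgN_fun; apply: cvg_at_right_filter; cvg_rules.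
rewrite mul0r subr0 in h; apply: cvg_trans h; apply: near_eq_cvg; near=> a.
have a0 : 0 < a by near: a; exact: nbhs_right_gt.
by rewrite ln_div ?posrE//; ring.
Unshelve. all: by end_near. Qed.

Let cvg_log_defect a : 0 < a -> {for a, continuous log_defect}.
Proof. by move=> a0; rewrite /log_defect; cvg_rules; rewrite divr_gt0. Qed.

Lemma integral_log_defect b : 0 < b ->
  (\int[mu]_(a in `]0%R, b[) (log_defect a)%:E = (b * b / 4 - b * ln (b / 4) + b)%:E)%E.
Proof.
move=> b0; pose F a := a * a / 4 - a * ln (a / 4) + a.
rewrite -[X in _ = X%:E]subr0 -/(F b).
apply: (@ge0_integral_FTC_oo _ _ F _ _ _ _ b0).
- move=> a /andP[a0 _]; apply: has_derivative_eq.
    by rewrite /F; derive_rules; rewrite divr_gt0.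
  by rewrite /= /log_defect ; set l := ln _; field; rewrite gt_eqF.
- by move=> a /andP[a0 _]; exact: cvg_log_defect.
- by move=> a /andP[a0 _]; exact: log_defect_ge0.
- apply: cvg_lim_eq.
    apply: cvgD_fun; last by apply: cvg_at_right_filter; cvg_rules.
    apply: cvgD_fun; last by apply: cvgN_fun; exact: cvg_mul_ln4.
    by apply: cvg_at_right_filter; cvg_rules.
  by ring.
- by apply: cvg_at_left_filter; rewrite /F; cvg_rules; rewrite divr_gt0.
Qed.

(** The form that [green (x / a)] takes for [0 < a <= x], free of maximum and quotient so that it
    can be differentiated in [a]. *)
Definition green_kernel x a : R := 2 * ln (Num.sqrt x + Num.sqrt (x - a)) - ln a.

Let pq_gt0 x a : 0 < x -> 0 < Num.sqrt x + Num.sqrt (x - a).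
Proof. by move=> x0; rewrite ltr_pwDl ?sqrtr_ge0 ?sqrtr_gt0. Qed.

Lemma green_kernelE x a : 0 < a <= x -> green (x / a) = green_kernel x a.
Proof.
move=> /andP[a0 ax]; have x0 : 0 < x by lra.
have sa : 0 < Num.sqrt a by rewrite sqrtr_gt0.
rewrite /green /green_kernel max_l ?ler_pdivlMr ?mul1r//.
have -> : ln a = 2 * ln (Num.sqrt a).
  by rewrite -{1}(sqr_sqrtr (ltW a0)) lnXn// mulr_natl.
rewrite -mulrBr -ln_div ?posrE ?pq_gt0//; congr (2 * ln _).
have -> : Num.sqrt x = Num.sqrt a * Num.sqrt (x / a).
  by rewrite -sqrtrM ?ltW//; congr Num.sqrt; field; rewrite gt_eqF.
have -> : Num.sqrt (x - a) = Num.sqrt a * Num.sqrt (x / a - 1).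
  by rewrite -sqrtrM ?ltW//; congr Num.sqrt; field; rewrite gt_eqF.
by field; rewrite gt_eqF.
Qed.

Lemma green_kernel_ge0 x a : 0 < a <= x -> 0 <= green_kernel x a.
Proof. by move=> h; rewrite -green_kernelE// green_ge0. Qed.

Let cvg_green_kernel x a : 0 < a < x -> {for a, continuous (green_kernel x)}.
Proof.
move=> /andP[a0 ax]; rewrite /green_kernel; cvg_rules => //.
by apply: pq_gt0; exact: lt_trans ax.
Qed.

Let is_derive_green_kernel x a : 0 < a < x ->
  has_derivative (green_kernel x) a (- Num.sqrt x / (a * Num.sqrt (x - a))).
Proof.
move=> /andP[a0 ax]; have x0 := lt_trans a0 ax.
have xa : 0 < x - a by rewrite subr_gt0.
apply: has_derivative_eq; first by rewrite /green_kernel; derive_rules => //; exact: pq_gt0.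
have p2 := sqr_sqrtr (ltW x0); have q2 := sqr_sqrtr (ltW xa).
have p0 : 0 < Num.sqrt x by rewrite sqrtr_gt0.
have q0 : 0 < Num.sqrt (x - a) by rewrite sqrtr_gt0.
rewrite /=; set q := Num.sqrt (x - a) in q2 q0 *; set p := Num.sqrt x in p2 p0 *.
have aE : a = (p - q) * (p + q) by rewrite -subr_sqr p2 q2; ring.
have pq : 0 < p - q.
  by have := a0; rewrite aE pmulr_lgt0//; lra.
clearbody p q; rewrite aE.
by field; rewrite !gt_eqF//; lra.
Qed.

Let cvg_green_kernel_right (f : R -> R) x : 0 < x -> f a @[a --> (0 : R)] --> f 0 ->
  a * (f a * green_kernel x a) @[a --> (0 : R)^'+] --> (0 : R).
Proof.
move=> x0 fc.
have -> : (fun a => a * (f a * green_kernel x a)) =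
    (fun a => a * (f a * (2 * ln (Num.sqrt x + Num.sqrt (x - a)))) + - (f a * (a * ln a))).
  by apply/funext => a; rewrite /green_kernel; ring.
apply: cvg_lim_eq.
  apply: cvgD_fun.
    apply: cvg_at_right_filter; apply: cvgM_fun; first exact: cvg_id.
    by apply: cvgM_fun; [exact: fc|cvg_rules; exact: pq_gt0].
  apply: cvgN_fun; apply: cvgM_fun; first exact: (cvg_at_right_filter fc).
  exact: cvg_mul_ln.
by ring.
Qed.

Let green_kernel_diag x : 0 < x -> green_kernel x x = 0.
Proof. by move=> x0; rewrite -green_kernelE ?x0 ?lexx// divff ?gt_eqF// green_le1. Qed.

Let cvg_green_kernel_left x : 0 < x -> {for x, continuous (green_kernel x)}.
Proof. by move=> x0; rewrite /green_kernel; cvg_rules => //; exact: pq_gt0. Qed.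

(** Integration by parts: the derivative in [a] is [- sqrt x / (a * sqrt (x - a))], and the factor
    [a] cancels. The factor [1 *] in [F] matches the weighted limit at 0 of
    [cvg_green_kernel_right]. *)
Lemma integral_green_kernel x : 0 < x ->
  (\int[mu]_(a in `]0%R, x[) (green_kernel x a)%:E = (2 * x)%:E)%E.
Proof.
move=> x0; pose F a := a * (1 * green_kernel x a) - 2 * (Num.sqrt x * Num.sqrt (x - a)).
have -> : 2 * x = 0 - (0 - 2 * (Num.sqrt x * Num.sqrt (x - 0))).
  by rewrite subr0 -expr2 sqr_sqrtr ?ltW//; ring.
apply: (@ge0_integral_FTC_oo _ _ F _ _ _ _ x0).
- move=> a /andP[a0 ax]; apply: has_derivative_eq.
    rewrite /F; apply: has_derivativeD.
      apply: has_derivativeM; first exact: has_derivative_id.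
      by apply: has_derivativeM; [exact: has_derivative_cst|apply: is_derive_green_kernel; rewrite a0].
    by derive_rules; rewrite subr_gt0.
  have q0 : 0 < Num.sqrt (x - a) by rewrite sqrtr_gt0 subr_gt0.
  by rewrite /=; field; rewrite !gt_eqF.
- by move=> a ax; exact: cvg_green_kernel.
- by move=> a /andP[a0 /ltW ax]; rewrite green_kernel_ge0// a0.
- apply: cvgD_fun; first by apply: (@cvg_green_kernel_right (fun=> 1)) => //; exact: cvg_cst.
  by apply: cvg_at_right_filter; cvg_rules.
- apply: cvg_lim_eq.
    apply: cvg_at_left_filter; apply: cvgD_fun; last by cvg_rules.
    apply: cvgM_fun; first exact: cvg_id.
    by apply: cvgM_fun; [exact: cvg_cst|exact: cvg_green_kernel_left].
  by rewrite green_kernel_diag// subrr sqrtr0; ring.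
Qed.

Section log_mean.
Variable rho : R.
Hypothesis rho0 : 0 < rho.
Local Notation w a := (Num.sqrt (1 + rho * a)).

Let w2_gt0 a : 0 <= a -> 0 < 1 + rho * a.
Proof. by move=> a0; rewrite ltr_pwDl// mulr_ge0// ltW. Qed.

Let w_gt0 a : 0 <= a -> 0 < w a.
Proof. by move=> a0; rewrite sqrtr_gt0 w2_gt0. Qed.

Let w_neq0 a : 0 <= a -> w a != 0.
Proof. by move=> a0; rewrite gt_eqF// w_gt0. Qed.

Let w_sqr a : 0 <= a -> 1 + rho * a = w a ^+ 2.
Proof. by move=> a0; rewrite sqr_sqrtr// ltW// w2_gt0. Qed.

Let aE a : 0 <= a -> a = (w a ^+ 2 - 1) / rho.
Proof. by move=> a0; rewrite -w_sqr//; field; rewrite gt_eqF. Qed.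

Let w0 : w 0 = 1. Proof. by rewrite mulr0 addr0 sqrtr1. Qed.

Let cvg_weight a : 0 < a -> {for a, continuous (mix_weight rho)}.
Proof.
move=> a0; rewrite /mix_weight; cvg_rules; rewrite gt_eqF// mulr_gt0 ?w_gt0 ?w2_gt0//; exact: ltW.
Qed.

Lemma integral_mix_weight b : 0 < b ->
  (\int[mu]_(a in `]0%R, b[) (mix_weight rho a)%:E = (2 / rho * (1 - (w b)^-1))%:E)%E.
Proof.
move=> b0; pose F a := - (2 / rho * (w a)^-1).
have -> : 2 / rho * (1 - (w b)^-1) = F b - F 0 by rewrite /F w0 invr1; ring.
apply: (@ge0_integral_FTC_oo _ _ F _ _ _ _ b0).
- move=> a /andP[/ltW a0 _]; apply: has_derivative_eq.
    by rewrite /F; derive_rules; [exact: w_neq0|exact: w2_gt0].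
  rewrite /= /mix_weight; set v := w a; rewrite (w_sqr a0) -/v.
  have := w_neq0 a0; rewrite -/v; clearbody v => v0.
  by field; rewrite v0 gt_eqF.
- by move=> a /andP[a0 _]; exact: cvg_weight.
- by move=> a _; exact: mix_weight_ge0.
- by apply: cvg_at_right_filter; rewrite /F; cvg_rules; rewrite w0 oner_neq0.
- by apply: cvg_at_left_filter; rewrite /F; cvg_rules; exact: (w_neq0 (ltW b0)).
Qed.

Lemma integral_mix_weight_id b : 0 < b ->
  (\int[mu]_(a in `]0%R, b[) (mix_weight rho a * a)%:E =
   (2 / rho ^+ 2 * (w b + (w b)^-1 - 2))%:E)%E.
Proof.
move=> b0; pose F a := 2 / rho ^+ 2 * (w a + (w a)^-1).
have -> : 2 / rho ^+ 2 * (w b + (w b)^-1 - 2) = F b - F 0 by rewrite /F w0 invr1; ring.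
apply: (@ge0_integral_FTC_oo _ _ F _ _ _ _ b0).
- move=> a /andP[/ltW a0 _]; apply: has_derivative_eq.
    by rewrite /F; derive_rules; [exact: w2_gt0|exact: w_neq0|exact: w2_gt0].
  rewrite /= /mix_weight; set v := w a; rewrite (w_sqr a0) -/v (aE a0) -/v.
  have := w_neq0 a0; rewrite -/v; clearbody v => v0.
  by field; rewrite v0 gt_eqF.
- by move=> a /andP[a0 _]; apply: cvgM_fun => //; exact: cvg_weight.
- by move=> a /andP[/ltW a0 _]; rewrite mulr_ge0 ?mix_weight_ge0.
- by apply: cvg_at_right_filter; rewrite /F; cvg_rules; rewrite w0 oner_neq0.
- by apply: cvg_at_left_filter; rewrite /F; cvg_rules; exact: (w_neq0 (ltW b0)).
Qed.

(** The mean of [ln (1 + rho * x)] under the arcsine law of [[0, a]], as [integral_Q1_ln] shows. *)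
Definition log_mean a : R := 2 * ln ((1 + w a) / 2).

Let h_gt0 a : 0 < (1 + w a) / 2.
Proof. by rewrite divr_gt0// ltr_pwDl ?sqrtr_ge0. Qed.

Let w_ge1 a : 0 <= a -> 1 <= w a.
Proof. by move=> a0; rewrite -[leLHS]sqrtr1; apply: ler_wsqrtr; rewrite lerDl mulr_ge0// ltW. Qed.

Let log_mean_ge0 a : 0 <= a -> 0 <= log_mean a.
Proof. by move=> a0; rewrite /log_mean mulr_ge0// ln_ge0// ler_pdivlMr//; have := w_ge1 a0; lra. Qed.

Let log_mean0 : log_mean 0 = 0.
Proof. by rewrite /log_mean w0 (_ : (1 + 1) / 2 = 1) ?ln1 ?mulr0//; field. Qed.

Let cvg_log_mean a : {for a, continuous log_mean}.
Proof. by rewrite /log_mean; cvg_rules. Qed.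

Lemma integral_log_mean b : 0 < b ->
  (\int[mu]_(a in `]0%R, b[) (log_mean a)%:E = (b * log_mean b - (w b - 1) ^+ 2 / rho)%:E)%E.
Proof.
move=> b0; pose F a := a * log_mean a - (w a - 1) * (w a - 1) / rho.
have -> : b * log_mean b - (w b - 1) ^+ 2 / rho = F b - F 0 by rewrite /F w0; ring.
apply: (@ge0_integral_FTC_oo _ _ F _ _ _ _ b0).
- move=> a /andP[/ltW a0 _]; apply: has_derivative_eq.
    by rewrite /F /log_mean; derive_rules; first [exact: h_gt0|exact: w2_gt0].
  rewrite /= /log_mean; set v := w a; set l := ln _; rewrite {1}(aE a0) -/v.
  have := w_ge1 a0; rewrite -/v; clearbody v l => v0.
  field; rewrite !gt_eqF//; lra.
- by move=> a /andP[a0 _]; exact: cvg_log_mean.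
- by move=> a /andP[/ltW a0 _]; exact: log_mean_ge0.
- apply: cvg_at_right_filter; rewrite /F; apply: cvgD_fun; last by cvg_rules.
  by apply: cvgM_fun => //; exact: cvg_log_mean.
- apply: cvg_at_left_filter; rewrite /F; apply: cvgD_fun; last by cvg_rules.
  by apply: cvgM_fun => //; exact: cvg_log_mean.
Qed.

(** The primitive of [mix_weight] vanishing at 0. The explicit factor [a] absorbs the logarithmic
    singularities at 0 in the integrations by parts. *)
Definition weight_primitive a : R := 2 * a / (w a * (1 + w a)).

Let wp_den a : 0 <= a -> w a * (1 + w a) != 0.
Proof. by move=> a0; rewrite gt_eqF// mulr_gt0 ?w_gt0// ltr_pwDl ?sqrtr_ge0. Qed.

Lemma weight_primitiveE a : 0 <= a -> weight_primitive a = 2 / rho * (1 - (w a)^-1).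
Proof.
move=> a0; rewrite /weight_primitive; set v := w a; rewrite (aE a0) -/v.
have := w_ge1 a0; rewrite -/v; clearbody v => v0.
field; rewrite !gt_eqF//; lra.
Qed.

Let is_derive_wp a : 0 < a -> has_derivative weight_primitive a (mix_weight rho a).
Proof.
move=> /ltW a0; rewrite /weight_primitive; apply: has_derivative_eq.
  by derive_rules; [exact: wp_den|exact: w2_gt0|exact: w2_gt0].
rewrite /= /mix_weight; set v := w a; rewrite (w_sqr a0) -/v (aE a0) -/v.
have := w_ge1 a0; rewrite -/v; clearbody v => v0.
field; rewrite !gt_eqF//; lra.
Qed.

Let cvg_wp a : 0 <= a -> {for a, continuous weight_primitive}.
Proof. by move=> a0; rewrite /weight_primitive; cvg_rules; exact: wp_den. Qed.

Lemma integral_mix_weight_log_mean b : 0 < b ->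
  (\int[mu]_(a in `]0%R, b[) (mix_weight rho a * log_mean a)%:E =
   (weight_primitive b * log_mean b - 4 / rho * (log_mean b - ln (w b)))%:E)%E.
Proof.
move=> b0; pose F a := weight_primitive a * log_mean a - 4 / rho * (log_mean a - ln (w a)).
have -> : weight_primitive b * log_mean b - 4 / rho * (log_mean b - ln (w b)) = F b - F 0.
  by rewrite /F log_mean0 w0 ln1; ring.
apply: (@ge0_integral_FTC_oo _ _ F _ _ _ _ b0).
- move=> a /andP[a1 _]; have a0 := ltW a1; apply: has_derivative_eq.
    rewrite /F /log_mean; apply: has_derivativeD.
      by apply: has_derivativeM; [exact: is_derive_wp|derive_rules;
        first [exact: h_gt0|exact: w2_gt0]].
    by derive_rules; first [exact: h_gt0|exact: w2_gt0|exact: w_gt0].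
  rewrite /= weight_primitiveE// /log_mean /mix_weight; set v := w a; set l := ln _.
  rewrite (w_sqr a0) -/v.
  have := w_ge1 a0; rewrite -/v; clearbody v l => v0.
  field; rewrite !gt_eqF//; lra.
- by move=> a /andP[a0 _]; apply: cvgM_fun; [exact: cvg_weight|exact: cvg_log_mean].
- by move=> a /andP[/ltW a0 _]; rewrite mulr_ge0 ?mix_weight_ge0// log_mean_ge0.
- apply: cvg_at_right_filter; rewrite /F; apply: cvgD_fun.
    by apply: cvgM_fun; [exact: cvg_wp|exact: cvg_log_mean].
  apply: cvgN_fun; apply: cvgM_fun; first exact: cvg_cst.
  by apply: cvgD_fun; [exact: cvg_log_mean|cvg_rules; rewrite w0].
- apply: cvg_at_left_filter; rewrite /F; apply: cvgD_fun.
    by apply: cvgM_fun; [exact: cvg_wp (ltW b0)|exact: cvg_log_mean].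
  apply: cvgN_fun; apply: cvgM_fun; first exact: cvg_cst.
  by apply: cvgD_fun; [exact: cvg_log_mean|cvg_rules; exact: w_gt0 (ltW b0)].
Qed.

(** The term [a / 2] gives half of [integral_mix_weight_id]. For the logarithm, integration by parts
    leaves [weight_primitive a / a], which is the derivative of [2 / rho * log_mean a]. *)
Lemma integral_mix_weight_log_defect b : 0 < b ->
  (\int[mu]_(a in `]0%R, b[) (mix_weight rho a * log_defect a)%:E =
   (- (weight_primitive b * ln (b / 4)) + 2 / rho * log_mean b
    + 1 / rho ^+ 2 * (w b + (w b)^-1 - 2))%:E)%E.
Proof.
move=> b0.
pose F a := - (weight_primitive a * ln (a / 4)) + 2 / rho * log_mean a
    + 1 / rho ^+ 2 * (w a + (w a)^-1 - 2).
rewrite -[X in _ = X%:E]subr0 -/(F b).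
apply: (@ge0_integral_FTC_oo _ _ F _ _ _ _ b0).
- move=> a /andP[a1 _]; have a0 := ltW a1; apply: has_derivative_eq.
    rewrite /F; apply: has_derivativeD; [apply: has_derivativeD|].
    + apply: has_derivativeN; apply: has_derivativeM; first exact: is_derive_wp.
      by derive_rules; rewrite divr_gt0.
    + by rewrite /log_mean; derive_rules; first [exact: h_gt0|exact: w2_gt0].
    + by derive_rules; first [exact: w2_gt0|exact: w_neq0].
  rewrite /= weight_primitiveE// /log_defect /mix_weight; set v := w a; set l := ln _.
  rewrite (w_sqr a0) -/v.
  have v1 : 1 < v by rewrite /v -[X in X < _]sqrtr1 ltr_sqrt ?w2_gt0// ltrDl mulr_gt0.
  have -> : a = (v ^+ 2 - 1) / rho by exact: aE.
  clearbody v l.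
  have v2 : 0 < v ^+ 2 - 1 by nra.
  field; rewrite !gt_eqF//; lra.
- by move=> a /andP[a0 _]; apply: cvgM_fun; [exact: cvg_weight|exact: cvg_log_defect].
- by move=> a /andP[a0 _]; rewrite mulr_ge0 ?mix_weight_ge0// log_defect_ge0.
- apply: cvg_lim_eq.
    apply: cvgD_fun; last by apply: cvg_at_right_filter; cvg_rules; rewrite w0 oner_neq0.
    apply: cvgD_fun; last first.
      by apply: cvg_at_right_filter; apply: cvgM_fun; [exact: cvg_cst|exact: cvg_log_mean].
    apply: cvgN_fun.
    have -> : (fun a => weight_primitive a * ln (a / 4)) =
        (fun a => 2 / (w a * (1 + w a)) * (a * ln (a / 4))).
      by apply/funext => a; rewrite /weight_primitive; ring.
    apply: cvgM_fun; last exact: cvg_mul_ln4.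
    by apply: cvg_at_right_filter; cvg_rules; apply: wp_den.
  by rewrite log_mean0 w0 invr1; ring.
- apply: cvg_at_left_filter; rewrite /F; apply: cvgD_fun; last first.
    by cvg_rules; exact: w_neq0 (ltW b0).
  apply: cvgD_fun; last by apply: cvgM_fun; [exact: cvg_cst|exact: cvg_log_mean].
  apply: cvgN_fun; apply: cvgM_fun; first exact: cvg_wp (ltW b0).
  by cvg_rules; rewrite divr_gt0.
Qed.

(** The identity that singles out this weight: mixing Green functions over [0 < a < x] reproduces
    the constraint function, as the constant weight reproduces [2 * x]. After integration by parts,
    the second term of [F] integrates [- weight_primitive] times the derivative of [green_kernel];
    at [a = x] it reduces to [4 / rho * ln (w x)]. *)
Lemma integral_mix_weight_green_kernel x : 0 < x ->
  (\int[mu]_(a in `]0%R, x[) (mix_weight rho a * green_kernel x a)%:E =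
   (2 / rho * ln (1 + rho * x))%:E)%E.
Proof.
move=> x0; have p0 : 0 < Num.sqrt x by rewrite sqrtr_gt0.
have pw0 a : 0 <= a -> 0 < Num.sqrt x * w a + Num.sqrt (x - a).
  by move=> a0; rewrite ltr_pwDl ?sqrtr_ge0// mulr_gt0// w_gt0.
pose F a := weight_primitive a * green_kernel x a +
  4 / rho * (ln (Num.sqrt x * w a + Num.sqrt (x - a)) - ln (Num.sqrt x + Num.sqrt (x - a))).
have Fx : 2 / rho * ln (1 + rho * x) = F x.
  rewrite /F green_kernel_diag// mulr0 add0r subrr sqrtr0 !addr0.
  rewrite lnM ?posrE ?w_gt0 ?ltW// {1}(w_sqr (ltW x0)) lnXn ?w_gt0 ?ltW// -mulr_natl; ring.
rewrite Fx -[X in _ = X%:E]subr0.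
apply: (@ge0_integral_FTC_oo _ _ F _ _ _ _ x0).
- move=> a /andP[a1 ax]; have a0 := ltW a1.
  have xa : 0 < x - a by rewrite subr_gt0.
  apply: has_derivative_eq.
    rewrite /F; apply: has_derivativeD.
      by apply: has_derivativeM; [exact: is_derive_wp|apply: is_derive_green_kernel; rewrite a1].
    by derive_rules; first [exact: pw0|exact: pq_gt0|exact: w2_gt0|exact: xa].
  rewrite /= weight_primitiveE// /mix_weight; set g := green_kernel x a.
  have p2 := sqr_sqrtr (ltW x0); have q2 := sqr_sqrtr (ltW xa).
  have q0 : 0 < Num.sqrt (x - a) by rewrite sqrtr_gt0.
  (* With [p], [q], [v] as free variables, [a = p ^ 2 - q ^ 2] and [rho = (v ^ 2 - 1) / a] are
     rational in them, so the identity is one of rational functions. *)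
  set v := w a; set q := Num.sqrt (x - a) in q2 q0 *; set p := Num.sqrt x in p2 p0 *.
  rewrite (w_sqr a0) -/v.
  have v1 : 1 < v by rewrite /v -[X in X < _]sqrtr1 ltr_sqrt ?w2_gt0// ltrDl mulr_gt0.
  have aE1 : a = (p - q) * (p + q) by rewrite -subr_sqr p2 q2; ring.
  have pq : 0 < p - q by have := a1; rewrite aE1 pmulr_lgt0//; lra.
  have rE : rho = (v ^+ 2 - 1) / ((p - q) * (p + q)).
    by rewrite -aE1 /v -w_sqr//; field; rewrite gt_eqF.
  rewrite -/v; clearbody v p q g; rewrite aE1 rE.
  have v2 : 0 < v ^+ 2 - 1 by nra.
  have pv : 0 < p * v by rewrite mulr_gt0//; lra.
  field; rewrite !gt_eqF//; lra.
- by move=> a ax; apply: cvgM_fun; [apply: cvg_weight; case/andP: ax|exact: cvg_green_kernel].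
- by move=> a /andP[a0 /ltW ax]; rewrite mulr_ge0 ?mix_weight_ge0// green_kernel_ge0// a0.
- apply: cvg_lim_eq.
    apply: cvgD_fun; last first.
      by apply: cvg_at_right_filter; cvg_rules; first [exact: pw0|exact: pq_gt0].
    have -> : (fun a => weight_primitive a * green_kernel x a) =
      (fun a => a * (2 / (w a * (1 + w a)) * green_kernel x a)).
      by apply/funext => a; rewrite /weight_primitive; ring.
    apply: (@cvg_green_kernel_right (fun a => 2 / (w a * (1 + w a)))) => //.
    by cvg_rules; apply: wp_den.
  by rewrite w0 mulr1; ring.
- apply: cvg_at_left_filter; rewrite /F; apply: cvgD_fun.
    by apply: cvgM_fun; [exact: cvg_wp (ltW x0)|exact: cvg_green_kernel_left].
  by cvg_rules; first [exact: pw0 (ltW x0)|exact: pq_gt0].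
Qed.

End log_mean.

End weight_integrals.

(** * Averages over the arcsine law of [[0, a]] *)

Section mixture_values.
Context {R : realType}.
Local Notation mu := (@lebesgue_measure R).
Local Notation Q1 := (`]0, pi / 2[%classic : set R).
Implicit Types (rho a b x y : R).

(* The first two terms make the kernel nonnegative, so that Tonelli applies;
   they contribute twice the first moment to the energy. *)
Definition log_kernel x y : R := `|x| + `|y| - ln `|x - y|.

Lemma log_kernel_ge0 x y : 0 <= log_kernel x y.
Proof.
rewrite subr_ge0; apply: le_trans (ler_normB x y).
have [->|ne] := eqVneq `|x - y| 0; first by rewrite ln0.
by apply/ltW/ln_sublinear; rewrite lt0r ne normr_ge0.
Qed.

Lemma measurable_log_kernel x : measurable_fun [set: R] (log_kernel x).
Proof. by rewrite /log_kernel; measurable_rules. Qed.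

Lemma measurable_green : measurable_fun [set: R] (@green R).
Proof.
rewrite /green; apply: measurable_funM => //; apply: measurable_fun_ln.
apply: measurable_funD; apply: measurable_fun_sqrt; last by measurable_rules.
by apply: measurable_maxr; measurable_rules.
Qed.

Lemma ge0_integrable (D : set R) (f : R -> R) (v : R) : measurable D ->
  measurable_fun D f -> (forall x, D x -> 0 <= f x) ->
  (\int[mu]_(x in D) (f x)%:E = v%:E)%E -> mu.-integrable D (EFin \o f).
Proof.
move=> mD mf f0 fv; apply/integrableP; split; first exact/measurable_EFinP.
rewrite (_ : (\int[mu]_(_ in _) _ = v%:E)%E) ?ltry// -fv.
by apply: eq_integral => x /[!inE] Dx; rewrite /= ger0_norm// f0.
Qed.

Let mQ1 : mu Q1 = (pi / 2)%:E.
Proof. by rewrite lebesgue_measure_itv/= lte_fin divr_gt0 ?pi_gt0// oppr0 adde0. Qed.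

Let fQ1 : (mu Q1 < +oo)%E.
Proof. by rewrite mQ1 ltry. Qed.

Lemma integral_Q1_cst (c : R) : (\int[mu]_(al in Q1) c%:E = (pi / 2 * c)%:E)%E.
Proof.
rewrite integral_cst//; transitivity (c%:E * (pi / 2 : R)%:E)%E.
  by congr (_ * _)%E; exact: mQ1.
by rewrite -EFinM mulrC.
Qed.

Let ic (c : R) : mu.-integrable Q1 (EFin \o cst c).
Proof. by apply: integrable_cst_itv => //; exact: fQ1. Qed.

Let mcos2 (D : set R) : measurable_fun D (fun al : R => cos al ^+ 2).
Proof. by measurable_rules. Qed.

Let cos01 (al : R) : 0 <= cos al ^+ 2 <= 1.
Proof. by rewrite sqr_ge0/= -(cos2Dsin2 al) lerDl sqr_ge0. Qed.

Let icos2 : mu.-integrable Q1 (EFin \o (fun al : R => cos al ^+ 2)).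
Proof.
apply: measurable_bounded_integrable => //; first exact: mcos2.
exists 1; split=> // y y1 al _ /=; have /andP[c0 c1] := cos01 al.
by rewrite ger0_norm// (le_trans c1)// ltW.
Qed.

Let int_cos2 : (\int[mu]_(al in Q1) (cos al ^+ 2)%:E = (pi / 4)%:E)%E.
Proof.
(* Reflection equates the integral with [pi / 2] minus itself. *)
have := integral_cos_sqr_onem (@measurable_id _ R [set: R]).
under eq_integral do rewrite EFinB.
rewrite integralB//; last exact: (ic 1).
rewrite integral_Q1_cst -(@fineK _ (\int[mu]_(al in Q1) (cos al ^+ 2)%:E)%E); last first.
  exact: integrable_fin_num.
by rewrite -EFinB => -[] h; congr EFin; lra.
Qed.

Lemma integral_Q1_id a : 0 <= a ->
  (\int[mu]_(al in Q1) (`|a * cos al ^+ 2|)%:E = (pi / 4 * a)%:E)%E.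
Proof.
move=> a0; transitivity (\int[mu]_(al in Q1) (a%:E * (cos al ^+ 2)%:E))%E.
  by apply: eq_integral => al _; rewrite ger0_norm// mulr_ge0 ?sqr_ge0.
by rewrite integralZl// int_cos2 -EFinM mulrC.
Qed.

(** With [c] the squared cosine, [1 + rho a c = rho a (X - (1 - c))] for [X = 1 + 1 / (rho a) > 1];
    by reflection this is the arcsine potential at the point [X] outside [[0, 1]]. *)
Lemma integral_Q1_ln rho a : 0 < rho -> 0 < a ->
  (\int[mu]_(al in Q1) (ln (1 + rho * `|a * cos al ^+ 2|))%:E =
   (pi / 2 * log_mean rho a)%:E)%E.
Proof.
move=> r0 a0; have ra0 : 0 < rho * a by rewrite mulr_gt0.
pose X := 1 + (rho * a)^-1.
have X1 : 1 < X by rewrite /X ltrDl invr_gt0.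
have X0 : 0 <= X by lra.
have mk : measurable_fun [set: R] (fun y => ln `|X - y|) by measurable_rules.
have EX := integral_cos_sqr_onem mk.
rewrite arcsine_log_potential// in EX.
pose h (al : R) := ln (1 + rho * `|a * cos al ^+ 2|).
have h1 (al : R) : 1 <= 1 + rho * `|a * cos al ^+ 2| by rewrite lerDl mulr_ge0// ltW.
have ih : mu.-integrable Q1 (EFin \o h).
  apply: measurable_bounded_integrable => //; first by rewrite /h; measurable_rules.
  exists (ln (1 + rho * a)); split; [exact: num_real|move=> y hy al _ /=].
  have /andP[c0 c1] := cos01 al.
  rewrite ger0_norm ?ln_ge0//; apply: le_trans (ltW hy); rewrite ler_ln ?posrE; last 2 first.
  - exact: lt_le_trans (h1 al).
  - by rewrite ltr_wpDr// ltW.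
  rewrite lerD2l ler_pM2l// ger0_norm; first by rewrite ler_piMr// ltW.
  by rewrite mulr_ge0// ltW.
move: EX; rewrite (_ : (\int[mu]_(al in Q1) (ln `|X - (1 - cos al ^+ 2)|)%:E =
    \int[mu]_(al in Q1) ((h al)%:E - (ln (rho * a))%:E))%E); last first.
  apply: eq_integral => al _; have /andP[c0 c1] := cos01 al.
  have h0 := lt_le_trans ltr01 (h1 al).
  rewrite -EFinB -ln_div ?posrE//; congr (ln _)%:E.
  have ri0 : 0 < (rho * a)^-1 by rewrite invr_gt0.
  rewrite (@ger0_norm _ (a * _)); last by rewrite mulr_ge0// ltW.
  rewrite ger0_norm; last by rewrite /X; lra.
  by rewrite /X; field; rewrite !gt_eqF.
rewrite integralB//; last exact: (ic (ln (rho * a))).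
rewrite integral_Q1_cst -(@fineK _ (\int[mu]_(al in Q1) (h al)%:E)%E); last first.
  exact: integrable_fin_num.
rewrite -EFinB => -[] EX; congr EFin.
have Xs : Num.sqrt X = Num.sqrt (1 + rho * a) / Num.sqrt (rho * a).
  rewrite -[X in X / _](_ : Num.sqrt (X * (rho * a)) = _); last first.
    by congr Num.sqrt; rewrite /X; field; rewrite !gt_eqF.
  by rewrite sqrtrM// mulfK// gt_eqF// sqrtr_gt0.
have : green X - ln 4 + ln (rho * a) = log_mean rho a.
  rewrite /green max_l ?(ltW X1)// /log_mean.
  have -> : ln 4 = 2 * ln 2 :> R by rewrite mulr_natl -lnXn//; congr ln; ring.
  have -> : ln (rho * a) = 2 * ln (Num.sqrt (rho * a)).
    by rewrite -{1}(sqr_sqrtr (ltW ra0)) lnXn ?sqrtr_gt0// mulr_natl.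
  rewrite -mulrBr -mulrDr Xs.
  have sX : Num.sqrt (X - 1) = (Num.sqrt (rho * a))^-1 by rewrite /X addrC addKr sqrtrV// ltW.
  have s0 : 0 < Num.sqrt (rho * a) by rewrite sqrtr_gt0.
  have w0 := sqrtr_ge0 (1 + rho * a).
  rewrite sX -ln_div ?posrE//; last by rewrite ltr_wpDl ?divr_ge0 ?invr_gt0 ?(ltW s0).
  rewrite -lnM ?posrE//; first by congr (2 * ln _); field; rewrite gt_eqF.
  by rewrite divr_gt0// ltr_wpDl ?divr_ge0 ?invr_gt0 ?(ltW s0).
have pp := @pi_gt0 R.
by rewrite /h in EX * => <-; lra.
Qed.

Lemma integral_Q1_log_kernel x a : 0 <= x -> 0 < a ->
  (\int[mu]_(al in Q1) (log_kernel x (a * cos al ^+ 2))%:E =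
   (pi / 2 * (x + log_defect a - green (x / a)))%:E)%E.
Proof.
move=> x0 a0; have xa0 : 0 <= x / a by rewrite divr_ge0// ltW.
have iL := integrable_arcsine_log xa0.
have iC : mu.-integrable Q1 (fun al : R => a%:E * (cos al ^+ 2)%:E)%E.
  by apply: integrableZl => //; exact: icos2.
transitivity (\int[mu]_(al in Q1) (x - ln a + a * cos al ^+ 2
    - ln `|x / a - cos al ^+ 2|)%:E)%E; last first.
  rewrite (_ : (\int[mu]_(_ in _) _ = \int[mu]_(al in Q1) ((x - ln a)%:E +
    a%:E * (cos al ^+ 2)%:E - (ln `|x / a - cos al ^+ 2|)%:E))%E)//.
  have iB : mu.-integrable Q1 (fun al : R => (x - ln a)%:E + a%:E * (cos al ^+ 2)%:E)%E.
    by apply: integrableD => //; exact: (ic (x - ln a)).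
  rewrite integralB// integralD//; last exact: (ic (x - ln a)).
  rewrite integral_Q1_cst integralZl// int_cos2 arcsine_log_potential//.
  rewrite -EFinM; congr EFin.
  by rewrite /log_defect ln_div ?posrE//; field.
apply: ae_eq_integral => //.
- apply/measurable_EFinP/measurable_funTS.
  by apply: (measurableT_comp (measurable_log_kernel x)); measurable_rules.
- by apply/measurable_EFinP/measurable_funTS; measurable_rules.
(* Scaling splits the logarithm as [ln a] plus that of [x / a - cos al ^ 2], except at this angle,
   where the argument is 0 and [ln 0 = 0]. *)
exists [set acos (Num.sqrt (x / a))]; split => //.
  exact: lebesgue_measure_set1.
move=> al /= hal; apply: contrapT => nal; apply: hal.
rewrite in_itv/= => /andP[al0 al1]; have pp := @pi_gt0 R.
have /andP[c0 c1] := cos01 al.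
have d0 : x / a - cos al ^+ 2 != 0.
  rewrite subr_eq0; apply/eqP => h; apply: nal; rewrite h sqrtr_sqr ger0_norm; last first.
    by apply: cos_ge0_pihalf; apply/andP; split; lra.
  by rewrite cosK// in_itv/=; apply/andP; split; lra.
congr EFin; rewrite /log_kernel (ger0_norm x0).
have -> : `|a * cos al ^+ 2| = a * cos al ^+ 2 by apply: ger0_norm; exact: mulr_ge0 (ltW a0) c0.
have -> : x - a * cos al ^+ 2 = a * (x / a - cos al ^+ 2) by field; rewrite gt_eqF.
have -> : ln `|a * (x / a - cos al ^+ 2)| = ln a + ln `|x / a - cos al ^+ 2|.
  by rewrite normrM gtr0_norm// lnM ?posrE ?normr_gt0.
by ring.
Qed.

End mixture_values.

(** * Potentials of the mixtures *)

Section mixture_potential.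
Context {R : realType}.
Local Notation mu := (@lebesgue_measure R).
Local Notation Q1 := (`]0, pi / 2[%classic : set R).
Implicit Types (rho a b x y : R).

Lemma mix_weight0 a : mix_weight 0 a = 1.
Proof. by rewrite /mix_weight mul0r addr0 sqrtr1 mulr1 invr1. Qed.

Lemma integral_mix_density_value rho b (h g : R -> R) (v : R) : 0 <= rho -> 0 < b ->
  measurable_fun [set: R] h -> (forall x, 0 <= h x) -> measurable_fun [set: R] g ->
  (forall a, 0 < a < b ->
    (\int[mu]_(al in Q1) (h (a * cos al ^+ 2))%:E = (pi / 2 * g a)%:E)%E) ->
  (\int[mu]_(a in `]0%R, b[) (mix_weight rho a * g a)%:E = v%:E)%E ->
  (\int[mu]_(x in `]0%R, b[) (mix_density rho b x * h x)%:E = (pi / 2 * v)%:E)%E.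
Proof.
move=> r0 b0 mh h0 mg hg gv; have pp := @pi_gt0 R.
have p2 : 0 < pi / 2 :> R by lra.
have g0 a : 0 < a < b -> 0 <= g a.
  move=> ab; rewrite -(pmulr_rge0 _ p2) -lee_fin -hg//.
  by apply: integral_ge0 => al _; rewrite lee_fin.
rewrite integral_mix_density//.
transitivity (\int[mu]_(a in `]0%R, b[) ((pi / 2)%:E * (mix_weight rho a * g a)%:E))%E.
  apply: eq_integral => a; rewrite inE/= in_itv/= => ab.
  by rewrite hg// -!EFinM; congr EFin; ring.
rewrite ge0_integralZl//; first by rewrite gv -EFinM.
- apply/measurable_EFinP/measurable_funTS; apply: measurable_funM => //.
  exact: measurable_mix_weight.
- by move=> a; rewrite /= in_itv/= => /g0 ga; rewrite lee_fin mulr_ge0 ?mix_weight_ge0.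
- by rewrite lee_fin ltW.
Qed.

Let measurable_green_div x : measurable_fun [set: R] (fun a => green (x / a)).
Proof. by apply: (measurableT_comp measurable_green); measurable_rules. Qed.

Let measurable_log_defect : measurable_fun [set: R] (@log_defect R).
Proof. by rewrite /log_defect; measurable_rules. Qed.

Section weighted_green.
Variables (m : R -> R) (x b V : R).
Hypothesis mm : measurable_fun [set: R] m.
Hypotheses (x0 : 0 < x) (b0 : 0 < b).
Hypothesis mV : (\int[mu]_(a in `]0%R, x[) (m a * green_kernel x a)%:E = V%:E)%E.

Let f a := m a * green (x / a).

Let mf : measurable_fun [set: R] f.
Proof. by rewrite /f; apply: measurable_funM. Qed.

Let mEf (D : set R) : measurable_fun D (EFin \o f).
Proof. by apply/measurable_EFinP/measurable_funTS. Qed.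

Let fV : (\int[mu]_(a in `]0%R, x[) (f a)%:E = V%:E)%E.
Proof.
rewrite -mV; apply: eq_integral => a; rewrite inE/= in_itv/= => /andP[a0 ax].
by rewrite /f green_kernelE// a0 ltW.
Qed.

(** The Green function of [[0, a]] vanishes at [x] as soon as [a >= x], so the scales between [x]
    and [b] contribute nothing. *)
Lemma integral_green_le : x <= b -> (\int[mu]_(a in `]0%R, b[) (f a)%:E = V%:E)%E.
Proof.
rewrite le_eqVlt => /predU1P[<-//|xb].
have -> : `]0, b[%classic = `]0, x[ `|` `[x, b[ :> set R.
  by rewrite -itv_bndbnd_setU// bnd_simp ?ltW.
rewrite integral_setU//; last 2 first.
- exact: mEf.
- apply/disj_set2P; rewrite -subset0 => y [] /=; rewrite !in_itv/=.
  by move=> /andP[_ h1] /andP[h2 _]; move: h1; rewrite ltNge h2.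
rewrite fV [X in (_ + X)%E]integral0_eq ?adde0// => a; rewrite /= in_itv/= => /andP[xa _].
rewrite /f green_le1 ?mulr0// ler_pdivrMr ?mul1r//; exact: lt_le_trans xa.
Qed.

Lemma integral_green_gt : b < x ->
  (\int[mu]_(a in `]0%R, b[) (f a)%:E + \int[mu]_(a in `[b, x[) (f a)%:E = V%:E)%E.
Proof.
move=> bx; rewrite -integral_setU//; last 2 first.
- exact: mEf.
- apply/disj_set2P; rewrite -subset0 => y [] /=; rewrite !in_itv/=.
  by move=> /andP[_ h1] /andP[h2 _]; move: h1; rewrite ltNge h2.
by rewrite -itv_bndbnd_setU// bnd_simp ?ltW.
Qed.

End weighted_green.

Lemma integral_mix_density_log_kernel rho b x (T1 T4 G : R) : 0 <= rho -> 0 < b -> 0 <= x ->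
  (\int[mu]_(a in `]0%R, b[) (mix_weight rho a)%:E = T1%:E)%E ->
  (\int[mu]_(a in `]0%R, b[) (mix_weight rho a * log_defect a)%:E = T4%:E)%E ->
  (\int[mu]_(a in `]0%R, b[) (mix_weight rho a * green (x / a))%:E = G%:E)%E ->
  (\int[mu]_(y in `]0%R, b[) (mix_density rho b y * log_kernel x y)%:E =
   (pi / 2 * (x * T1 + T4 - G))%:E)%E.
Proof.
move=> r0 b0 x0 h1 h4 hG.
have mw := measurable_mix_weight rho.
have w0 := mix_weight_ge0 rho.
have m1 : measurable_fun `]0%R, b[ (mix_weight rho) by exact: measurable_funTS.
have m4 : measurable_fun `]0%R, b[ (fun a => mix_weight rho a * log_defect a).
  by apply: measurable_funTS; exact: measurable_funM.
have mG : measurable_fun `]0%R, b[ (fun a => mix_weight rho a * green (x / a)).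
  by apply: measurable_funTS; exact: measurable_funM.
apply: (@integral_mix_density_value _ _ _ (fun a => x + log_defect a - green (x / a))) => //.
- exact: measurable_log_kernel.
- by move=> y; exact: log_kernel_ge0.
- by apply: measurable_funB => //; apply: measurable_funD.
- by move=> a /andP[a0 _]; exact: integral_Q1_log_kernel.
have i1 : mu.-integrable `]0, b[ (EFin \o mix_weight rho).
  exact: (ge0_integrable _ m1 _ h1).
have i4 : mu.-integrable `]0, b[ (EFin \o (fun a => mix_weight rho a * log_defect a)).
  apply: (ge0_integrable _ m4 _ h4) => // a; rewrite /= in_itv/= => /andP[a0 _].
  by rewrite mulr_ge0// log_defect_ge0.
have iG : mu.-integrable `]0, b[ (EFin \o (fun a => mix_weight rho a * green (x / a))).
  apply: (ge0_integrable _ mG _ hG) => // a _.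
  by rewrite mulr_ge0// green_ge0.
have ix1 : mu.-integrable `]0, b[ (fun a => x%:E * (mix_weight rho a)%:E)%E.
  by apply: integrableZl => //; exact: i1.
have iB : mu.-integrable `]0, b[
    (fun a => x%:E * (mix_weight rho a)%:E + (mix_weight rho a * log_defect a)%:E)%E.
  by apply: integrableD => //; exact: i4.
rewrite (_ : (\int[mu]_(_ in _) _ = \int[mu]_(a in `]0%R, b[)
    (x%:E * (mix_weight rho a)%:E + (mix_weight rho a * log_defect a)%:E
     - (mix_weight rho a * green (x / a))%:E))%E); last first.
  by apply: eq_integral => a _; congr EFin; ring.
rewrite integralB; [|by []|exact: iB|exact: iG].
rewrite integralD; [|by []|exact: ix1|exact: i4].
by rewrite integralZl; [rewrite h1 h4 hG|by []|exact: i1].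
Qed.

End mixture_potential.

(** * The optimal density *)

Section optimal_density.
Context {R : realType}.
Local Notation mu := (@lebesgue_measure R).
Variables (rho k b : R).
Hypotheses (rho0 : 0 < rho) (b0 : 0 < b).
Local Notation s := (Num.sqrt (1 + rho * b)).
Hypothesis krs : k * rho <= s.
Hypothesis kE : k = (b / 2 - 2) / (1 - 1 / s).
Local Notation p := (opt_density rho k b).
Implicit Types (x y : R).

Let rx_ge0 x : 0 <= x -> 0 <= rho * x.
Proof. by move=> x0; rewrite mulr_ge0// ltW. Qed.

Let s_gt1 : 1 < s.
Proof.
have h : 0 < 1 + rho * b by rewrite ltr_pwDl// rx_ge0// ltW.
by rewrite -[X in X < _]sqrtr1 ltr_sqrt// ltrDl mulr_gt0.
Qed.

Let s_neq0 : s != 0. Proof. by rewrite gt_eqF// (lt_trans ltr01). Qed.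

Let s_gt0 : 0 < s. Proof. exact: lt_trans s_gt1. Qed.

Let s_sqr : s ^+ 2 = 1 + rho * b.
Proof. by rewrite sqr_sqrtr// addr_ge0// rx_ge0// ltW. Qed.

Let bE : b = (s ^+ 2 - 1) / rho.
Proof. by rewrite s_sqr; field; rewrite gt_eqF. Qed.

Let kE' : k * (1 - s^-1) = b / 2 - 2.
Proof.
have h : 1 - s^-1 != 0.
  by rewrite subr_eq0 eq_sym invr_eq1; apply/eqP => h; have := s_gt1; rewrite h ltxx.
by rewrite [in LHS]kE mul1r divfK.
Qed.

Lemma opt_density_eq0 x : ~~ (0 < x < b) -> p x = 0.
Proof.
rewrite /opt_density; case: ifPn => // /andP[x0 xb]; rewrite x0/= -leNgt => bx.
have -> : x = b by apply/eqP; rewrite eq_le xb.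
by rewrite subrr sqrtr0 mul0r mul0r.
Qed.

(** Partial fractions in [1 + rho * x]. The two terms are the mixtures with constant weight
    ([rho = 0]) and with [mix_weight rho], so every integral against [p] reduces to two integrals
    over the scale [a]. *)
Lemma opt_densityE x : 0 < x < b ->
  p x = (2 * pi)^-1 * mix_density 0 b x - k * rho / (2 * pi) * mix_density rho b x.
Proof.
move=> /andP[x0 xb]; rewrite /opt_density x0 (ltW xb)/= /mix_density !mul0r !addr0 sqrtr1.
have sx : Num.sqrt x != 0 by rewrite gt_eqF// sqrtr_gt0.
have rx : 1 + rho * x != 0 by rewrite gt_eqF// ltr_pwDl// rx_ge0// ltW.
have pp : pi != 0 :> R by rewrite gt_eqF// pi_gt0.
have := s_neq0; set t := s; clearbody t => t0.
move: (pi : R) pp => P P0; by field; rewrite sx rx P0 t0.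
Qed.

(** The affine factor increases from [1 - k * rho / s] at [x = 0]; the hypothesis [krs] says that
    this value is nonnegative. *)
Lemma opt_density_ge0 x : 0 <= p x.
Proof.
have [/andP[x0 xb]|h] := boolP (0 < x < b); last by rewrite opt_density_eq0.
rewrite /opt_density x0 (ltW xb)/= mulr_ge0//.
  rewrite divr_ge0 ?sqrtr_ge0// !mulr_ge0 ?sqrtr_ge0 ?pi_ge0//.
  by rewrite addr_ge0// rx_ge0// ltW.
have h1 : k * rho / s <= 1 by rewrite ler_pdivrMr ?mul1r//; lra.
have : 0 < rho * x by rewrite mulr_gt0.
lra.
Qed.

Lemma measurable_opt_density : measurable_fun [set: R] p.
Proof.
apply: measurable_fun_ifT; first by measurable_rules.
  by measurable_rules.
by measurable_rules.
Qed.

Lemma integral_opt_density (h : R -> R) (v0 v1 : R) :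
  measurable_fun [set: R] h -> (forall x, 0 <= h x) ->
  (\int[mu]_(x in `]0%R, b[) (mix_density 0 b x * h x)%:E = v0%:E)%E ->
  (\int[mu]_(x in `]0%R, b[) (mix_density rho b x * h x)%:E = v1%:E)%E ->
  (\int[mu]_x (p x * h x)%:E = ((2 * pi)^-1 * v0 - k * rho / (2 * pi) * v1)%:E)%E.
Proof.
move=> mh h0 e0 e1.
have md r : measurable_fun `]0, b[ (fun x => mix_density r b x * h x).
  by apply: measurable_funTS; apply: measurable_funM => //; exact: measurable_mix_density.
have d0 r : 0 <= r -> forall x, `]0, b[%classic x -> 0 <= mix_density r b x * h x.
  move=> r0 x; rewrite /= in_itv/= => /andP[x0 _].
  by rewrite mulr_ge0// mix_density_ge0// ltW.
have i0 : mu.-integrable `]0, b[ (EFin \o (fun x => mix_density 0 b x * h x)).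
  exact: (ge0_integrable _ (md 0) (d0 0 (lexx 0)) e0).
have i1 : mu.-integrable `]0, b[ (EFin \o (fun x => mix_density rho b x * h x)).
  exact: (ge0_integrable _ (md rho) (d0 rho (ltW rho0)) e1).
transitivity (\int[mu]_(x in `]0%R, b[) ((2 * pi)^-1%:E * (mix_density 0 b x * h x)%:E
    - (k * rho / (2 * pi))%:E * (mix_density rho b x * h x)%:E))%E.
  rewrite [RHS]integral_mkcond; apply: eq_integral => x _; rewrite patchE mem_setE.
  rewrite in_itv/=; case: ifPn => xb; last by rewrite opt_density_eq0// mul0r.
  by rewrite opt_densityE//; congr EFin; ring.
rewrite integralB; [|by []|apply: integrableZl => //; exact: i0|apply: integrableZl => //; exact: i1].
rewrite integralZl; [|by []|exact: i0].
rewrite integralZl; [|by []|exact: i1].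
by rewrite e0 e1.
Qed.

Let mweight_id : measurable_fun [set: R] (fun a : R => a / 2).
Proof. by measurable_rules. Qed.

(** The two mixtures give the mass [b / 4 - k * (1 - s^-1) / 2], so the equation [kE] is the
    normalisation. *)
Lemma integral_opt_density1 : (\int[mu]_x (p x)%:E = 1)%E.
Proof.
have pp := @pi_gt0 R.
have h r v : 0 <= r -> (\int[mu]_(a in `]0%R, b[) (mix_weight r a)%:E = v%:E)%E ->
    (\int[mu]_(x in `]0%R, b[) (mix_density r b x * cst 1 x)%:E = (pi / 2 * v)%:E)%E.
  move=> r0 hv; apply: (@integral_mix_density_value _ _ _ _ (cst 1)) => //.
    by move=> a _; rewrite integral_Q1_cst.
  by rewrite -hv; apply: eq_integral => a _; rewrite mulr1.
have h0 : (\int[mu]_(a in `]0%R, b[) (mix_weight 0 a)%:E = b%:E)%E.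
  rewrite (_ : (\int[mu]_(_ in _) _ = \int[mu]_(a in `]0%R, b[) (cst 1 a))%E); last first.
    by apply: eq_integral => a _; rewrite mix_weight0.
  by rewrite integral_cst// mul1e; have := @lebesgue_measure_itv R `]0, b[;
    rewrite /= lte_fin b0 oppr0 adde0.
have := @integral_opt_density (cst 1) _ _ _ _ (h _ _ (lexx 0) h0)
  (h _ _ (ltW rho0) (integral_mix_weight rho0 b0)).
rewrite (_ : (\int[mu]_x (p x * cst 1 x)%:E = \int[mu]_x (p x)%:E)%E); last first.
  by apply: eq_integral => x _; rewrite mulr1.
move=> ->//; congr EFin.
transitivity (b / 4 - (k * (1 - s^-1)) / 2); last by rewrite kE'; field.
by move: (pi : R) pp => P P0; field; rewrite s_neq0 !gt_eqF.
Qed.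

Definition opt_moment : R := b * b / 16 - k / (4 * rho) * (s + s^-1 - 2).

Lemma integral_opt_density_norm : (\int[mu]_x (p x * `|x|)%:E = opt_moment%:E)%E.
Proof.
have pp := @pi_gt0 R.
have h r v : 0 <= r -> (\int[mu]_(a in `]0%R, b[) (mix_weight r a * a)%:E = v%:E)%E ->
    (\int[mu]_(x in `]0%R, b[) (mix_density r b x * `|x|)%:E = (pi / 2 * (2^-1 * v))%:E)%E.
  move=> r0 hv; apply: (@integral_mix_density_value _ _ _ _ (fun a => a / 2)) => //.
    by move=> a /andP[/ltW a0 _]; rewrite integral_Q1_id//; congr EFin; field.
  rewrite (_ : (\int[mu]_(_ in _) _ = \int[mu]_(a in `]0%R, b[) (2^-1%:E * (mix_weight r a * a)%:E))%E); last first.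
    by apply: eq_integral => a _; congr EFin; ring.
  rewrite ge0_integralZl//; first by rewrite hv.
  - apply/measurable_EFinP/measurable_funTS; apply: measurable_funM => //.
    exact: measurable_mix_weight.
  - by move=> a; rewrite /= in_itv/= => /andP[/ltW a0 _]; rewrite lee_fin mulr_ge0 ?mix_weight_ge0.
have h0 : (\int[mu]_(a in `]0%R, b[) (mix_weight 0 a * a)%:E = (b * b / 2)%:E)%E.
  rewrite (_ : (\int[mu]_(_ in _) _ = \int[mu]_(a in `]0%R, b[) a%:E)%E); last first.
    by apply: eq_integral => a _; rewrite mix_weight0 mul1r.
  pose F (a : R) := a * a / 2.
  have -> : b * b / 2 = F b - F 0 by rewrite /F; field.
  apply: (@ge0_integral_FTC_oo _ _ F _ _ _ _ b0).
  - move=> a _; apply: has_derivative_eq; first by rewrite /F; derive_rules.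
    by rewrite /=; field.
  - by move=> a _; cvg_rules.
  - by move=> a /andP[/ltW].
  - by apply: cvg_at_right_filter; rewrite /F; cvg_rules.
  - by apply: cvg_at_left_filter; rewrite /F; cvg_rules.
rewrite (@integral_opt_density _ _ _ _ _ (h _ _ (lexx 0) h0)
  (h _ _ (ltW rho0) (integral_mix_weight_id rho0 b0))); [|by measurable_rules|by []].
congr EFin; rewrite /opt_moment.
by move: (pi : R) pp => P P0; field; rewrite s_neq0 !gt_eqF.
Qed.

Definition opt_log_moment : R := log_mean rho b - (s - 1) ^+ 2 / (4 * rho)
  + k * (log_mean rho b - ln s).

Lemma integral_opt_density_ln :
  (\int[mu]_x (p x * ln (1 + rho * `|x|))%:E = opt_log_moment%:E)%E.
Proof.
have pp := @pi_gt0 R.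
have h1 x : 1 <= 1 + rho * `|x| by rewrite lerDl mulr_ge0// ltW.
have mh : measurable_fun [set: R] (fun x => ln (1 + rho * `|x|)) by measurable_rules.
have h r v : 0 <= r -> (\int[mu]_(a in `]0%R, b[) (mix_weight r a * log_mean rho a)%:E = v%:E)%E ->
    (\int[mu]_(x in `]0%R, b[) (mix_density r b x * ln (1 + rho * `|x|))%:E = (pi / 2 * v)%:E)%E.
  move=> r0 hv; apply: (@integral_mix_density_value _ _ _ _ (log_mean rho)) => //.
  - by move=> x; exact: ln_ge0.
  - by rewrite /log_mean; measurable_rules.
  - by move=> a /andP[a0 _]; rewrite integral_Q1_ln.
have h0 : (\int[mu]_(a in `]0%R, b[) (mix_weight 0 a * log_mean rho a)%:E =
    (b * log_mean rho b - (s - 1) ^+ 2 / rho)%:E)%E.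
  rewrite -(integral_log_mean rho0 b0).
  by apply: eq_integral => a _; rewrite mix_weight0 mul1r.
rewrite (@integral_opt_density _ _ _ _ _ (h _ _ (lexx 0) h0)
  (h _ _ (ltW rho0) (integral_mix_weight_log_mean rho0 b0))); [|by []|by move=> x; exact: ln_ge0].
congr EFin; rewrite /opt_log_moment weight_primitiveE// ?(ltW b0)//.
transitivity ((b / 4 - (k * (1 - s^-1)) / 2) * log_mean rho b - (s - 1) ^+ 2 / (4 * rho)
  + k * (log_mean rho b - ln s)); last by rewrite kE'; field; rewrite gt_eqF.
by move: (pi : R) pp => P P0; field; rewrite s_neq0 !gt_eqF.
Qed.

(** The Euler-Lagrange constant: on [[0, b]] the integral of [p y * ln |x - y|] over [y] is [x / 2 -
    k / 2 * ln (1 + rho * x) + opt_level]. *)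
Definition opt_level : R := ln (b / 4) - b / 4 + k * ln ((1 + s) / 2).

Let weight0_mass : (\int[mu]_(a in `]0%R, b[) (mix_weight 0 a)%:E = b%:E)%E.
Proof.
rewrite (_ : (\int[mu]_(_ in _) _ = \int[mu]_(a in `]0%R, b[) (cst 1 a))%E); last first.
  by apply: eq_integral => a _; rewrite mix_weight0.
by rewrite integral_cst// mul1e; have := @lebesgue_measure_itv R `]0, b[;
  rewrite /= lte_fin b0 oppr0 adde0.
Qed.

Let potential_value x (G0 G1 : R) : 0 <= x ->
  (\int[mu]_(a in `]0%R, b[) (mix_weight 0 a * green (x / a))%:E = G0%:E)%E ->
  (\int[mu]_(a in `]0%R, b[) (mix_weight rho a * green (x / a))%:E = G1%:E)%E ->
  (\int[mu]_y (p y * log_kernel x y)%:E =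
    (x + opt_moment - opt_level - (G0 / 4 - k * rho / 4 * G1))%:E)%E.
Proof.
move=> x0 g0 g1; have pp := @pi_gt0 R.
have t0 : (\int[mu]_(a in `]0%R, b[) (mix_weight 0 a * log_defect a)%:E =
    (b * b / 4 - b * ln (b / 4) + b)%:E)%E.
  rewrite -(integral_log_defect b0).
  by apply: eq_integral => a _; rewrite mix_weight0 mul1r.
rewrite (integral_opt_density _ _
  (integral_mix_density_log_kernel (lexx 0) b0 x0 weight0_mass t0 g0)
  (integral_mix_density_log_kernel (ltW rho0) b0 x0 (integral_mix_weight rho0 b0)
    (integral_mix_weight_log_defect rho0 b0) g1)); last 2 first.
- exact: measurable_log_kernel.
- by move=> y; exact: log_kernel_ge0.
congr EFin; rewrite weight_primitiveE// ?(ltW b0)// /opt_moment /opt_level /log_mean.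
move: (ln (b / 4)) (ln ((1 + s) / 2)) => l1 l2.
transitivity ((b / 4 - (k * (1 - s^-1)) / 2) * (x - l1) + b / 4 + b * b / 16
   - k * l2 - k / (4 * rho) * (s + s^-1 - 2) - (G0 / 4 - k * rho / 4 * G1)).
  by move: (pi : R) pp => P P0; field; rewrite s_neq0 !gt_eqF.
by rewrite kE'; field; rewrite s_neq0 gt_eqF.
Qed.

(** The mixing weight [1 - k * rho * mix_weight rho a] can be negative near [a = 0] when
    [k * rho > 1]. The inequality for the potential to the right of [b] only involves the scales
    from [b] on. *)
Let weight_le1 a : b <= a -> k * rho * mix_weight rho a <= 1.
Proof.
move=> ba; have a0 : 0 <= a by apply: le_trans ba; exact: ltW.
have ra := rx_ge0 a0.
have sa : s <= Num.sqrt (1 + rho * a) by apply: ler_wsqrtr; rewrite lerD2l ler_pM2l.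
have sa0 := lt_le_trans s_gt0 sa.
rewrite /mix_weight ler_pdivrMr ?mul1r; last by rewrite mulr_gt0// ltr_pwDl.
by apply: le_trans krs _; apply: le_trans sa _; rewrite ler_peMl ?(ltW sa0)// lerDl.
Qed.

Lemma opt_potential x : 0 <= x -> exists U : R,
  [/\ (\int[mu]_y (p y * log_kernel x y)%:E = U%:E)%E,
   x / 2 + k / 2 * ln (1 + rho * x) + opt_moment - opt_level <= U &
   x <= b -> U = x / 2 + k / 2 * ln (1 + rho * x) + opt_moment - opt_level].
Proof.
rewrite le_eqVlt => /predU1P[<-|x0].
  have gr0 r : (\int[mu]_(a in `]0%R, b[) (mix_weight r a * green (0 / a))%:E = 0%:E)%E.
    by apply: integral0_eq => a _; rewrite mul0r green_le1 ?mulr0.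
  exists (0 + opt_moment - opt_level - (0 / 4 - k * rho / 4 * 0)); split.
  - exact: (potential_value (lexx 0) (gr0 0) (gr0 rho)).
  - by rewrite [rho * 0]mulr0 addr0 ln1; lra.
  - by move=> _; rewrite [rho * 0]mulr0 addr0 ln1; ring.
have mw r := @measurable_mix_weight R r.
have w0 r := @mix_weight_ge0 R r.
have V0 : (\int[mu]_(a in `]0%R, x[) (mix_weight 0 a * green_kernel x a)%:E = (2 * x)%:E)%E.
  rewrite -(integral_green_kernel x0).
  by apply: eq_integral => a _; rewrite mix_weight0 mul1r.
have V1 := integral_mix_weight_green_kernel rho0 x0.
have [xb|bx] := leP x b.
  have := potential_value (ltW x0) (integral_green_le (mw 0) x0 V0 xb)
    (integral_green_le (mw rho) x0 V1 xb).
  set U := (X in (X%:E)%E) => hU.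
  have UE : U = x / 2 + k / 2 * ln (1 + rho * x) + opt_moment - opt_level.
    by rewrite /U; field; rewrite gt_eqF.
  by exists U; split => //; rewrite UE.
(* Two nonnegative pieces with a finite sum are finite, and can be subtracted. *)
have split_fin (r v : R) :
    (\int[mu]_(a in `]0%R, b[) (mix_weight r a * green (x / a))%:E +
     \int[mu]_(a in `[b, x[) (mix_weight r a * green (x / a))%:E = v%:E)%E ->
    exists G H : R, [/\
     (\int[mu]_(a in `]0%R, b[) (mix_weight r a * green (x / a))%:E = G%:E)%E,
     (\int[mu]_(a in `[b, x[) (mix_weight r a * green (x / a))%:E = H%:E)%E,
     0 <= H & G + H = v].
  set I := (\int[mu]_(_ in _) _)%E; set J := (\int[mu]_(_ in _) _)%E => IJ.
  have I0 : (0 <= I)%E by apply: integral_ge0 => a _; rewrite lee_fin mulr_ge0// green_ge0.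
  have J0 : (0 <= J)%E by apply: integral_ge0 => a _; rewrite lee_fin mulr_ge0// green_ge0.
  clearbody I J; case: I J I0 J0 IJ => [G||] [H||]//= G0 H0.
  by move=> -[] e; exists G, H; split.
have [G0 [H0 [g0 h0 H0p e0]]] := split_fin _ _ (integral_green_gt (mw 0) b0 V0 bx).
have [G1 [H1 [g1 h1 H1p e1]]] := split_fin _ _ (integral_green_gt (mw rho) b0 V1 bx).
exists (x + opt_moment - opt_level - (G0 / 4 - k * rho / 4 * G1)); split.
- exact: potential_value (ltW x0) g0 g1.
(* [H0] and [H1] come from the missing scales [b <= a < x]; [U] exceeds the Euler-Lagrange value by
   [(H0 - k * rho * H1) / 4]. *)
- have H10 : k * rho * H1 <= H0.
    have [k0|k0] := leP k 0.
      by apply: le_trans H0p; rewrite -mulrA mulr_le0_ge0// mulr_ge0// ltW.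
    have kr : 0 <= k * rho by rewrite mulr_ge0// ltW.
    have mg : measurable_fun `[b, x[ (fun a => green (x / a)).
      apply: measurable_funTS; apply: (measurableT_comp measurable_green).
      by measurable_rules.
    have mwg r : measurable_fun `[b, x[ (fun a => mix_weight r a * green (x / a)).
      by apply: measurable_funM => //; exact: measurable_funTS.
    rewrite -lee_fin EFinM -h1 -h0 -ge0_integralZl; [|by []|apply/measurable_EFinP; exact: mwg
      |by move=> a _; rewrite lee_fin mulr_ge0// green_ge0|by rewrite lee_fin].
    apply: ge0_le_integral => //.
    + by move=> a _; rewrite lee_fin mulr_ge0// mulr_ge0// green_ge0.
    + by apply/measurable_EFinP; apply: measurable_funM => //; exact: mwg.
    + by apply/measurable_EFinP; exact: mwg.
    move=> a; rewrite /= in_itv/= => /andP[ba _].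
    rewrite lee_fin mix_weight0 mulrA ler_wpM2r ?green_ge0//; exact: weight_le1.
  have -> : G0 = 2 * x - H0 by lra.
  have -> : G1 = 2 / rho * ln (1 + rho * x) - H1 by lra.
  have -> : k * rho / 4 * (2 / rho * ln (1 + rho * x) - H1) =
    k / 2 * ln (1 + rho * x) - k * rho * H1 / 4 by field; rewrite gt_eqF.
  lra.
- by [].
Qed.

End optimal_density.

(** * Positive definiteness of the logarithmic energy *)

Section feature_map.
Context {R : realType} d (W : measurableType d).
Variable nu : {sigma_finite_measure set W -> \bar R}.
Local Notation mu := (@lebesgue_measure R).
Variable phi : R * W -> R.
Hypotheses (mphi : measurable_fun [set: R * W] phi) (phi0 : forall z, 0 <= phi z).

Definition feature (f : R -> R) (w : W) : \bar R := (\int[mu]_x (f x * phi (x, w))%:E)%E.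

Let mphi1 w : measurable_fun [set: R] (fun x => phi (x, w)).
Proof. exact: (measurableT_comp mphi). Qed.

Let mphi2 x : measurable_fun [set: W] (fun w => phi (x, w)).
Proof. exact: (measurableT_comp mphi). Qed.

Lemma feature_ge0 (f : R -> R) w : (forall x, 0 <= f x) -> (0 <= feature f w)%E.
Proof. by move=> f0; apply: integral_ge0 => x _; rewrite lee_fin mulr_ge0. Qed.

Let mfphi (f : R -> R) : measurable_fun [set: R] f ->
  measurable_fun [set: R * W] (fun z : R * W => (f z.1 * phi z)%:E).
Proof.
move=> mf; apply/measurable_EFinP; apply: measurable_funM => //.
by apply: (measurableT_comp mf); exact: measurable_fst.
Qed.

Lemma measurable_feature (f : R -> R) : measurable_fun [set: R] f -> (forall x, 0 <= f x) ->
  measurable_fun [set: W] (feature f).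
Proof.
move=> mf f0.
have F0 (z : R * W) : (0 <= (f z.1 * phi z)%:E)%E by rewrite lee_fin mulr_ge0.
exact: (@measurable_fun_fubini_tonelli_G _ _ _ _ R mu _ (mfphi mf) F0).
Qed.

(** Tonelli, used once for [y] and once for [x], turns the bilinear form of a Gram kernel into an
    inner product of features. All terms are nonnegative, so the identity holds in the extended
    reals. *)
Lemma integral_feature (f g : R -> R) :
  measurable_fun [set: R] f -> (forall x, 0 <= f x) ->
  measurable_fun [set: R] g -> (forall x, 0 <= g x) ->
  (\int[mu]_x \int[mu]_y ((f x * g y)%:E * \int[nu]_w (phi (x, w) * phi (y, w))%:E) =
   \int[nu]_w (feature f w * feature g w))%E.
Proof.
move=> mf f0 mg g0.
have mG := measurable_feature mg g0.
transitivity (\int[mu]_x \int[nu]_w ((f x * phi (x, w))%:E * feature g w))%E.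
  apply: eq_integral => x _.
  pose F (z : R * W) := (f x * phi (x, z.2) * (g z.1 * phi z))%:E.
  have mF : measurable_fun [set: R * W] F.
    apply/measurable_EFinP; apply: measurable_funM.
      apply: measurable_funM => //.
      by apply: (measurableT_comp (mphi2 x)); exact: measurable_snd.
    by have /measurable_EFinP := mfphi mg.
  have F0 z : (0 <= F z)%E by rewrite lee_fin !mulr_ge0.
  transitivity (\int[mu]_y \int[nu]_w F (y, w))%E.
    apply: eq_integral => y _; rewrite -ge0_integralZl.
    - by apply: eq_integral => w _; rewrite -EFinM /F/=; congr EFin; ring.
    - by [].
    - by apply/measurable_EFinP; apply: measurable_funM => //; exact: mphi1.
    - by move=> w _; rewrite lee_fin mulr_ge0.
    - by rewrite lee_fin mulr_ge0.
  rewrite fubini_tonelli//; apply: eq_integral => w _; rewrite -ge0_integralZl//.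
  - by apply/measurable_EFinP; apply: measurable_funM => //; exact: mphi1.
  - by move=> y _; rewrite lee_fin mulr_ge0.
  - by rewrite lee_fin mulr_ge0.
pose F (z : R * W) := ((f z.1 * phi z)%:E * feature g z.2)%E.
have mF : measurable_fun [set: R * W] F.
  apply: emeasurable_funM; first exact: mfphi.
  by apply: (measurableT_comp mG); exact: measurable_snd.
have F0 z : (0 <= F z)%E by rewrite mule_ge0 ?lee_fin ?mulr_ge0// feature_ge0.
transitivity (\int[mu]_x \int[nu]_w F (x, w))%E; first by [].
rewrite fubini_tonelli//; apply: eq_integral => w _.
rewrite /F/= ge0_integralZr//.
- by apply/measurable_EFinP; apply: measurable_funM => //; exact: mphi1.
- by move=> x _; rewrite lee_fin mulr_ge0.
- exact: feature_ge0.
Qed.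

End feature_map.

(** * Sliding windows and their Gram kernel *)

Section window_kernel.
Context {R : realType}.
Local Notation mu := (@lebesgue_measure R).
Local Notation mu2 := ((@lebesgue_measure R) \x (@lebesgue_measure R))%E.
Implicit Types (T t u x y z : R).

(** The argument is [(x, (t, z))]: a point, a window length and a left end. The corresponding
    feature of [f] is its mean over []z, z + t]]. *)
Definition window T (v : R * (R * R)) : R :=
  if [&& 0 < v.2.1, v.2.1 <= T, v.2.2 < v.1 & v.1 <= v.2.2 + v.2.1]
  then (v.2.1)^-1 else 0.

Lemma window_ge0 T v : 0 <= window T v.
Proof. by rewrite /window; case: ifPn => // /andP[t0 _]; rewrite invr_ge0 ltW. Qed.

Lemma measurable_window T : measurable_fun [set: R * (R * R)] (window T).
Proof.
have m21 : measurable_fun [set: R * (R * R)] (fun v => v.2.1).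
  by apply: (measurableT_comp measurable_fst); exact: measurable_snd.
have m22 : measurable_fun [set: R * (R * R)] (fun v => v.2.2).
  by apply: (measurableT_comp measurable_snd); exact: measurable_snd.
rewrite /window; apply: measurable_fun_ifT; last by [].
  by measurable_rules.
by measurable_rules.
Qed.

(** The value at [u = 0] is a convention: the Gram integral diverges there, but the diagonal is a
    null set. *)
Definition window_kernel T u : R :=
  if (0 < u) && (u <= T) then ln T - ln u + u / T - 1 else 0.

(** For a fixed length [t], the left ends of the windows containing both points form an interval of
    length [t - u], empty if [t <= u]; it remains to integrate [(t - u) / t ^ 2] over
    [u < t <= T]. *)
Lemma integral_window T x y : 0 < T -> x != y ->
  (\int[mu2]_w (window T (x, w) * window T (y, w))%:E = (window_kernel T `|x - y|)%:E)%E.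
Proof.
move=> T0; wlog xy : x y / x < y => [hw ne|_].
  have [xy|yx|e] := ltgtP x y; [exact: hw| |by rewrite e eqxx in ne].
  rewrite distrC -hw ?(lt_eqF yx)//; apply: eq_integral => w _.
  by rewrite mulrC.
rewrite distrC gtr0_norm ?subr_gt0//; set u := y - x.
have u0 : 0 < u by rewrite subr_gt0.
have mw := @measurable_window T.
have mF : measurable_fun [set: R * R] (fun w => (window T (x, w) * window T (y, w))%:E).
  by apply/measurable_EFinP; apply: measurable_funM; apply: (measurableT_comp mw).
rewrite fubini_tonelli1//; last by move=> w; rewrite lee_fin mulr_ge0 ?window_ge0.
have inner t : (\int[mu]_z (window T (x, (t, z)) * window T (y, (t, z)))%:E =
    ((fun t => (t^-1 - u * (t * t)^-1)%:E) \_ `]u, T]) t)%E.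
  rewrite patchE mem_setE in_itv/=; case: ifPn => [/andP[ut tT]|].
    have t0 : 0 < t by lra.
    transitivity (\int[mu]_(z in `[(y - t)%R, x[) (t^-1 * t^-1)%:E)%E.
      rewrite [RHS]integral_mkcond; apply: eq_integral => z _.
      rewrite patchE mem_setE in_itv/= /window/= t0 tT/=.
      have [zx|xz] := ltP z x; last by rewrite andbF mul0r.
      have [yz|zy] := leP (y - t) z => /=.
        have h1 : x <= z + t by lra.
        have h2 : z < y by lra.
        have h3 : y <= z + t by lra.
        by rewrite h1 h2 h3.
      have h3 : (y <= z + t) = false by apply/negbTE; rewrite -ltNge; lra.
      by rewrite h3 andbF mulr0.
    rewrite integral_cst//; have /= -> := @lebesgue_measure_itv R `[y - t, x[.
    rewrite lte_fin ifT; last by rewrite /u in ut; lra.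
    by rewrite -EFinD -EFinM; congr EFin; rewrite /u; field; rewrite gt_eqF.
  move=> h; apply: integral0_eq => z _; rewrite /window/=.
  case: ifPn => [/and4P[h1 h2 h3 h4]|]; last by rewrite mul0r.
  case: ifPn => [/and4P[g1 g2 g3 g4]|]; last by rewrite mulr0.
  by exfalso; move: h; rewrite h2 andbT -leNgt /u; lra.
transitivity (\int[mu]_(t in `]u, T]) (t^-1 - u * (t * t)^-1)%:E)%E.
  by rewrite [RHS]integral_mkcond; apply: eq_integral => t _; exact: inner.
rewrite /window_kernel u0/=.
have [uT|Tu] := leP u T; last by rewrite set_itv_ge ?integral_set0// bnd_simp -leNgt ltW.
move: uT; rewrite le_eqVlt => /predU1P[->|uT].
  by rewrite set_itvoc0 integral_set0 divff ?gt_eqF// subrr add0r subrr.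
pose F t := ln t + u * t^-1.
have -> : ln T - ln u + u / T - 1 = F T - F u by rewrite /F divff ?gt_eqF//; ring.
have mf : measurable_fun [set: R] (fun t : R => (t^-1 - u * (t * t)^-1)%:E).
  by apply/measurable_EFinP; measurable_rules.
rewrite -[LHS]integral_itv_bndo_bndc; last exact: measurable_funTS.
apply: (@ge0_integral_FTC_oo _ _ F _ _ _ _ uT).
- move=> t /andP[ut _]; have t0 : 0 < t by lra.
  apply: has_derivative_eq; first by rewrite /F; derive_rules; rewrite ?gt_eqF.
  by rewrite /=; field; rewrite gt_eqF.
- move=> t /andP[ut _]; have t0 : 0 < t by lra.
  by cvg_rules; rewrite ?gt_eqF// mulr_gt0.
- move=> t /andP[ut _]; have t0 : 0 < t by lra.
  have -> : t^-1 - u * (t * t)^-1 = (t - u) / (t * t) by field; rewrite gt_eqF.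
  by rewrite divr_ge0 ?mulr_ge0// ?ltW// subr_gt0.
- by apply: cvg_at_right_filter; rewrite /F; cvg_rules; rewrite ?gt_eqF.
- by apply: cvg_at_left_filter; rewrite /F; cvg_rules; rewrite ?gt_eqF.
Qed.

End window_kernel.

Lemma ae_imply (R : realType) (P Q : R -> Prop) :
  {ae @lebesgue_measure R, forall x, P x} -> (forall x, P x -> Q x) ->
  {ae @lebesgue_measure R, forall x, Q x}.
Proof.
move=> aP PQ; apply: negligibleS aP => x /= nQ Px.
by apply: nQ; exact: PQ.
Qed.

(* The [sigma_finite_measure] instance of a product of sigma-finite measures
   is shadowed by the one for products of subprobabilities. *)
Definition plane_measure (R : realType) := (@lebesgue_measure R \x @lebesgue_measure R)%E.

HB.instance Definition _ (R : realType) := Measure.on (@plane_measure R).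

Lemma plane_measure_sigma_finite (R : realType) : sigma_finite setT (@plane_measure R).
Proof.
have /sigma_finiteP[F [TF ndF Foo]] := sigma_finiteT (@lebesgue_measure R).
exists (fun n => F n `*` F n).
  rewrite -setXTT TF predeqE => -[x y]; split.
    move=> [/= [n _ Fnx] [k _ Fky]]; exists (maxn n k) => //; split.
    - by move: x Fnx; exact/subsetPset/ndF/leq_maxl.
    - by move: y Fky; exact/subsetPset/ndF/leq_maxr.
  by move=> [n _ []/= ? ?]; split; exists n.
move=> k; have [? ?] := Foo k.
split; first exact: measurableX.
by rewrite /plane_measure product_measure1E// lte_mul_pinfty// ge0_fin_numE.
Qed.

HB.instance Definition _ (R : realType) :=
  Measure_isSigmaFinite.Build _ _ _ (@plane_measure R) (plane_measure_sigma_finite R).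

(** * Mutual energies and truncation at window length [T] *)

Section log_energy.
Context {R : realType}.
Local Notation mu := (@lebesgue_measure R).
Local Notation mu2 := ((@lebesgue_measure R) \x (@lebesgue_measure R))%E.
Implicit Types (f g : R -> R) (T x y : R).

Definition nice_density f (m : R) : Prop :=
  [/\ measurable_fun [set: R] f, (forall x, 0 <= f x),
      (\int[mu]_x (f x)%:E = 1)%E & (\int[mu]_x (f x * `|x|)%:E = m%:E)%E].

Definition mutual_energy f g : \bar R :=
  (\int[mu]_x \int[mu]_y (f x * g y * log_kernel x y)%:E)%E.

Section pair_integral.
Variables (f g : R -> R) (mf mg : R).
Hypotheses (nf : nice_density f mf) (ng : nice_density g mg).

Let f0 x : 0 <= f x. Proof. by case: nf. Qed.
Let g0 x : 0 <= g x. Proof. by case: ng. Qed.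
Let mfm : measurable_fun [set: R] f. Proof. by case: nf. Qed.
Let mgm : measurable_fun [set: R] g. Proof. by case: ng. Qed.

Let I (F : R * R -> R) : \bar R := (\int[mu2]_z (f z.1 * g z.2 * F z)%:E)%E.

Let mfg : measurable_fun [set: R * R] (fun z : R * R => f z.1 * g z.2).
Proof.
apply: measurable_funM.
  by apply: (measurableT_comp mfm); exact: measurable_fst.
by apply: (measurableT_comp mgm); exact: measurable_snd.
Qed.

Let mI (F : R * R -> R) : measurable_fun [set: R * R] F ->
  measurable_fun [set: R * R] (fun z : R * R => (f z.1 * g z.2 * F z)%:E).
Proof. by move=> mF; apply/measurable_EFinP; exact: measurable_funM. Qed.

Let I_ge0 (F : R * R -> R) : (forall z, 0 <= F z) -> forall z : R * R, (0 <= (f z.1 * g z.2 * F z)%:E)%E.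
Proof. by move=> F0 z; rewrite lee_fin !mulr_ge0. Qed.

Let ID (F G : R * R -> R) : measurable_fun [set: R * R] F -> (forall z, 0 <= F z) ->
  measurable_fun [set: R * R] G -> (forall z, 0 <= G z) ->
  I (fun z => F z + G z) = (I F + I G)%E.
Proof.
move=> mF F0 mG G0; rewrite /I.
under eq_integral do rewrite mulrDr EFinD.
by rewrite ge0_integralD//; [move=> z _; exact: I_ge0|exact: mI|move=> z _; exact: I_ge0|exact: mI].
Qed.

Let IE (F : R * R -> R) : measurable_fun [set: R * R] F -> (forall z, 0 <= F z) ->
  (I F = \int[mu]_x \int[mu]_y (f x * g y * F (x, y))%:E)%E.
Proof.
by move=> mF F0; rewrite /I fubini_tonelli1//; [exact: mI|exact: I_ge0].
Qed.

Let Icst (c : R) : 0 <= c -> I (cst c) = c%:E.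
Proof.
move=> c0; rewrite IE//.
have [_ _ f1 _] := nf; have [_ _ g1 _] := ng.
transitivity (\int[mu]_x (c%:E * (f x)%:E))%E; last first.
  rewrite ge0_integralZl//; first by rewrite f1 mule1.
  - exact/measurable_EFinP.
  - by move=> x _; rewrite lee_fin.
apply: eq_integral => x _.
transitivity (\int[mu]_y ((f x * c)%:E * (g y)%:E))%E.
  by apply: eq_integral => y _; rewrite -EFinM; congr EFin => /=; ring.
rewrite ge0_integralZl//; first by rewrite g1 mule1 -EFinM mulrC.
- exact/measurable_EFinP.
- by move=> y _; rewrite lee_fin.
- by rewrite lee_fin mulr_ge0.
Qed.

Let I1 : I (fun z => `|z.1|) = mf%:E.
Proof.
rewrite IE//; last by measurable_rules.
have [_ _ _ f1] := nf; have [_ _ g1 _] := ng.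
rewrite -f1; apply: eq_integral => x _.
transitivity (\int[mu]_y ((f x * `|x|)%:E * (g y)%:E))%E.
  by apply: eq_integral => y _; rewrite -EFinM; congr EFin => /=; ring.
rewrite ge0_integralZl//; first by rewrite g1 mule1.
- exact/measurable_EFinP.
- by move=> y _; rewrite lee_fin.
- by rewrite lee_fin mulr_ge0.
Qed.

Let I2 : I (fun z => `|z.2|) = mg%:E.
Proof.
rewrite IE//; last by measurable_rules.
have [_ _ f1 _] := nf; have [_ _ _ g1] := ng.
transitivity (\int[mu]_x (mg%:E * (f x)%:E))%E; last first.
  have mg0 : 0 <= mg.
    by rewrite -lee_fin -g1; apply: integral_ge0 => x _; rewrite lee_fin mulr_ge0.
  rewrite ge0_integralZl//; first by rewrite f1 mule1.
  - exact/measurable_EFinP.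
  - by move=> x _; rewrite lee_fin.
apply: eq_integral => x _.
transitivity (\int[mu]_y ((f x)%:E * (g y * `|y|)%:E))%E.
  by apply: eq_integral => y _; rewrite -EFinM; congr EFin => /=; ring.
rewrite ge0_integralZl//; first by rewrite g1 -EFinM mulrC.
- by apply/measurable_EFinP; measurable_rules.
- by move=> y _; rewrite lee_fin mulr_ge0.
- by rewrite lee_fin.
Qed.

Let ae_neq x : {ae mu, forall y, x != y}.
Proof.
exists [set x]; split => //; first exact: lebesgue_measure_set1.
by move=> y /= /negP; rewrite negbK => /eqP.
Qed.

Let I_offdiag (F G : R * R -> R) : measurable_fun [set: R * R] F -> (forall z, 0 <= F z) ->
  measurable_fun [set: R * R] G -> (forall z, 0 <= G z) ->
  (forall x y, x != y -> F (x, y) = G (x, y)) -> I F = I G.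
Proof.
move=> mF F0 mG G0 FG; rewrite (IE mF F0) (IE mG G0); apply: eq_integral => x _.
have mH (H : R * R -> R) : measurable_fun [set: R * R] H ->
    measurable_fun [set: R] (fun y => (f x * g y * H (x, y))%:E).
  move=> mH; apply/measurable_EFinP; apply: measurable_funM; first by measurable_rules.
  exact: (measurableT_comp mH).
apply: ge0_ae_eq_integral => //; [exact: mH|exact: mH|..].
- by move=> y _; rewrite lee_fin !mulr_ge0.
- by move=> y _; rewrite lee_fin !mulr_ge0.
apply: (ae_imply (ae_neq x)) => y xy _.
by rewrite FG.
Qed.

Let mkernel T : measurable_fun [set: R * R] (fun z : R * R => (window_kernel T `|z.1 - z.2|)%R).
Proof. by rewrite /window_kernel; measurable_rules. Qed.

Let kernel_ge0 T : 0 < T -> forall z : R * R, 0 <= window_kernel T `|z.1 - z.2|.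
Proof.
move=> T0 z; rewrite /window_kernel; move: `|_| => u.
case: ifPn => // /andP[u0 uT].
have uT0 : 0 < u / T by rewrite divr_gt0.
have := ln_sublinear uT0; have : -1 < u / T - 1 by lra.
by move=> /le_ln1Dx; rewrite addrC subrK ln_div ?posrE//; lra.
Qed.

(** The truncation error: for [x != y], [log_kernel + ln T + defect = window_kernel + |x| + |y| +
    1]. Being at most [u / T], its integral against two densities with first moments tends to 0 as
    [T] grows. *)
Let defect T u : R := if u <= T then u / T else 1 + ln u - ln T.

Let defect_bounds T u : 0 < T -> 0 <= u -> 0 <= defect T u <= u / T.
Proof.
move=> T0 u0; rewrite /defect; case: ifPn => [_|]; first by rewrite lexx divr_ge0// ltW.
rewrite -ltNge => Tu; have u1 : 0 < u by exact: lt_trans Tu.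
have : ln T <= ln u by rewrite ler_ln ?posrE// ltW.
have uT0 : 0 < u / T by rewrite divr_gt0.
have : -1 < u / T - 1 by lra.
move=> /le_ln1Dx; rewrite addrC subrK ln_div ?posrE// => h1 h2.
by apply/andP; split; lra.
Qed.

Lemma feature_energy T (q : R) : 1 <= T -> mutual_energy f g = q%:E ->
  exists e : R, [/\ 0 <= e, e <= (mf + mg) / T &
   (\int[mu2]_w (feature (window T) f w * feature (window T) g w) =
    (q + ln T + e - mf - mg - 1)%:E)%E].
Proof.
move=> T1 qE; have T0 : 0 < T by lra.
have lT : 0 <= ln T by exact: ln_ge0.
have mN : measurable_fun [set: R * R] (fun z : R * R => log_kernel z.1 z.2).
  by rewrite /log_kernel; measurable_rules.
have N0 (z : R * R) : 0 <= log_kernel z.1 z.2 by exact: log_kernel_ge0.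
have mD : measurable_fun [set: R * R] (fun z : R * R => (defect T `|z.1 - z.2|)%R).
  by rewrite /defect; measurable_rules.
have D0 (z : R * R) : 0 <= defect T `|z.1 - z.2|.
  by have /andP[] := defect_bounds T0 (normr_ge0 (z.1 - z.2)).
have m1 : measurable_fun [set: R * R] (fun z : R * R => `|z.1|) by measurable_rules.
have m2 : measurable_fun [set: R * R] (fun z : R * R => `|z.2|) by measurable_rules.
have IN : I (fun z => log_kernel z.1 z.2) = q%:E by rewrite IE.
have IDle : (I (fun z => (defect T `|z.1 - z.2|)%R) <= ((mf + mg) / T)%:E)%E.
  rewrite mulrC EFinM EFinD -I1 -I2 -ID// -ge0_integralZl//.
  - apply: ge0_le_integral => //.
    + by move=> z _; rewrite lee_fin !mulr_ge0.
    + exact: mI.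
    + by apply: measurable_funeM; apply: mI; exact: measurable_funD.
    move=> z _; rewrite -EFinM lee_fin mulrCA ler_wpM2l ?mulr_ge0//.
    have /andP[_ h] := defect_bounds T0 (normr_ge0 (z.1 - z.2)).
    apply: le_trans h _; rewrite mulrC ler_pM2l ?invr_gt0//; exact: ler_normB.
  - by apply: mI; exact: measurable_funD.
  - by move=> z _; apply: (@I_ge0 (fun z => `|z.1| + `|z.2|)) => {}z; rewrite addr_ge0.
  - by rewrite lee_fin invr_ge0 ltW.
have [e eE] : exists e : R, I (fun z => (defect T `|z.1 - z.2|)%R) = e%:E.
  exists (fine (I (fun z => (defect T `|z.1 - z.2|)%R))); rewrite fineK// ge0_fin_numE.
    by apply: le_lt_trans IDle _; rewrite ltry.
  by apply: integral_ge0 => z _; rewrite lee_fin !mulr_ge0.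
exists e; split.
- by rewrite -lee_fin -eE; apply: integral_ge0 => z _; rewrite lee_fin !mulr_ge0.
- by rewrite -lee_fin -eE.
(* The terms are distributed so that both sides integrate nonnegative functions; [ln T >= 0] is why
   [T >= 1] is assumed. *)
have key : (I (fun z => (window_kernel T `|z.1 - z.2|)%R) + (mf + mg + 1)%:E =
    (q + ln T + e)%:E)%E.
  have -> : (q + ln T + e)%:E =
      I (fun z => (log_kernel z.1 z.2 + cst (ln T) z + defect T `|z.1 - z.2|)%R).
    rewrite ID//; first by rewrite ID// IN Icst// eE.
    - exact: measurable_funD.
    - by move=> z; rewrite addr_ge0.
  have -> : (I (fun z => (window_kernel T `|z.1 - z.2|)%R) + (mf + mg + 1)%:E =
      I (fun z => (window_kernel T `|z.1 - z.2| + (`|z.1| + `|z.2| + cst 1 z))%R))%E.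
    rewrite ID//.
    - by congr (_ + _)%E; rewrite ID//; [rewrite ID// I1 I2 Icst|exact: measurable_funD].
    - exact: kernel_ge0.
    - by apply: measurable_funD => //; exact: measurable_funD.
    - by move=> z; rewrite !addr_ge0.
  apply: I_offdiag.
  - by apply: measurable_funD => //; apply: measurable_funD => //; exact: measurable_funD.
  - by move=> z; rewrite addr_ge0 ?kernel_ge0// !addr_ge0.
  - by apply: measurable_funD => //; exact: measurable_funD.
  - by move=> z; rewrite addr_ge0// addr_ge0.
  move=> x y xy /=; rewrite /window_kernel /defect /log_kernel normr_gt0 subr_eq0 xy/=.
  by case: ifPn => _; ring.
have -> : (\int[mu2]_w (feature (window T) f w * feature (window T) g w) =
    I (fun z => (window_kernel T `|z.1 - z.2|)%R))%E.
  transitivity (\int[mu]_x \int[mu]_y ((f x * g y)%:E *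
      \int[mu2]_w (window T (x, w) * window T (y, w))%:E))%E.
    symmetry; exact: (@integral_feature R _ _ (@plane_measure R) (window T) (measurable_window T)
      (window_ge0 T) f g mfm f0 mgm g0).
  rewrite IE; [|exact: mkernel|exact: kernel_ge0].
  apply: eq_integral => x _; apply: ge0_ae_eq_integral => //.
  - apply: emeasurable_funM.
      by apply/measurable_EFinP; measurable_rules.
    pose F (v : R * (R * R)) := (window T (x, v.2) * window T v)%:E.
    have mF : measurable_fun [set: R * (R * R)] F.
      apply/measurable_EFinP; apply: measurable_funM; last exact: measurable_window.
      apply: (measurableT_comp (@measurable_window _ T)).
      by apply: measurable_fun_pair => //; exact: measurable_snd.
    have F0 v : (0 <= F v)%E by rewrite lee_fin mulr_ge0 ?window_ge0.
    exact: (@measurable_fun_fubini_tonelli_F _ _ _ _ R (@plane_measure R) F mF F0).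
  - apply/measurable_EFinP; apply: measurable_funM; first by measurable_rules.
    by apply: (measurableT_comp (mkernel T)).
  - by move=> y _; rewrite mule_ge0 ?lee_fin ?mulr_ge0//; apply: integral_ge0 => w _;
      rewrite lee_fin mulr_ge0 ?window_ge0.
  - by move=> y _; rewrite lee_fin !mulr_ge0// (kernel_ge0 T0 (x, y)).
  apply: (ae_imply (ae_neq x)) => y xy _.
  by rewrite integral_window.
move: key; case: (I _) => [r||]//=.
by move=> -[] h; congr EFin; lra.
Qed.

End pair_integral.

End log_energy.

Lemma ae_and (R : realType) (P Q : R -> Prop) :
  {ae @lebesgue_measure R, forall x, P x} -> {ae @lebesgue_measure R, forall x, Q x} ->
  {ae @lebesgue_measure R, forall x, P x /\ Q x}.
Proof.
move=> aP aQ; have := negligibleU aP aQ; apply: negligibleS => x /= nPQ.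
by have [Px|] := pselect (P x); [right => Qx; exact: nPQ|left].
Qed.

Section vanishing_increments.
Context {R : realType}.
Local Notation mu := (@lebesgue_measure R).

(** By Lebesgue differentiation [h] is almost everywhere the derivative of [F]. Were [h z] nonzero,
    the difference quotients at [z] would be nonzero for all small [t], hence on a set of positive
    measure. *)
Lemma vanishing_increments (h : R -> R) :
  let F x := (\int[mu]_(t in [set` `]-oo, x]]) (h t))%R in
  mu.-integrable [set: R] (EFin \o h) ->
  {ae mu, forall z, {ae mu, forall t, 0 < t <= 1 -> F (z + t) = F z}} ->
  {ae mu, forall z, h z = 0}.
Proof.
move=> F ih hF.
have mh : measurable_fun [set: R] h by move: (measurable_int _ ih) => /measurable_EFinP.
have dF : {ae mu, forall x, derivable F x 1 /\ derive1 F x = h x}.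
  apply: FTC1Ny => [y|]; first exact: integrableS ih.
  by apply: open_integrable_locally => //; exact: openT.
apply: (ae_imply (ae_and hF dF)) => z [hz [dz Fz]].
apply/eqP/negP => /negP hz0.
have cF : (fun t => t^-1 *: ((F \o shift z) (t *: (1 : R)) - F z)) @ 0^' --> h z.
  by rewrite -Fz derive1E; exact: dz.
have : \forall t \near 0^', t^-1 *: ((F \o shift z) (t *: (1 : R)) - F z) != 0.
  exact: (cvgr_neq0 _ cF hz0).
move=> [d /= d0 hd].
case: hz => N [mN N0 hN].
have dm0 : 0 < Num.min d 1 by rewrite lt_min d0 ltr01.
have sub : `]0, (Num.min d 1)[ `<=` N.
  move=> t; rewrite /= in_itv/= lt_min => /and3P[t0 td t1]; apply: hN => /= H.
  have := hd t; rewrite /ball_/= sub0r normrN (gtr0_norm t0) => /(_ td).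
  rewrite gt_eqF// => /(_ isT).
  have -> : t%:A + z = z + t by rewrite addrC [_%:A]mulr1.
  by rewrite H ?t0 ?ltW// subrr scaler0 eqxx.
have := le_measure mu; move=> /(_ `]0, (Num.min d 1)[%classic N).
rewrite !inE => /(_ (measurable_itv _) mN sub).
have /= -> := @lebesgue_measure_itv R `]0, (Num.min d 1)[.
by rewrite N0 lte_fin dm0 oppr0 adde0 lee_fin leNgt dm0.
Qed.

End vanishing_increments.

(** * Positivity of the neutral energy and its equality case *)

Section log_energy_positivity.
Context {R : realType}.
Local Notation mu := (@lebesgue_measure R).
Local Notation mu2 := ((@lebesgue_measure R) \x (@lebesgue_measure R))%E.
Implicit Types (f g : R -> R) (T x y m : R).

Lemma nice_density_integrable f m : nice_density f m -> mu.-integrable [set: R] (EFin \o f).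
Proof.
case=> mf f0 f1 _; exact: (ge0_integrable measurableT mf (fun x _ => f0 x) f1).
Qed.

Lemma feature_window T f t z : measurable_fun [set: R] f -> (forall x, 0 <= f x) ->
  feature (window T) f (t, z) =
  if (0 < t) && (t <= T) then ((t^-1)%:E * \int[mu]_(x in `]z, (z + t)%R]) (f x)%:E)%E else 0%E.
Proof.
move=> mf f0; case: ifPn => [/andP[t0 tT]|tT]; last first.
  apply: integral0_eq => x _; rewrite /window/=; case: ifPn; last by rewrite mulr0.
  by move=> /and4P[h1 h2 _ _]; rewrite h1 h2 in tT.
rewrite -ge0_integralZl//.
- rewrite [RHS]integral_mkcond; apply: eq_integral => x _.
  rewrite patchE mem_setE in_itv/= /window/= t0 tT/=.
  by case: ifPn => _; rewrite ?mulr0// -EFinM mulrC.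
- by apply/measurable_EFinP; exact: measurable_funTS.
- by move=> x _; rewrite lee_fin.
- by rewrite lee_fin invr_ge0 ltW.
Qed.

Lemma feature_window_Rintegral T f m t z : nice_density f m ->
  feature (window T) f (t, z) =
  (if (0 < t) && (t <= T) then t^-1 * \int[mu]_(x in `]z, (z + t)%R]) f x else 0)%:E.
Proof.
move=> nf; have [mf f0 _ _] := nf.
rewrite feature_window//; case: ifPn => // _; rewrite EFinM fineK//.
apply: integrable_fin_num => //; apply: integrableS (nice_density_integrable nf) => //.
Qed.

Let level T f w := fine (feature (window T) f w).

Let levelE T f m w : nice_density f m -> feature (window T) f w = (level T f w)%:E.
Proof. by case: w => t z nf; rewrite /level (feature_window_Rintegral _ _ _ nf). Qed.

Let measurable_level T f m : nice_density f m -> measurable_fun [set: R * R] (level T f).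
Proof.
case=> mf f0 _ _; apply: measurableT_comp => //.
exact: (measurable_feature (measurable_window T) (window_ge0 T) mf f0).
Qed.

Let level_ge0 T f m w : nice_density f m -> 0 <= level T f w.
Proof.
by case=> mf f0 _ _; apply: fine_ge0; apply: feature_ge0 => //; exact: window_ge0.
Qed.

Variables (f g : R -> R) (mf mg qff qgg qfg : R).
Hypotheses (nf : nice_density f mf) (ng : nice_density g mg).
Hypotheses (ff : mutual_energy f f = qff%:E) (gg : mutual_energy g g = qgg%:E)
  (fg : mutual_energy f g = qfg%:E).

Let gap T : \bar R := (\int[mu2]_w ((level T f w - level T g w) ^+ 2)%:E)%E.

Let mlf T := measurable_level T nf.
Let mlg T := measurable_level T ng.

Let mgap T : measurable_fun [set: R * R] (fun w => ((level T f w - level T g w) ^+ 2)%:E).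
Proof. by apply/measurable_EFinP; apply: measurable_funX; apply: measurable_funB. Qed.

Let m_ge0 f' m : nice_density f' m -> 0 <= m.
Proof.
case=> _ f0 _ mE; rewrite -lee_fin -mE.
by apply: integral_ge0 => x _; rewrite lee_fin mulr_ge0.
Qed.

(** Both functions have mass 1, so [ln T], the moments and the constant cancel in the combination of
    the three energies. For an upper bound on [gap T] it suffices to bound [e1] and [e2] above and
    [e3] below. *)
Let gap_eq T : 1 <= T -> exists e1 e2 e3 : R,
  [/\ 0 <= e3, e1 <= 2 * mf / T, e2 <= 2 * mg / T &
    gap T = (qff + qgg - 2 * qfg + e1 + e2 - 2 * e3)%:E].
Proof.
move=> T1.
have [e1 [_ e1l E1]] := feature_energy nf nf T1 ff.
have [e2 [_ e2l E2]] := feature_energy ng ng T1 gg.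
have [e3 [e30 _ E3]] := feature_energy nf ng T1 fg.
exists e1, e2, e3; split => //.
- by apply: le_trans e1l _; rewrite (_ : mf + mf = 2 * mf)//; ring.
- by apply: le_trans e2l _; rewrite (_ : mg + mg = 2 * mg)//; ring.
have prodE (f1 f2 : R -> R) m1 m2 : nice_density f1 m1 -> nice_density f2 m2 ->
    (\int[mu2]_w (feature (window T) f1 w * feature (window T) f2 w) =
     \int[mu2]_w (level T f1 w * level T f2 w)%:E)%E.
  move=> n1 n2; apply: eq_integral => w _.
  by rewrite (levelE _ _ n1) (levelE _ _ n2).
move: E1 E2 E3; rewrite (prodE _ _ _ _ nf nf) (prodE _ _ _ _ ng ng) (prodE _ _ _ _ nf ng).
move=> E1 E2 E3.
have mM (a c : R * R -> R) : measurable_fun [set: R * R] a -> measurable_fun [set: R * R] c ->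
    measurable_fun [set: R * R] (fun w => (a w * c w)%:E).
  by move=> ma mc; apply/measurable_EFinP; exact: measurable_funM.
(* The expansion of the square is stated without subtraction, as [gap T] is not yet known to be
   finite. *)
have : (gap T + 2%:E * \int[mu2]_w (level T f w * level T g w)%:E =
    \int[mu2]_w (level T f w * level T f w)%:E + \int[mu2]_w (level T g w * level T g w)%:E)%E.
  have L0 w : 0 <= level T f w by exact: level_ge0 nf.
  have G0 w : 0 <= level T g w by exact: level_ge0 ng.
  have sq0 w : (0 <= ((level T f w - level T g w) ^+ 2)%:E)%E by rewrite lee_fin sqr_ge0.
  have M0 (a c : R * R -> R) : (forall w, 0 <= a w) -> (forall w, 0 <= c w) ->
    forall w, [set: R * R] w -> (0 <= (a w * c w)%:E)%E.
    by move=> a0 c0 w _; rewrite lee_fin mulr_ge0.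
  have two0 : (0 <= 2%:E :> \bar R)%E by rewrite lee_fin.
  rewrite -ge0_integralZl; [|by []|exact: mM|exact: M0|by []].
  rewrite -ge0_integralD; [|by []|by move=> w _|exact: mgap|
    by move=> w _; rewrite mule_ge0// M0|by apply: measurable_funeM; exact: mM].
  rewrite -ge0_integralD; [|by []|exact: M0|exact: mM|exact: M0|exact: mM].
  by apply: eq_integral => w _; rewrite -EFinM -!EFinD; congr EFin; ring.
rewrite E1 E2 E3; case: (gap T) => [r||]//= -[] h; congr EFin; lra.
Qed.

(** Raising [T] admits longer windows and leaves the means over the shorter ones unchanged. *)
Let gap_mono T : 1 <= T -> (gap 1 <= gap T)%E.
Proof.
move=> T1; apply: ge0_le_integral => //; [|exact: mgap|exact: mgap|].
  by move=> w _; rewrite lee_fin sqr_ge0.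
case=> t z _; rewrite lee_fin /level.
rewrite !(feature_window_Rintegral _ _ _ nf) !(feature_window_Rintegral _ _ _ ng)/=.
case: ifPn => [/andP[t0 t1]|_]; last by rewrite subrr expr0n/= sqr_ge0.
by rewrite t0 (le_trans t1 T1).
Qed.

(** [gap 1 <= gap T <= D + c / T] for every [T >= 1], where [D] is the neutral energy. Comparing
    with the fixed length 1 leaves a quantity that must vanish when [D = 0]. *)
Let gap1_le : (0 <= gap 1 <= (qff + qgg - 2 * qfg)%:E)%E.
Proof.
have g0 T : (0 <= gap T)%E by apply: integral_ge0 => w _; rewrite lee_fin sqr_ge0.
rewrite g0/=; have [e1 [e2 [e3 [_ _ _]]]] := gap_eq (lexx 1).
set v := (X in X%:E) => gv; rewrite gv lee_fin leNgt; apply/negP => lt.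
have := m_ge0 nf; have := m_ge0 ng => mg0 mf0.
set D := qff + qgg - 2 * qfg in lt.
have vD : 0 < v - D by rewrite subr_gt0.
pose c := 2 * (mf + mg); have c0 : 0 <= c by rewrite /c; lra.
(* Chosen so that [c / T < v - D], which contradicts [v <= D + c / T]. *)
pose T := 1 + c / (v - D).
have T1 : 1 <= T by rewrite /T lerDl divr_ge0// ltW.
have cT : c / T < v - D.
  rewrite ltr_pdivrMr; last by lra.
  by rewrite /T mulrDr mulr1 mulrC divfK ?gt_eqF//; lra.
have [d1 [d2 [d3 [d30 d1l d2l gT]]]] := gap_eq T1.
have := gap_mono T1; rewrite gv gT lee_fin -/D.
have : 2 * mf / T + 2 * mg / T = c / T by rewrite /c; ring.
lra.
Qed.

Lemma log_energy_ge0 : 0 <= qff + qgg - 2 * qfg.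
Proof. by move: gap1_le => /andP[h1 h2]; rewrite -lee_fin (le_trans h1). Qed.

Lemma log_energy_eq0 : qff + qgg - 2 * qfg = 0 -> {ae mu, forall x, f x = g x}.
Proof.
move=> D0; have gap0 : gap 1 = 0%E.
  by apply/eqP; rewrite eq_le andbC; move: gap1_le; rewrite D0.
have inf := nice_density_integrable nf; have ing := nice_density_integrable ng.
suff : {ae mu, forall x, f x - g x = 0}.
  by move=> h; apply: (ae_imply h) => x /eqP; rewrite subr_eq0 => /eqP.
have ih : mu.-integrable [set: R] (EFin \o (fun x => f x - g x)).
  have := integrableB measurableT inf ing; apply: eq_integrable => // x _.
apply: vanishing_increments => //.
have G0 w : (0 <= ((level 1 f w - level 1 g w) ^+ 2)%:E)%E by rewrite lee_fin sqr_ge0.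
have mG := @measurable_fun_fubini_tonelli_G _ _ _ _ R mu _ (mgap 1) G0.
(* The left end [z] is taken as the outer variable: the exceptional lengths [t] may depend on [z],
   as [vanishing_increments] allows. *)
have : (\int[mu]_z `|\int[mu]_t ((level 1 f (t, z) - level 1 g (t, z)) ^+ 2)%:E| = 0)%E.
  rewrite -gap0 /gap (@fubini_tonelli2 _ _ _ _ R mu mu _ (mgap 1) G0).
  by apply: eq_integral => z _; rewrite gee0_abs//; apply: integral_ge0.
have [+ _] := ae_eq_integral_abs mu measurableT mG; move=> /[apply] hz.
apply: (ae_imply hz) => z /(_ Logic.I) /= hz0.
have mz : measurable_fun [set: R] (fun t => ((level 1 f (t, z) - level 1 g (t, z)) ^+ 2)%:E).
  by apply: (measurableT_comp (mgap 1)).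
have : (\int[mu]_t `|((level 1 f (t, z) - level 1 g (t, z)) ^+ 2)%:E| = 0)%E.
  by rewrite -[RHS]hz0; apply: eq_integral => t _; rewrite gee0_abs.
have [+ _] := ae_eq_integral_abs mu measurableT mz; move=> /[apply] ht.
apply: (ae_imply ht) => t /(_ Logic.I) /= [] /eqP.
rewrite sqrf_eq0 subr_eq0 /level => /eqP + /andP[t0 t1].
rewrite !(feature_window_Rintegral _ _ _ nf) !(feature_window_Rintegral _ _ _ ng)/= t0 t1/=.
move=> /(mulfI (lt0r_neq0 _)); rewrite invr_gt0 => /(_ t0) e.
apply/eqP; rewrite -subr_eq0 Rintegral_itvB//; last 2 first.
- exact: integrableS ih.
- by rewrite bnd_simp lerDl ltW.
have i1 : mu.-integrable `]z, (z + t)] (EFin \o f) by exact: integrableS inf.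
have i2 : mu.-integrable `]z, (z + t)] (EFin \o g) by exact: integrableS ing.
by rewrite RintegralB// e subrr.
Qed.

End log_energy_positivity.

(** * Tame densities *)

Section tame_functions.
Context {R : realType}.
Local Notation mu := (@lebesgue_measure R).
Implicit Types (q : R -> R) (x y u : R).

(* Split according to whether [-ln u <= a `^ eps]; in the other case [a * -ln u]
   is at most [(-ln u) `^ (1 + 1/eps)]. *)
Lemma mul_oppr_ln_le (eps : R) : 0 < eps ->
  exists2 K, 0 <= K & forall a u, 0 <= a -> 0 < u -> u < 1 ->
    a * - ln u <= a `^ (1 + eps) + K * (Num.sqrt u)^-1.
Proof.
move=> e0; pose p := 1 + eps^-1; have p0 : 0 < p by rewrite addr_gt0// invr_gt0.
exists ((2 * p) `^ p); first exact: powR_ge0.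
move=> a u a0 u0 u1; set L := - ln u.
have L0 : 0 <= L by rewrite oppr_ge0 ln_le0// ltW.
have su0 : 0 <= (Num.sqrt u)^-1 by rewrite invr_ge0 sqrtr_ge0.
have [aL|La] := leP L (a `^ eps).
  rewrite -[leLHS]addr0 lerD ?mulr_ge0 ?powR_ge0//.
  by rewrite powRD ?powRr1// ?ler_wpM2l// gt_eqF// addr_gt0.
rewrite -[leLHS]add0r lerD ?powR_ge0//.
have aE : a = (a `^ eps) `^ eps^-1 by rewrite -powRrM divff ?gt_eqF// powRr1.
have h1 : a * L <= L `^ p.
  rewrite /p powRD ?powRr1//; last by rewrite gt_eqF.
  rewrite mulrC ler_wpM2l// [leLHS]aE ge0_ler_powR ?invr_ge0 ?nnegrE ?powR_ge0//; exact: ltW.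
apply: le_trans h1 _.
(* The square-root bound is applied to [u ^ (1 / p)], so that the [p]-th power of the result is
   [(2 p) ^ p * u ^ (-1/2)]; this fixes the witness [K]. *)
have h2 : L <= 2 * p * u `^ (- (p^-1 * 2^-1)).
  have := oppr_ln_le_inv_sqrt (powR_gt0 p^-1 u0).
  rewrite ln_powR -powR12_sqrt ?powR_ge0// -powRrM -powRN -mulrN -/L mulrC => h.
  by rewrite mulrAC -ler_pdivrMr.
have -> : (Num.sqrt u)^-1 = (u `^ (- (p^-1 * 2^-1))) `^ p.
  rewrite -powRrM -powR12_sqrt ?ltW// -powRN; congr (_ `^ _).
  by rewrite mulNr mulrAC mulVf ?gt_eqF// mul1r.
rewrite -powRM ?powR_ge0//; last by rewrite mulr_ge0// ltW.
by rewrite ge0_ler_powR ?nnegrE ?mulr_ge0 ?powR_ge0// ltW.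
Qed.

Definition neg_ln u : R := if u < 1 then - ln u else 0.

Lemma neg_ln_ge0 u : 0 <= neg_ln u.
Proof. by rewrite /neg_ln; case: ifPn => // /ltW u1; rewrite oppr_ge0 ln_le0. Qed.

Lemma log_kernel_le_neg_ln x y : log_kernel x y <= `|x| + `|y| + neg_ln `|x - y|.
Proof.
rewrite /log_kernel lerD2l /neg_ln; case: ifPn => //; rewrite -leNgt => u1.
by rewrite oppr_le0 ln_ge0.
Qed.

Lemma measurable_neg_ln x : measurable_fun [set: R] (fun y => neg_ln `|x - y|).
Proof. by rewrite /neg_ln; measurable_rules. Qed.

Let sing (t : R) : R := if `|t| < 1 then (Num.sqrt `|t|)^-1 else 0.

Let measurable_sing : measurable_fun [set: R] sing.
Proof. by rewrite /sing; measurable_rules. Qed.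

Let sing_ge0 t : 0 <= sing t.
Proof. by rewrite /sing; case: ifPn => // _; rewrite invr_ge0 sqrtr_ge0. Qed.

Let integral_sing x : (\int[mu]_y (sing (x - y))%:E = 4%:E)%E.
Proof.
have <- : (\int[mu]_y (sing y)%:E = 4%:E)%E.
  have := integral_inv_sqrt_norm (@ltr01 R); rewrite sqrtr1 mulr1 => <-.
  rewrite [RHS]integral_mkcond; apply: eq_integral => y _.
  rewrite patchE mem_setE in_itv/= /sing ltr_norml.
  by case: ifPn.
rewrite (@ge0_integral_affine _ (fun y => (sing y)%:E) (-1) x) ?oppr_eq0 ?oner_eq0//.
- rewrite normrN normr1 mul1e; apply: eq_integral => y _.
  by rewrite mulN1r addrC.
exact/measurable_EFinP.
Qed.

(** A representative that is nonnegative everywhere and zero on the negative axis, where [q] is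
    arbitrary. Integrals over the half-line become integrals over the whole line. *)
Definition half_line_abs q x : R := if 0 <= x then `|q x| else 0.

Lemma half_line_abs_ge0 q x : 0 <= half_line_abs q x.
Proof. by rewrite /half_line_abs; case: ifPn. Qed.

Lemma mem_Rplus x : (x \in @Rplus R) = (0 <= x).
Proof. by rewrite /Rplus mem_setE in_itv/= andbT. Qed.

Lemma measurable_Rplus : measurable (@Rplus R).
Proof. exact: measurable_itv. Qed.

Lemma integral_half_line_abs q (F : R -> R -> R) : (forall x, F x 0 = 0) ->
  (\int[mu]_(x in @Rplus R) (F x `|q x|)%:E = \int[mu]_x (F x (half_line_abs q x))%:E)%E.
Proof.
move=> F0; rewrite [LHS]integral_mkcond; apply: eq_integral => x _.
by rewrite patchE mem_Rplus /half_line_abs; case: ifPn => // _; rewrite F0.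
Qed.

Section tame.
Variable q : R -> R.
Hypothesis tq : tame q.

Lemma tame_measurable : measurable_fun (@Rplus R) q.
Proof. by case: tq => /measurable_int /measurable_EFinP. Qed.

Lemma measurable_half_line_abs : measurable_fun [set: R] (half_line_abs q).
Proof.
have -> : half_line_abs q = (fun x => `|q x|) \_ (@Rplus R).
  by apply/funext => x; rewrite patchE mem_Rplus.
apply/measurable_restrict => //; first exact: measurable_Rplus.
by rewrite setTI; apply: measurableT_comp => //; exact: tame_measurable.
Qed.

(** The exponent [1 + eps] of tameness controls the part of the logarithm near the diagonal,
    uniformly in [x]: the singular majorant is a translate of a fixed function with integral 4. *)
Lemma integral_neg_ln_bounded : exists C : R, forall x,
  (\int[mu]_y (half_line_abs q y * neg_ln `|x - y|)%:E <= C%:E)%E.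
Proof.
have [_ _ [eps e0 hq]] := tq.
have [K K0 hK] := mul_oppr_ln_le e0.
rewrite (@integral_half_line_abs q (fun _ a => a `^ (1 + eps))) in hq; last first.
  by move=> x; rewrite powR0// gt_eqF// addr_gt0.
set A := (X in (X < _)%E) in hq.
have A0 : (0 <= A)%E by apply: integral_ge0 => x _; rewrite lee_fin powR_ge0.
exists (fine A + K * 4) => x.
have mh := measurable_half_line_abs.
have mp : measurable_fun [set: R] (fun y => (half_line_abs q y `^ (1 + eps))%:E).
  by apply/measurable_EFinP; exact: measurableT_comp (measurable_powR _) mh.
have ms : measurable_fun [set: R] (fun y => sing (x - y)).
  by apply: (measurableT_comp measurable_sing); measurable_rules.
rewrite EFinD fineK ?ge0_fin_numE// EFinM -(integral_sing x) -ge0_integralZl; last first.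
- by rewrite lee_fin.
- by move=> y _; rewrite lee_fin.
- exact/measurable_EFinP.
- by [].
rewrite -ge0_integralD; last first.
- by apply: measurable_funeM; exact/measurable_EFinP.
- by move=> y _; rewrite mule_ge0 ?lee_fin.
- exact: mp.
- by move=> y _; rewrite lee_fin powR_ge0.
- by [].
apply: ge0_le_integral => //.
- by move=> y _; rewrite lee_fin mulr_ge0 ?half_line_abs_ge0 ?neg_ln_ge0.
- by apply/measurable_EFinP; apply: measurable_funM => //; exact: measurable_neg_ln.
- apply: emeasurable_funD => //.
  by apply: measurable_funeM; exact/measurable_EFinP.
move=> y _; rewrite -EFinM -EFinD lee_fin /neg_ln /sing.
have h0 := half_line_abs_ge0 q y.
case: ifPn => [u1|_]; last by rewrite !mulr0 addr0 powR_ge0.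
have [->|ne] := eqVneq `|x - y| 0.
  by rewrite ln0// oppr0 mulr0 addr_ge0 ?powR_ge0// mulr_ge0// sqrtr0 invr0.
by apply: hK => //; rewrite lt0r ne normr_ge0.
Qed.

End tame.

End tame_functions.

(** * Finite potentials and energies of admissible densities *)

Section densities.
Context {R : realType}.
Local Notation mu := (@lebesgue_measure R).
Implicit Types (f q : R -> R) (x y m : R).

(** Recovers integrals of the signed logarithm [|x| + |y| - log_kernel x y] from nonnegative ones.
    The energy uses it for the inner integral with [c = |x|] and for the outer one with [c = m]. *)
Lemma integral_nice_densityMD f m (V : R -> R) (v a c : R) : nice_density f m ->
  measurable_fun [set: R] V -> (forall x, 0 <= V x) ->
  (\int[mu]_x (f x * V x)%:E = v%:E)%E ->
  (\int[mu]_x (f x * (a * (c + `|x| - V x)))%:E = (a * (c + m - v))%:E)%E.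
Proof.
move=> [mf f0 f1 fm] mV V0 fV.
have if1 : mu.-integrable [set: R] (EFin \o f) := ge0_integrable measurableT mf (fun x _ => f0 x) f1.
have ifm : mu.-integrable [set: R] (EFin \o (fun x => f x * `|x|)).
  apply: ge0_integrable fm => //; first by measurable_rules.
  by move=> x _; rewrite mulr_ge0.
have ifV : mu.-integrable [set: R] (EFin \o (fun x => f x * V x)).
  apply: ge0_integrable fV => //; first exact: measurable_funM.
  by move=> x _; rewrite mulr_ge0.
have icf : mu.-integrable [set: R] (fun x => c%:E * (f x)%:E)%E by exact: integrableZl.
have icm : mu.-integrable [set: R] (fun x => c%:E * (f x)%:E + (f x * `|x|)%:E)%E.
  exact: integrableD.
have iall : mu.-integrable [set: R]
  (fun x => c%:E * (f x)%:E + (f x * `|x|)%:E - (f x * V x)%:E)%E by exact: integrableB.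
transitivity (\int[mu]_x (a%:E * (c%:E * (f x)%:E + (f x * `|x|)%:E - (f x * V x)%:E)))%E.
  by apply: eq_integral => x _; congr EFin; ring.
rewrite integralZl; [|by []|exact: iall].
rewrite integralB; [|by []|exact: icm|exact: ifV].
rewrite integralD; [|by []|exact: icf|exact: ifm].
rewrite integralZl; [|by []|exact: if1].
by rewrite f1 fm fV mule1.
Qed.

Section density.
Variable q : R -> R.
Hypothesis dq : densities q.
Local Notation q' := (half_line_abs q).

Let tq : tame q. Proof. by case: dq. Qed.
Let mq : measurable_fun (@Rplus R) q := tame_measurable tq.
Let mq' : measurable_fun [set: R] q' := measurable_half_line_abs tq.

Lemma integral_density (phi : R -> R) : measurable_fun [set: R] phi ->
  (\int[mu]_(x in @Rplus R) (q x * phi x)%:E = \int[mu]_x (q' x * phi x)%:E)%E.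
Proof.
move=> mphi; rewrite -(@integral_half_line_abs _ q (fun x a => a * phi x)); last first.
  by move=> x; rewrite mul0r.
have mphi' : measurable_fun (@Rplus R) phi by exact: measurable_funTS.
apply: ae_eq_integral; first exact: measurable_Rplus.
- by apply/measurable_EFinP; exact: measurable_funM.
- by apply/measurable_EFinP; apply: measurable_funM => //; exact: measurableT_comp.
have [_ q0 _] := dq; apply: (ae_imply q0) => x qx /qx {}qx.
by rewrite ger0_norm.
Qed.

Lemma density_nice : exists m, nice_density q' m.
Proof.
have [_ q0 q1] := dq; have [_ qx _] := tq.
exists (fine (\int[mu]_(x in @Rplus R) (x * `|q x|)%:E)); split => //.
- by move=> x; exact: half_line_abs_ge0.
- transitivity (\int[mu]_x (q' x * 1)%:E)%E; first by under [RHS]eq_integral do rewrite mulr1.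
  rewrite -integral_density//; first by under eq_integral do rewrite mulr1.
rewrite fineK; last first.
  rewrite ge0_fin_numE//; apply: integral_ge0 => x; rewrite /Rplus/= in_itv/= andbT => x0.
  by rewrite lee_fin mulr_ge0.
rewrite -(@integral_half_line_abs _ q (fun x a => a * `|x|)); last by move=> x; rewrite mul0r.
apply: eq_integral => x; rewrite mem_Rplus => x0.
by rewrite (ger0_norm x0) mulrC.
Qed.

Lemma density_potential : exists U : R -> R, [/\ measurable_fun [set: R] U,
  forall x, 0 <= U x, exists C, forall x, U x <= `|x| + C &
  forall x, (\int[mu]_y (q' y * log_kernel x y)%:E = (U x)%:E)%E].
Proof.
have [m nq] := density_nice; have [_ q0 q1 qm] := nq.
have [C hC] := integral_neg_ln_bounded tq.
pose G x := (\int[mu]_y (q' y * log_kernel x y)%:E)%E.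
have G0 x : (0 <= G x)%E.
  by apply: integral_ge0 => y _; rewrite lee_fin mulr_ge0// log_kernel_ge0.
have Gle x : (G x <= (`|x| + (m + C))%:E)%E.
  apply: (@le_trans _ _ (\int[mu]_y (`|x|%:E * (q' y)%:E + (q' y * `|y|)%:E +
      (q' y * neg_ln `|x - y|)%:E))%E).
    apply: ge0_le_integral => //.
    - by move=> y _; rewrite lee_fin mulr_ge0// log_kernel_ge0.
    - by apply/measurable_EFinP; apply: measurable_funM => //; exact: measurable_log_kernel.
    - apply: emeasurable_funD; first apply: emeasurable_funD.
      + by apply: measurable_funeM; exact/measurable_EFinP.
      + by apply/measurable_EFinP; measurable_rules.
      + by apply/measurable_EFinP; apply: measurable_funM => //; exact: measurable_neg_ln.
    move=> y _; rewrite -EFinM -!EFinD lee_fin.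
    have := ler_wpM2l (q0 y) (log_kernel_le_neg_ln x y).
    by rewrite !mulrDr [_ * `|x|]mulrC.
  rewrite ge0_integralD; last first.
  - by apply/measurable_EFinP; apply: measurable_funM => //; exact: measurable_neg_ln.
  - by move=> y _; rewrite lee_fin mulr_ge0 ?neg_ln_ge0.
  - apply: emeasurable_funD; first by apply: measurable_funeM; exact/measurable_EFinP.
    by apply/measurable_EFinP; measurable_rules.
  - by move=> y _; rewrite -EFinM -EFinD lee_fin addr_ge0 ?mulr_ge0.
  - by [].
  rewrite ge0_integralD; last first.
  - by apply/measurable_EFinP; measurable_rules.
  - by move=> y _; rewrite lee_fin mulr_ge0.
  - by apply: measurable_funeM; exact/measurable_EFinP.
  - by move=> y _; rewrite -EFinM lee_fin mulr_ge0.
  - by [].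
  rewrite ge0_integralZl; [|by []|exact/measurable_EFinP|by move=> y _; rewrite lee_fin|by rewrite lee_fin].
  rewrite q1 qm mule1 (_ : (`|x| + (m + C))%:E = (`|x|%:E + m%:E + C%:E)%E); last first.
    by rewrite -!EFinD addrA.
  by apply: leeD => //; exact: hC.
have Gfin x : G x \is a fin_num.
  by rewrite ge0_fin_numE// (le_lt_trans (Gle x))// ltry.
exists (fun x => fine (G x)); split.
- apply: measurableT_comp => //.
  pose F (z : R * R) := (q' z.2 * log_kernel z.1 z.2)%:E.
  have mF : measurable_fun [set: R * R] F.
    apply/measurable_EFinP; apply: measurable_funM.
      by apply: (measurableT_comp mq'); exact: measurable_snd.
    by rewrite /log_kernel; measurable_rules.
  have F0 z : (0 <= F z)%E by rewrite lee_fin mulr_ge0// log_kernel_ge0.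
  exact: (@measurable_fun_fubini_tonelli_F _ _ _ _ R mu F mF F0).
- by move=> x; exact: fine_ge0.
- by exists (m + C) => x; rewrite -lee_fin fineK.
- by move=> x; rewrite fineK.
Qed.

Lemma mutual_energy_potential f (U : R -> R) :
  (forall x, (\int[mu]_y (q' y * log_kernel x y)%:E = (U x)%:E)%E) -> (forall x, 0 <= f x) ->
  mutual_energy f q' = (\int[mu]_x (f x * U x)%:E)%E.
Proof.
move=> UE f0; apply: eq_integral => x _.
rewrite EFinM -UE -ge0_integralZl.
- by apply: eq_integral => y _; rewrite -EFinM mulrA.
- by [].
- by apply/measurable_EFinP; apply: measurable_funM => //; exact: measurable_log_kernel.
- by move=> y _; rewrite lee_fin mulr_ge0 ?half_line_abs_ge0 ?log_kernel_ge0.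
- by rewrite lee_fin.
Qed.

Lemma mutual_energy_density f m : nice_density f m -> exists Q, mutual_energy f q' = Q%:E.
Proof.
move=> [mf f0 f1 fm].
have [U [mU U0 [C UC] UE]] := density_potential.
rewrite (mutual_energy_potential UE f0).
have C0 : 0 <= C by have := le_trans (U0 0) (UC 0); rewrite normr0 add0r.
exists (fine (\int[mu]_x (f x * U x)%:E)); rewrite fineK// ge0_fin_numE; last first.
  by apply: integral_ge0 => x _; rewrite lee_fin mulr_ge0.
apply: (@le_lt_trans _ _ (\int[mu]_x ((f x * `|x|)%:E + C%:E * (f x)%:E))%E).
  apply: ge0_le_integral => //.
  - by move=> x _; rewrite lee_fin mulr_ge0.
  - by apply/measurable_EFinP; exact: measurable_funM.
  - apply: emeasurable_funD; first by apply/measurable_EFinP; measurable_rules.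
    by apply: measurable_funeM; exact/measurable_EFinP.
  move=> x _; rewrite -EFinM -EFinD lee_fin.
  by have := ler_wpM2l (f0 x) (UC x); rewrite mulrDr [_ * C]mulrC.
rewrite ge0_integralD; last first.
- by apply: measurable_funeM; exact/measurable_EFinP.
- by move=> x _; rewrite -EFinM lee_fin mulr_ge0.
- by apply/measurable_EFinP; measurable_rules.
- by move=> x _; rewrite lee_fin mulr_ge0.
- by [].
rewrite ge0_integralZl; [|by []|exact/measurable_EFinP|by move=> y _; rewrite lee_fin|by rewrite lee_fin].
by rewrite f1 fm mule1 -EFinD ltry.
Qed.

Lemma energy_density m Q : nice_density q' m -> mutual_energy q' q' = Q%:E ->
  energy 1 q = (Q - m)%:E.
Proof.
move=> nq; have [_ q0 q1 qm] := nq.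
have [U [mU U0 _ UE]] := density_potential.
rewrite (mutual_energy_potential UE q0) => QE.
have E1 : (\int[mu]_(x in @Rplus R) (x * q x)%:E = m%:E)%E.
  rewrite -qm -integral_density; last by measurable_rules.
  apply: eq_integral => x; rewrite mem_Rplus => x0.
  by rewrite (ger0_norm x0) mulrC.
have E2 : (\int[mu]_(x in @Rplus R) \int[mu]_(y in @Rplus R)
    (q x * q y * ln `|x - y|)%:E = (m + m - Q)%:E)%E.
  transitivity (\int[mu]_(x in @Rplus R) (q x * (1 * (m + `|x| - U x)))%:E)%E.
    apply: eq_integral => x _.
    transitivity (\int[mu]_(y in @Rplus R) (q y * (q x * (`|x| + `|y| - log_kernel x y)))%:E)%E.
      by apply: eq_integral => y _; congr EFin; rewrite /log_kernel; ring.
    rewrite integral_density; last first.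
      apply: measurable_funM => //; apply: measurable_funB; first by measurable_rules.
      exact: measurable_log_kernel.
    rewrite (integral_nice_densityMD _ _ nq (measurable_log_kernel x) (log_kernel_ge0 x) (UE x)).
    by congr EFin; ring.
  rewrite integral_density; last by measurable_rules.
  rewrite (integral_nice_densityMD _ _ nq mU U0 QE).
  by congr EFin; ring.
(* For [beta = 1] the middle term is 0 even if its integral is infinite, since [0 * oo = 0] in the
   extended reals. *)
by rewrite /energy E1 E2 subrr mul0e sube0 -EFinB; congr EFin; ring.
Qed.

Lemma log_moment_density (rho L : R) :
  (\int[mu]_(x in @Rplus R) (q x * ln (1 + rho * x))%:E = L%:E)%E <->
  (\int[mu]_x (q' x * ln (1 + rho * `|x|))%:E = L%:E)%E.
Proof.
rewrite -integral_density; last by measurable_rules.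
suff -> : (\int[mu]_(x in @Rplus R) (q x * ln (1 + rho * x))%:E =
  \int[mu]_(x in @Rplus R) (q x * ln (1 + rho * `|x|))%:E)%E by [].
by apply: eq_integral => x; rewrite mem_Rplus => x0; rewrite (ger0_norm x0).
Qed.

End density.

Lemma ae_eq_half_line_abs q q2 : densities q -> densities q2 ->
  {ae mu, forall x, half_line_abs q x = half_line_abs q2 x} ->
  q = q2 %[ae mu in @Rplus R].
Proof.
move=> [_ q0 _] [_ q20 _] h.
apply: (ae_imply (ae_and h (ae_and q0 q20))) => x [e [h1 h2]] xR.
move: e; rewrite /half_line_abs.
have -> : 0 <= x by move: xR; rewrite /Rplus/= in_itv/= andbT.
by rewrite !ger0_norm; [|exact: h2|exact: h1].
Qed.

End densities.

(** * Admissibility of the optimal density *)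

Section optimal_density_admissible.
Context {R : realType}.
Local Notation mu := (@lebesgue_measure R).
Variables (rho k b : R).
Hypotheses (rho0 : 0 < rho) (b0 : 0 < b).
Local Notation s := (Num.sqrt (1 + rho * b)).
Hypothesis krs : k * rho <= s.
Hypothesis kE : k = (b / 2 - 2) / (1 - 1 / s).
Local Notation p := (opt_density rho k b).

Let p0 x : 0 <= p x. Proof. exact: opt_density_ge0. Qed.
Let mp : measurable_fun [set: R] p. Proof. exact: measurable_opt_density. Qed.
Let p1 : (\int[mu]_x (p x)%:E = 1)%E. Proof. exact: integral_opt_density1. Qed.
Let pm : (\int[mu]_x (p x * `|x|)%:E = (opt_moment rho k b)%:E)%E.
Proof. exact: integral_opt_density_norm. Qed.

Lemma opt_density_nice : nice_density p (opt_moment rho k b).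
Proof. by split. Qed.

Lemma half_line_abs_opt_density : half_line_abs p = p.
Proof.
apply/funext => x; rewrite /half_line_abs; case: ifPn => x0; first by rewrite ger0_norm.
by rewrite opt_density_eq0// negb_and -leNgt (ltW (_ : x < 0)) ?ltNge.
Qed.

Lemma opt_density_le_inv_sqrt : exists2 c, 0 <= c &
  forall x, 0 < x < b -> p x <= c * (Num.sqrt x)^-1.
Proof.
pose M := rho * b + 1 + `|k * rho / s|.
have M0 : 0 <= M by rewrite !addr_ge0// mulr_ge0// ltW.
exists (Num.sqrt b * M); first by rewrite mulr_ge0// sqrtr_ge0.
move=> x /andP[x0 xb]; rewrite /opt_density x0 (ltW xb)/=.
have rx : 0 < rho * x by rewrite mulr_gt0.
have D1 : 1 <= 2 * pi * (1 + rho * x) :> R.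
  have := @pi_ge2 R; have := mulr_gt0 (@pi_gt0 R) rx; nra.
have sx : 0 < (Num.sqrt x)^-1 by rewrite invr_gt0 sqrtr_gt0.
rewrite invfM mulrA mulrAC ler_wpM2r ?(ltW sx)//.
have h1 : Num.sqrt (b - x) / (2 * pi * (1 + rho * x)) <= Num.sqrt b.
  rewrite ler_pdivrMr; last by lra.
  have := sqrtr_ge0 b; have : Num.sqrt (b - x) <= Num.sqrt b.
    by apply: ler_wsqrtr; lra.
  nra.
have h2 : rho * x + 1 - k * rho / s <= M.
  have := ler_norm (- (k * rho / s)); rewrite normrN /M.
  have : rho * x <= rho * b by rewrite ler_pM2l// ltW.
  lra.
have h0 : 0 <= Num.sqrt (b - x) / (2 * pi * (1 + rho * x)).
  by rewrite divr_ge0 ?sqrtr_ge0//; lra.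
apply: le_trans (_ : Num.sqrt (b - x) / (2 * pi * (1 + rho * x)) * M <= _).
  exact: ler_wpM2l.
exact: ler_wpM2r.
Qed.

Let integral_inv_quartic : (\int[mu]_(x in `]0%R, b[)
  ((Num.sqrt x)^-1 * (Num.sqrt (Num.sqrt x))^-1)%:E = (4 * Num.sqrt (Num.sqrt b))%:E)%E.
Proof.
pose F (x : R) := 4 * Num.sqrt (Num.sqrt x).
have -> : 4 * Num.sqrt (Num.sqrt b) = F b - F 0 by rewrite /F !sqrtr0 mulr0 subr0.
apply: (@ge0_integral_FTC_oo _ _ F _ _ _ _ b0).
- move=> x /andP[x0 _]; have sx : 0 < Num.sqrt x by rewrite sqrtr_gt0.
  apply: has_derivative_eq; first by rewrite /F; derive_rules; rewrite ?gt_eqF.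
  have ssx : 0 < Num.sqrt (Num.sqrt x) by rewrite sqrtr_gt0.
  by rewrite /=; field; rewrite !gt_eqF.
- move=> x /andP[x0 _]; have sx : 0 < Num.sqrt x by rewrite sqrtr_gt0.
  have ssx : 0 < Num.sqrt (Num.sqrt x) by rewrite sqrtr_gt0.
  by cvg_rules; rewrite ?gt_eqF.
- by move=> x _; rewrite mulr_ge0// invr_ge0 sqrtr_ge0.
- by apply: cvg_at_right_filter; rewrite /F; cvg_rules.
- by apply: cvg_at_left_filter; rewrite /F; cvg_rules.
Qed.

Lemma tame_opt_density : tame p.
Proof.
have ip := nice_density_integrable opt_density_nice.
split.
- by apply: integrableS ip => //; exact: measurable_Rplus.
- rewrite (_ : (\int[mu]_(x in @Rplus R) _ = (opt_moment rho k b)%:E)%E) ?ltry//.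
  transitivity (\int[mu]_(x in @Rplus R) (`|p x| * `|x|)%:E)%E.
    by apply: eq_integral => x; rewrite mem_Rplus => x0; rewrite (ger0_norm x0) mulrC.
  rewrite (@integral_half_line_abs _ p (fun x a => a * `|x|)); last by move=> x; rewrite mul0r.
  by rewrite half_line_abs_opt_density.
have [c c0 pc] := opt_density_le_inv_sqrt.
(* The density is at most a multiple of [x ^ (-1/2)], so its power [3 / 2] is at most a multiple of
   [x ^ (-3/4)], still integrable at 0. *)
exists 2^-1; first by rewrite invr_gt0.
have e0 : 1 + 2^-1 != 0 :> R by rewrite gt_eqF.
rewrite (@integral_half_line_abs _ p (fun _ a => a `^ (1 + 2^-1))); last first.
  by move=> x; rewrite powR0.
rewrite half_line_abs_opt_density.
have -> : (\int[mu]_x (p x `^ (1 + 2^-1))%:E = \int[mu]_(x in `]0%R, b[) (p x `^ (1 + 2^-1))%:E)%E.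
  rewrite [RHS]integral_mkcond; apply: eq_integral => x _.
  rewrite patchE mem_setE in_itv/=; case: ifPn => // h.
  by rewrite opt_density_eq0// powR0.
have mpp : measurable_fun [set: R] (fun x => (p x `^ (1 + 2^-1))%:E).
  by apply/measurable_EFinP; exact: measurableT_comp (measurable_powR _) mp.
have mq : measurable_fun [set: R] (fun x : R => ((Num.sqrt x)^-1 * (Num.sqrt (Num.sqrt x))^-1)%:E).
  by apply/measurable_EFinP; measurable_rules.
apply: (@le_lt_trans _ _ (\int[mu]_(x in `]0%R, b[)
    ((c `^ (1 + 2^-1))%:E * ((Num.sqrt x)^-1 * (Num.sqrt (Num.sqrt x))^-1)%:E))%E).
  apply: ge0_le_integral => //.
  - by move=> x _; rewrite lee_fin powR_ge0.
  - exact: measurable_funTS.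
  - by apply: measurable_funeM; exact: measurable_funTS.
  move=> x /=; rewrite in_itv/= => xb; rewrite -EFinM lee_fin.
  have sx : 0 <= (Num.sqrt x)^-1 by rewrite invr_ge0 sqrtr_ge0.
  apply: (@le_trans _ _ ((c * (Num.sqrt x)^-1) `^ (1 + 2^-1))).
    by rewrite ge0_ler_powR ?nnegrE ?mulr_ge0 ?pc.
  rewrite powRM// ler_wpM2l ?powR_ge0//.
  have x0 : 0 < (Num.sqrt x)^-1 by rewrite invr_gt0 sqrtr_gt0; case/andP: xb.
  rewrite powRD; last by rewrite (gt_eqF x0) implybT.
  by rewrite powRr1// powR12_sqrt// sqrtrV ?sqrtr_ge0.
rewrite ge0_integralZl; [|by []|exact: measurable_funTS| |by rewrite lee_fin powR_ge0].
  by rewrite integral_inv_quartic -EFinM ltry.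
by move=> x _; rewrite lee_fin mulr_ge0// invr_ge0 sqrtr_ge0.
Qed.

Lemma densities_opt_density : densities p.
Proof.
split; first exact: tame_opt_density.
  by apply: aeW => x _.
rewrite -p1 [LHS]integral_mkcond; apply: eq_integral => x _.
rewrite patchE mem_Rplus; case: ifPn => // h.
by rewrite opt_density_eq0// negb_and -leNgt ltW// ltNge.
Qed.

Lemma densities_at_opt_density : densities_at rho (opt_log_moment rho k b) p.
Proof.
split; first exact: densities_opt_density.
apply/(log_moment_density densities_opt_density).
by rewrite half_line_abs_opt_density; exact: integral_opt_density_ln.
Qed.

End optimal_density_admissible.

(** * Minimality *)

Section minimality.
Context {R : realType}.
Local Notation mu := (@lebesgue_measure R).
Variables (rho k b : R).
Hypotheses (rho0 : 0 < rho) (b0 : 0 < b).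
Local Notation s := (Num.sqrt (1 + rho * b)).
Hypothesis krs : k * rho <= s.
Hypothesis kE : k = (b / 2 - 2) / (1 - 1 / s).
Local Notation p := (opt_density rho k b).
Local Notation m1 := (opt_moment rho k b).
Local Notation Cb := (opt_level rho k b).
Implicit Types (f q : R -> R) (x y m L Q : R).

Let np : nice_density p m1. Proof. exact: opt_density_nice. Qed.
Let dp : densities p. Proof. exact: densities_opt_density. Qed.
Let pE : half_line_abs p = p. Proof. exact: half_line_abs_opt_density. Qed.

Let W x := x / 2 + k / 2 * ln (1 + rho * x) + m1 - Cb.

Let potential : exists U : R -> R, [/\ measurable_fun [set: R] U, forall x, 0 <= U x,
  forall x, (\int[mu]_y (p y * log_kernel x y)%:E = (U x)%:E)%E,
  forall x, 0 <= x -> W x <= U x & forall x, 0 <= x <= b -> U x = W x].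
Proof.
have [U [mU U0 _ UE]] := density_potential dp.
rewrite pE in UE; exists U; split => // x.
- by move=> /(opt_potential rho0 b0 krs kE)[V [VE h _]]; move: VE h; rewrite UE => -[->].
- by move=> /andP[/(opt_potential rho0 b0 krs kE)[V [VE _ h]] xb]; move: VE; rewrite UE h// => -[].
Qed.

Lemma log_moment_exists f m : nice_density f m ->
  exists L, (\int[mu]_x (f x * ln (1 + rho * `|x|))%:E = L%:E)%E.
Proof.
move=> [mf f0 _ fm].
have l0 x : 0 <= ln (1 + rho * `|x|) by rewrite ln_ge0// lerDl mulr_ge0// ltW.
have mfl : measurable_fun [set: R] (fun x => (f x * ln (1 + rho * `|x|))%:E).
  by apply/measurable_EFinP; measurable_rules.
exists (fine (\int[mu]_x (f x * ln (1 + rho * `|x|))%:E)).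
rewrite fineK// ge0_fin_numE; last by apply: integral_ge0 => x _; rewrite lee_fin mulr_ge0.
apply: (@le_lt_trans _ _ (\int[mu]_x (rho%:E * (f x * `|x|)%:E))%E).
  apply: ge0_le_integral => //.
  - by move=> x _; rewrite lee_fin mulr_ge0.
  - by apply: measurable_funeM; apply/measurable_EFinP; measurable_rules.
  move=> x _; rewrite -EFinM lee_fin mulrCA ler_wpM2l//.
  by apply: le_ln1Dx; rewrite (lt_le_trans (ltrN10 R))// mulr_ge0// ltW.
rewrite ge0_integralZl; [|by []| | |by rewrite lee_fin ltW].
- by rewrite fm -EFinM ltry.
- by apply/measurable_EFinP; measurable_rules.
- by move=> x _; rewrite lee_fin mulr_ge0.
Qed.

Section cross_energy.
Variables (f : R -> R) (m L Q : R).
Hypotheses (nf : nice_density f m) (f_half_line : forall x, x < 0 -> f x = 0)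
  (fL : (\int[mu]_x (f x * ln (1 + rho * `|x|))%:E = L%:E)%E)
  (fQ : mutual_energy f p = Q%:E).

(** [d] is the slack in the Euler-Lagrange inequality. Averaged against [f] it is the excess of the
    cross energy, hence nonnegative, and 0 when [f] lives on []0, b[]. *)
Let slack : exists d : R -> R, [/\ forall x, 0 <= f x * d x,
  forall x, 0 <= x <= b -> d x = 0 &
  (\int[mu]_x (f x * d x)%:E = (Q - (m / 2 + k / 2 * L + m1 - Cb))%:E)%E].
Proof.
have [U [mU U0 UE WU UW]] := potential.
have [mf f0 f1 fm] := nf.
exists (fun x => U x - W `|x|); split.
- move=> x; have [x0|x0] := ltP x 0; first by rewrite f_half_line// mul0r.
  by rewrite mulr_ge0// subr_ge0 ger0_norm ?WU.
- by move=> x /[dup] xb /andP[x0 _]; rewrite ger0_norm// UW// subrr.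
have fU : (\int[mu]_x (f x * U x)%:E = Q%:E)%E.
  rewrite -fQ -[in RHS]pE (mutual_energy_potential dp _ f0 (U := U))//.
  by move=> x; rewrite pE.
have if1 : mu.-integrable [set: R] (EFin \o f) := nice_density_integrable nf.
have ifm : mu.-integrable [set: R] (EFin \o (fun x => f x * `|x|)).
  apply: ge0_integrable fm => //; first by measurable_rules.
  by move=> x _; rewrite mulr_ge0.
have ifU : mu.-integrable [set: R] (EFin \o (fun x => f x * U x)).
  apply: ge0_integrable fU => //; first exact: measurable_funM.
  by move=> x _; rewrite mulr_ge0.
have ifL : mu.-integrable [set: R] (EFin \o (fun x => f x * ln (1 + rho * `|x|))).
  apply: ge0_integrable fL => //; first by measurable_rules.
  by move=> x _; rewrite mulr_ge0// ln_ge0// lerDl mulr_ge0// ltW.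
have i1 : mu.-integrable [set: R] (fun x => (2^-1)%:E * (f x * `|x|)%:E)%E by exact: integrableZl.
have i2 : mu.-integrable [set: R]
    (fun x => (k / 2)%:E * (f x * ln (1 + rho * `|x|))%:E)%E by exact: integrableZl.
have i3 : mu.-integrable [set: R] (fun x => (m1 - Cb)%:E * (f x)%:E)%E by exact: integrableZl.
have i12 := integrableD measurableT i1 i2.
have i123 := integrableD measurableT i12 i3.
transitivity (\int[mu]_x ((f x * U x)%:E - ((2^-1)%:E * (f x * `|x|)%:E +
    (k / 2)%:E * (f x * ln (1 + rho * `|x|))%:E + (m1 - Cb)%:E * (f x)%:E)))%E.
  by apply: eq_integral => x _; congr EFin; rewrite /W; field.
rewrite integralB; [|by []|exact: ifU|exact: i123].
rewrite integralD; [|by []|exact: i12|exact: i3].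
rewrite integralD; [|by []|exact: i1|exact: i2].
rewrite integralZl; [|by []|exact: ifm].
rewrite integralZl; [|by []|exact: ifL].
rewrite integralZl; [|by []|exact: if1].
by rewrite fU fm fL f1; congr EFin; field.
Qed.

Lemma cross_energy_ge : m / 2 + k / 2 * L + m1 - Cb <= Q.
Proof.
have [d [d0 _ dE]] := slack; rewrite -subr_ge0 -lee_fin -dE.
by apply: integral_ge0 => x _; rewrite lee_fin.
Qed.

(** Applied to [f = p], this yields the self-energy of [p] without a double integral. *)
Lemma cross_energy_eq : (forall x, ~~ (0 < x < b) -> f x = 0) ->
  Q = m / 2 + k / 2 * L + m1 - Cb.
Proof.
move=> fb; have [d [_ d0 dE]] := slack; apply/eqP; rewrite -subr_eq0.
apply/eqP; apply: EFin_inj; rewrite -dE integral0_eq// => x _.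
have [/andP[x0 xb]|/fb->] := boolP (0 < x < b); last by rewrite mul0r.
by rewrite d0 ?mulr0// !ltW.
Qed.

End cross_energy.

(** The value obtained by averaging the Euler-Lagrange equality against [p] and removing the moment
    terms of [log_kernel]. *)
Definition opt_energy : R := (m1 + k * opt_log_moment rho k b) / 2 - Cb.

Let self_energy : mutual_energy p p = (opt_energy + m1)%:E.
Proof.
have [Q QE] := mutual_energy_density dp np; rewrite pE in QE.
rewrite QE; congr EFin.
rewrite (cross_energy_eq np _ (integral_opt_density_ln rho0 b0 kE) QE).
- by rewrite /opt_energy; field.
- by move=> x x0; rewrite opt_density_eq0// negb_and -leNgt ltW.
- by move=> x; exact: opt_density_eq0.
Qed.

Lemma energy_opt_density : energy 1 p = opt_energy%:E.
Proof.
have nq : nice_density (half_line_abs p) m1 by rewrite pE.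
rewrite (energy_density dp nq (Q := opt_energy + m1)); last by rewrite pE.
by rewrite addrK.
Qed.

(* The first inequality is [cross_energy_ge]; the gap is then the energy of the
   signed measure [q - p], whence the equality case. *)
Lemma energy_ge q : densities q -> exists E L, [/\ energy 1 q = E%:E,
  (\int[mu]_(x in @Rplus R) (q x * ln (1 + rho * x))%:E = L%:E)%E,
  opt_energy + k * (L - opt_log_moment rho k b) <= E &
  E = opt_energy + k * (L - opt_log_moment rho k b) -> q = p %[ae mu in @Rplus R]].
Proof.
move=> dq; have [m nq] := density_nice dq.
have [Q QE] := mutual_energy_density dq nq.
have [L LE] := log_moment_exists nq.
have [Q2 Q2E] := mutual_energy_density dp nq; rewrite pE in Q2E.
exists (Q - m), L; split.
- exact: energy_density.
- exact/(log_moment_density dq).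
- have h1 := log_energy_ge0 nq np QE self_energy Q2E.
  have h2 := @cross_energy_ge _ _ _ _ nq _ LE Q2E.
  have {}h2 : m / 2 + k / 2 * L + m1 - Cb <= Q2.
    by apply: h2 => x; rewrite /half_line_abs ltNge => /negbTE ->.
  (* Twice the bound on the cross energy is inserted in the positivity of the neutral energy; the
     relation [2 * opt_energy = m1 + k * opt_log_moment - 2 * Cb] gives the form claimed. *)
  by move: h1 h2; rewrite /opt_energy; lra.
move=> e; have h2 := @cross_energy_ge _ _ _ _ nq _ LE Q2E.
have {}h2 : m / 2 + k / 2 * L + m1 - Cb <= Q2.
  by apply: h2 => x; rewrite /half_line_abs ltNge => /negbTE ->.
have h1 := log_energy_ge0 nq np QE self_energy Q2E.
have d0 : Q + (opt_energy + m1) - 2 * Q2 = 0.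
  apply/eqP; rewrite eq_le h1 andbT; move: e h2; rewrite /opt_energy; lra.
apply: ae_eq_half_line_abs => //; rewrite pE.
exact: (log_energy_eq0 nq np QE self_energy Q2E d0).
Qed.

Lemma minimizer_opt_density : unique_minimizer (energy 1)
  (densities_at rho (opt_log_moment rho k b)) p.
Proof.
have at_p := densities_at_opt_density rho0 b0 krs kE.
have hq q : densities_at rho (opt_log_moment rho k b) q -> exists E,
    [/\ energy 1 q = E%:E, opt_energy <= E & E = opt_energy -> q = p %[ae mu in @Rplus R]].
  move=> [dq Lq]; have [E [L [EE LE h1 h2]]] := energy_ge dq.
  move: LE h1 h2; rewrite Lq => -[<-]; rewrite subrr mulr0 addr0 => h1 h2.
  by exists E; split.
split; first (split; first exact: at_p).
  by move=> q /hq[E [-> h _]]; rewrite energy_opt_density lee_fin.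
move=> q [/hq[E [EE h1 h2]] hmin]; apply: h2; apply/eqP; rewrite eq_le h1 andbT.
by have := hmin _ at_p; rewrite EE energy_opt_density lee_fin.
Qed.

Lemma E1_opt_density : E1 1 rho (opt_log_moment rho k b) = opt_energy%:E.
Proof.
have [[at_p hmin] _] := minimizer_opt_density.
rewrite -energy_opt_density; apply/eqP; rewrite eq_le; apply/andP; split.
  by apply: ereal_inf_lbound; exists p.
by apply: le_ereal_inf_tmp => _ [q qat <-]; exact: hmin.
Qed.

(** Without a multiplier the bound of [energy_ge] no longer depends on the logarithmic moment, so it
    holds for all densities at once. *)
Lemma E0_opt_density : k = 0 -> E0 (1 : R) = opt_energy%:E.
Proof.
move=> k0; rewrite -energy_opt_density; apply/eqP; rewrite eq_le; apply/andP; split.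
  by apply: ereal_inf_lbound; exists p => //; exact: dp.
apply: le_ereal_inf_tmp => _ [q /energy_ge[E [L [-> _ h _]]] <-].
by rewrite energy_opt_density lee_fin; move: h; rewrite k0 mul0r addr0.
Qed.

End minimality.

(** [k = 0] forces [b = 4], and for any [rho] the density is then the Marchenko-Pastur law
    [sqrt (4 - x) / (2 pi sqrt x)]; the choice [rho = 1] is arbitrary. *)
Lemma E0_value (R : realType) : E0 (1 : R) = (3 / 2 : R)%:E.
Proof.
have c0 : (0 : R) * 1 <= Num.sqrt (1 + 1 * 4) by rewrite mul0r sqrtr_ge0.
have e0 : (0 : R) = (4 / 2 - 2) / (1 - 1 / Num.sqrt (1 + 1 * 4)).
  by rewrite (_ : 4 / 2 - 2 = 0 :> R) ?mul0r//; lra.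
have b4 : (0 : R) < 4 by [].
rewrite (E0_opt_density ltr01 b4 c0 e0)//; congr EFin.
by rewrite /opt_energy /opt_moment /opt_level !mul0r divff ?pnatr_eq0// ln1; field.
Qed.

(** * The parameters k and b *)

Section parameters.
Context {R : realType}.
Variable rho : R.
Hypothesis rho0 : 0 < rho.
Implicit Types (s k b r : R).

Local Notation t := (Num.sqrt rho).

Let t0 : 0 < t. Proof. by rewrite sqrtr_gt0. Qed.

Let rhoE : rho = t * t. Proof. by rewrite -expr2 sqr_sqrtr// ltW. Qed.

(* The system is parametrised by [s = sqrt (1 + rho * b)]. *)
Definition edge s : R := (s * s - 1) / rho.
Definition multiplier s : R := s * (s + 1) / (2 * rho) - 2 * s * (s - 1)^-1.
Definition rate s : R := 2 * (multiplier s + 1) * ln ((1 + s) / 2)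
  - 1 / (4 * rho) * (s - 1) ^+ 2 - multiplier s * ln s.

Lemma sqrt_edge s : 0 < s -> Num.sqrt (1 + rho * edge s) = s.
Proof.
move=> s0; rewrite (_ : 1 + rho * edge s = s ^+ 2); first by rewrite sqrtr_sqr gtr0_norm.
by rewrite /edge; field; rewrite gt_eqF.
Qed.

Lemma edge_sqrt b : 0 < b -> edge (Num.sqrt (1 + rho * b)) = b.
Proof.
move=> b0; rewrite /edge -expr2 sqr_sqrtr; last by rewrite addr_ge0// mulr_ge0// ltW.
by field; rewrite gt_eqF.
Qed.

Lemma kb_system_rate s : 1 < s -> kb_system rho (rate s) (multiplier s) (edge s).
Proof.
move=> s1; have s0 : 0 < s by lra.
have e : ln (1 + rho * edge s) = 2 * ln s.
  rewrite (_ : 1 + rho * edge s = s * s); first by rewrite lnM ?posrE//; ring.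
  by rewrite /edge; field; rewrite gt_eqF.
rewrite /kb_system sqrt_edge// e; split; last by rewrite /rate; field; rewrite gt_eqF.
by rewrite /multiplier /edge; field; rewrite !gt_eqF//; lra.
Qed.

(** [multiplier] increases with [s], being an increasing term minus [2 + 2 / (s - 1)], and takes the
    value [k_c rho] at [s = 1 + 2 * sqrt rho]. *)
Lemma multiplier_le s : 1 < s -> s <= 1 + 2 * t -> multiplier s <= k_c rho.
Proof.
move=> s1 sS; have u0 : 0 < s - 1 by lra.
have h1 : s * (s + 1) / (2 * rho) <= (1 + 2 * t) * (2 + 2 * t) / (2 * rho).
  by rewrite ler_pM2r ?invr_gt0 ?mulr_gt0//; have := t0; nra.
have h2 : (2 * t)^-1 <= (s - 1)^-1 by rewrite lef_pV2 ?posrE ?mulr_gt0//; lra.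
have -> : k_c rho = (1 + 2 * t) * (2 + 2 * t) / (2 * rho) - (2 + 2 * (2 * t)^-1).
  rewrite /k_c; have := t0; have := rhoE; move: t => u -> u00.
  by field; rewrite gt_eqF.
have -> : multiplier s = s * (s + 1) / (2 * rho) - (2 + 2 * (s - 1)^-1).
  by rewrite /multiplier; field; rewrite !gt_eqF.
lra.
Qed.

(** [multiplier s * rho - s] has the sign of [(s - 1) ^ 2 - 4 * rho], so [k_c] is the threshold at
    which the density would lose nonnegativity. Beyond [s = 1 + 2 * sqrt rho] one would get
    [multiplier s * rho > s > k_c rho * rho]. *)
Lemma multiplier_le_edge s : 1 < s -> multiplier s <= k_c rho -> multiplier s * rho <= s.
Proof.
move=> s1 kc; have s0 : 0 < s by lra.
have u0 : 0 < s - 1 by lra.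
have E : multiplier s * rho - s = s * ((s - 1) ^+ 2 - 4 * rho) / (2 * (s - 1)).
  by rewrite /multiplier; field; rewrite !gt_eqF.
have [sS|Ss] := leP s (1 + 2 * t).
  rewrite -subr_le0 E pmulr_lle0 ?invr_gt0 ?mulr_gt0// pmulr_rle0//.
  have := rhoE; have := t0; nra.
have : 0 < multiplier s * rho - s.
  rewrite E divr_gt0 ?mulr_gt0// subr_gt0; have := rhoE; have := t0; nra.
have : k_c rho * rho = 1 + 2 * t.
  rewrite /k_c; have := t0; have := rhoE; move: t => u -> u00.
  by field; rewrite gt_eqF.
have := ler_wpM2r (ltW rho0) kc.
lra.
Qed.

Let log_ratio s : 0 < s -> 2 * ln ((1 + s) / 2) - ln s = ln (1 + (s - 1) ^+ 2 / (4 * s)).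
Proof.
move=> s0; have h : 0 < (1 + s) / 2 by lra.
rewrite (_ : 1 + (s - 1) ^+ 2 / (4 * s) = (1 + s) / 2 * ((1 + s) / 2) / s); last first.
  by field; rewrite gt_eqF.
by move: ((1 + s) / 2) h => w w0; rewrite ln_div ?posrE ?mulr_gt0// lnM ?posrE//; ring.
Qed.

(** Here [multiplier] multiplies a logarithm of order [(s - 1) ^ 2], which absorbs its pole at
    [s = 1]. *)
Let rateE s : 0 < s -> rate s =
  2 * ln ((1 + s) / 2) - 1 / (4 * rho) * (s - 1) ^+ 2
  + multiplier s * ln (1 + (s - 1) ^+ 2 / (4 * s)).
Proof. by move=> s0; rewrite -log_ratio// /rate; ring. Qed.

Lemma rate_r_c : rate (1 + 2 * t) = r_c rho.
Proof.
have S0 : 0 < 1 + 2 * t by have := t0; lra.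
rewrite rateE// /r_c.
have -> : multiplier (1 + 2 * t) = (1 + 2 * t) / rho.
  rewrite /multiplier; have := t0; have := rhoE; move: t => u -> u00.
  by field; rewrite !gt_eqF//; lra.
have -> : 1 + (1 + 2 * t - 1) ^+ 2 / (4 * (1 + 2 * t)) = 1 + rho / (1 + 2 * t).
  have := t0; have := rhoE; move: t => u -> u00.
  by field; rewrite !gt_eqF//; lra.
have -> : (1 + (1 + 2 * t)) / 2 = 1 + t by field.
have -> : 1 / (4 * rho) * (1 + 2 * t - 1) ^+ 2 = 1.
  have := t0; have := rhoE; move: t => u -> u00.
  by field; rewrite gt_eqF.
ring.
Qed.

(** Makes [rate] as small as needed near [s = 1]. An upper bound suffices for the intermediate value
    theorem, so the negative terms are dropped. *)
Lemma rate_le s : 1 < s -> s <= 2 -> rate s <= (s - 1) * (1 + rho^-1).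
Proof.
move=> s1 s2; have s0 : 0 < s by lra.
have ri : 0 < rho^-1 by rewrite invr_gt0.
rewrite rateE//.
have h1 : ln ((1 + s) / 2) <= (s - 1) / 2.
  by rewrite (_ : (1 + s) / 2 = 1 + (s - 1) / 2); [apply: le_ln1Dx; lra|field].
have w0 : 0 <= (s - 1) ^+ 2 / (4 * s) by rewrite divr_ge0 ?sqr_ge0//; lra.
have h2 : ln (1 + (s - 1) ^+ 2 / (4 * s)) <= (s - 1) ^+ 2 / (4 * s).
  by apply: le_ln1Dx; lra.
have h3 : 0 <= ln (1 + (s - 1) ^+ 2 / (4 * s)) by rewrite ln_ge0//; lra.
have h4 : multiplier s <= s * (s + 1) / (2 * rho).
  rewrite /multiplier gerBl; apply: mulr_ge0; last by rewrite invr_ge0; lra.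
  lra.
have h5 : 0 <= s * (s + 1) / (2 * rho).
  by rewrite divr_ge0 ?mulr_ge0// ltW//; lra.
have h6 : 0 <= 1 / (4 * rho) * (s - 1) ^+ 2.
  by rewrite mulr_ge0 ?sqr_ge0// divr_ge0// mulr_ge0// ltW.
have h7 : multiplier s * ln (1 + (s - 1) ^+ 2 / (4 * s)) <=
    s * (s + 1) / (2 * rho) * ((s - 1) ^+ 2 / (4 * s)).
  exact: le_trans (ler_wpM2r h3 h4) (ler_wpM2l h5 h2).
have h8 : s * (s + 1) / (2 * rho) * ((s - 1) ^+ 2 / (4 * s)) <= (s - 1) * rho^-1.
  have -> : s * (s + 1) / (2 * rho) * ((s - 1) ^+ 2 / (4 * s)) =
      (s - 1) * rho^-1 * ((s + 1) * (s - 1) / 8) by field; rewrite !gt_eqF.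
  rewrite ler_piMr ?mulr_ge0//; [lra|exact: ltW|nra].
lra.
Qed.

Lemma continuous_rate s : 1 < s -> {for s, continuous rate}.
Proof.
move=> s1; have s0 : 0 < s by lra.
have h : 0 < (1 + s) / 2 by lra.
have u : s - 1 != 0 by rewrite gt_eqF//; lra.
by rewrite /prop_for /continuous_at /rate /multiplier; cvg_rules.
Qed.

Lemma kb_system_exists r : 0 < r -> r <= r_c rho ->
  exists k b, [/\ k <= k_c rho, 0 < b & kb_system rho r k b].
Proof.
move=> r0 rc; have ri : 0 < rho^-1 by rewrite invr_gt0.
(* The left end [1 + h] must be at most 2 for [rate_le], at most the right end [1 + 2 * t], and have
   rate at most [r]; the right end has rate [r_c rho]. *)
pose h := Num.min (Num.min 1 (2 * t)) (r / (1 + rho^-1)).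
have h0 : 0 < h.
  by rewrite !lt_min ltr01 mulr_gt0//= divr_gt0//; lra.
have /andP[h1 h2] : (h <= 1) && (h <= 2 * t) by rewrite -le_min ge_min lexx.
have h3 : h * (1 + rho^-1) <= r.
  by rewrite -ler_pdivlMr; [rewrite ge_min lexx orbT|lra].
clearbody h; have [s] : exists2 s, s \in `[1 + h, 1 + 2 * t] & rate s = r.
  apply: IVT; first by lra.
    apply: continuous_in_subspaceT => s; rewrite inE/= in_itv/= => /andP[s1 _].
    by apply: continuous_rate; lra.
  have : rate (1 + h) <= r.
    apply: le_trans (rate_le _ _) _; [lra|lra|].
    by have -> : 1 + h - 1 = h by ring.
  rewrite rate_r_c => h4; rewrite ge_min h4/= le_max rc orbT//.
rewrite in_itv/= => /andP[s1 s2] <-.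
have s1' : 1 < s by lra.
exists (multiplier s), (edge s); split.
- exact: multiplier_le.
- by rewrite /edge divr_gt0// subr_gt0; nra.
- exact: kb_system_rate.
Qed.

Lemma kb_system_bound r k b : k <= k_c rho -> 0 < b -> kb_system rho r k b ->
  k * rho <= Num.sqrt (1 + rho * b).
Proof.
move=> kc b0 [kE _].
have rb : 0 < rho * b by rewrite mulr_gt0.
have s1 : 1 < Num.sqrt (1 + rho * b).
  by rewrite -[X in X < _]sqrtr1 ltr_sqrt; lra.
have kM : k = multiplier (Num.sqrt (1 + rho * b)).
  have [-> _] := kb_system_rate s1.
  by rewrite edge_sqrt.
by rewrite kM; apply: multiplier_le_edge; rewrite -?kM.
Qed.

(** The second equation of the system is the constraint on [p], with [ln (1 + rho * b)] in place of
    [2 * ln s]. *)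
Lemma kb_system_log_moment r k b : 0 < b -> kb_system rho r k b ->
  opt_log_moment rho k b = r.
Proof.
move=> b0 [_ ->]; have rb : 0 < rho * b by rewrite mulr_gt0.
have lnE : ln (Num.sqrt (1 + rho * b)) = ln (1 + rho * b) / 2.
  have h : 0 < 1 + rho * b by lra.
  rewrite -[in RHS](sqr_sqrtr (ltW h)) expr2 lnM ?posrE ?sqrtr_gt0//.
  by field.
by rewrite /opt_log_moment /log_mean lnE; field; rewrite gt_eqF.
Qed.

Lemma opt_energy_excess r k b : 0 < b -> kb_system rho r k b ->
  opt_energy rho k b - 3 / 2 =
  k / 2 * (r - b / 4) - ln (b / 4) - k * ln ((1 + Num.sqrt (1 + rho * b)) / 2)
  + 1 / 32 * (b - 4) * (4 * rho^-1 + 3 * b + 12).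
Proof.
move=> b0 sys; rewrite /opt_energy (kb_system_log_moment b0 sys) /opt_level /opt_moment.
have [kE _] := sys.
have rb : 0 < rho * b by rewrite mulr_gt0.
have s1 : 1 < Num.sqrt (1 + rho * b).
  by rewrite -[X in X < _]sqrtr1 ltr_sqrt; lra.
have bE := edge_sqrt b0; move: kE bE s1; rewrite /edge.
move: (ln (b / 4)) (ln _) => l1 l2; move: (Num.sqrt _) => s kE bE s1.
have s0 : 0 < s by lra.
have u0 : 0 < s - 1 by lra.
rewrite kE -bE; field; rewrite !gt_eqF//.
Qed.

End parameters.

Theorem mainTheorem3 (R : realType) (rho : R) (rho_gt0 : 0 < rho)
    (r : R) (r_gt0 : 0 < r) (r_le : r <= r_c rho) :
  (exists k b : R, [/\ k <= k_c rho, 0 < b & kb_system rho r k b]) /\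
  (forall k b : R, k <= k_c rho -> 0 < b -> kb_system rho r k b ->
    unique_minimizer (energy 1) (densities_at rho r) (opt_density rho k b) /\
    (E1 1 rho r - E0 1)%E =
    (k / 2 * (r - b / 4) - ln (b / 4)
     - k * ln ((1 + Num.sqrt (1 + rho * b)) / 2)
     + 1 / 32 * (b - 4) * (4 * rho^-1 + 3 * b + 12))%:E).
Proof.
split; first exact: kb_system_exists.
move=> k b kc b0 sys.
have krs := kb_system_bound rho_gt0 kc b0 sys; have [kE _] := sys.
rewrite -(opt_energy_excess rho_gt0 b0 sys) -(kb_system_log_moment rho_gt0 b0 sys).
split; first exact: minimizer_opt_density.
by rewrite E1_opt_density// E0_value.
Qed.
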